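(* Let $1<\alpha<2$, $m>0$, and $H_0=(-\Delta+m^{2/\alpha})^{\alpha/2}-m$ on $L^2(\mathbb{R}^3)$. Let $V:\mathbb{R}^3\to\mathbb{R}$, $V\le 0$, be such that for some $s>1$ $$\big\|\langle x\rangle^s|V|^{1/2}\big\|_\infty<\big\|\langle x\rangle^{-s}R(\pm i0)\langle x\rangle^{-s}\big\|^{-1/2}.$$ Then $H=H_0+V$ has no non-positive eigenvalue; in particular, zero is not an eigenvalue of $H$.
   Context: $\langle x\rangle=\sqrt{1+|x|^2}$. $H_0$ is the Fourier multiplier with symbol $(|\xi|^2+m^{2/\alpha})^{\alpha/2}-m$, and $R(z)=(H_0-z)^{-1}$ is its resolvent. For $s>1$, $\langle x\rangle^{-s}R(\pm i0)\langle x\rangle^{-s}$ denotes the operator norm limit on $L^2(\mathbb{R}^3)$ of $\langle x\rangle^{-s}R(z)\langle x\rangle^{-s}$ as $z=\pm i\epsilon\to 0$, $\epsilon\downarrow 0$; both limits exist and coincide with the bounded operator $\langle x\rangle^{-s}H_0^{-1}\langle x\rangle^{-s}$. The norm on the right-hand side is the operator norm on $L^2(\mathbb{R}^3)$. $H$ is self-adjoint on $\mathrm{Dom}(H_0)$. *)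

(* Defs.v *)
From HB Require Import structures.
From mathcomp Require Export all_boot all_order all_algebra.
From mathcomp Require Export all_classical all_reals all_analysis.
From mathcomp Require Export complex.

Set Implicit Arguments.
Unset Strict Implicit.
Unset Printing Implicit Defensive.

Import Order.TTheory GRing.Theory Num.Theory.
Import numFieldNormedType.Exports.

Local Open Scope classical_set_scope.
Local Open Scope ring_scope.
Local Open Scope complex_scope.

Section Space.
Context {R : realType}.

Definition R2 : Type := (measurableTypeR R * measurableTypeR R)%type.
Definition R3 : Type := (R2 * measurableTypeR R)%type.
HB.instance Definition _ := Measurable.on R2.
HB.instance Definition _ := Measurable.on R3.

Definition mu2 : set R2 -> \bar R :=
  (@lebesgue_measure R \x @lebesgue_measure R)%E.
HB.instance Definition _ := Measure.on mu2.

(* The sigma-finite instance on products is not found by unification in the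
   library, so it is redone here; Fubini's theorem on mu3 needs it. *)
Let mu2_sigma_finite : sigma_finite setT mu2.
Proof.
have /sigma_finiteP[F [TF ndF Foo]] := sigma_finiteT (@lebesgue_measure R).
exists (fun n => F n `*` F n).
  rewrite -setXTT TF predeqE => -[x y]; split.
    move=> [/= [n _ Fnx] [k _ Gky]]; exists (maxn n k) => //; split.
    - by move: x Fnx; exact/subsetPset/ndF/leq_maxl.
    - by move: y Gky; exact/subsetPset/ndF/leq_maxr.
  by move=> [n _ []/= ? ?]; split; exists n.
move=> k; have [? ?] := Foo k.
split; first exact: measurableX.
by rewrite /mu2 product_measure1E// lte_mul_pinfty// ge0_fin_numE.
Qed.
HB.instance Definition _ := Measure_isSigmaFinite.Build _ _ _ mu2
  mu2_sigma_finite.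

Definition mu3 : set R3 -> \bar R := (mu2 \x @lebesgue_measure R)%E.
HB.instance Definition _ := Measure.on mu3.

Let mu3_sigma_finite : sigma_finite setT mu3.
Proof.
have /sigma_finiteP[F [TF ndF Foo]] := sigma_finiteT mu2.
have /sigma_finiteP[G [TG ndG Goo]] := sigma_finiteT (@lebesgue_measure R).
exists (fun n => F n `*` G n).
  rewrite -setXTT TF TG predeqE => -[x y]; split.
    move=> [/= [n _ Fnx] [k _ Gky]]; exists (maxn n k) => //; split.
    - by move: x Fnx; exact/subsetPset/ndF/leq_maxl.
    - by move: y Gky; exact/subsetPset/ndG/leq_maxr.
  by move=> [n _ []/= ? ?]; split; exists n.
move=> k; have [? ?] := Foo k; have [? ?] := Goo k.
split; first exact: measurableX.
by rewrite /mu3 product_measure1E// lte_mul_pinfty// ge0_fin_numE.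
Qed.
HB.instance Definition _ := Measure_isSigmaFinite.Build _ _ _ mu3
  mu3_sigma_finite.

Definition dot3 (x y : R3) : R :=
  x.1.1 * y.1.1 + x.1.2 * y.1.2 + x.2 * y.2.

Definition japanese (x : R3) : R := Num.sqrt (1 + dot3 x x).

(* Elements of L^2(R^3; C) are represented by functions, and equality in L^2 by
   [aeq]. *)
Definition aeq (f g : R3 -> R[i]) : Prop := {ae mu3, forall x, f x = g x}.

Definition cmeasurable (f : R3 -> R[i]) : Prop :=
  measurable_fun [set: R3] (fun x => complex.Re (f x)) /\
  measurable_fun [set: R3] (fun x => complex.Im (f x)).

Definition L1norm (f : R3 -> R[i]) : \bar R :=
  ('N[mu3]_1[EFin \o (fun x => Normc.normc (f x))])%E.

Definition L2norm (f : R3 -> R[i]) : \bar R :=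
  ('N[mu3]_(2%:E)[EFin \o (fun x => Normc.normc (f x))])%E.

Definition inL1 (f : R3 -> R[i]) : Prop := cmeasurable f /\ (L1norm f < +oo)%E.

Definition inL2 (f : R3 -> R[i]) : Prop := cmeasurable f /\ (L2norm f < +oo)%E.

Definition cintegral (f : R3 -> R[i]) : R[i] :=
  Rintegral mu3 [set: R3] (fun x => complex.Re (f x)) +i*
  Rintegral mu3 [set: R3] (fun x => complex.Im (f x)).

(* (2 pi)^(-3/2) \int exp(- i x.xi) f(x) dx, for integrable f; with this
   convention - Delta has symbol |xi|^2. *)
Definition fourierL1 (f : R3 -> R[i]) (xi : R3) : R[i] :=
  ((2 * pi) `^ (- (3 / 2)))%:C *
  cintegral (fun x => (cos (dot3 x xi) -i* sin (dot3 x xi)) * f x).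

(* [fh] is the Fourier transform of [f] on L^2, i.e. the value at [f] of the
   continuous extension to L^2 of [fourierL1] on the dense subspace
   L^1 \cap L^2. *)
Definition fourierL2 (f fh : R3 -> R[i]) : Prop :=
  [/\ inL2 f, inL2 fh &
    exists u : nat -> R3 -> R[i],
      [/\ forall n, inL1 (u n) /\ inL2 (u n),
          (fun n => L2norm (fun x => u n x - f x)) @ \oo --> 0%E &
          (fun n => L2norm (fun x => fourierL1 (u n) x - fh x)) @ \oo --> 0%E]].

(* A possibly unbounded operator T on L^2 is represented by its graph:
   [T f g] means that f is in Dom T and T f = g. *)
Definition graph : Type := (R3 -> R[i]) -> (R3 -> R[i]) -> Prop.

(* The condition on [g] contains the domain condition a fh \in L^2. *)
Definition fourier_multiplier (a : R3 -> R) : graph := fun f g =>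
  exists fh, fourierL2 f fh /\ fourierL2 g (fun xi => (a xi)%:C * fh xi).

Definition H0 (alpha m : R) : graph :=
  fourier_multiplier
    (fun xi => (dot3 xi xi + m `^ (2 / alpha)) `^ (alpha / 2) - m).

(* Dom (T + V) = Dom T, which is the operator sum when V is bounded. *)
Definition add_potential (T : graph) (V : R3 -> R) : graph := fun f g =>
  exists h, T f h /\ aeq g (fun x => h x + (V x)%:C * f x).

Definition is_eigenvalue (T : graph) (lambda : R[i]) : Prop :=
  exists f, ~ aeq f (fun=> 0) /\ T f (fun x => lambda * f x).

(* (T - z)^-1 f, where defined *)
Definition resolvent (T : graph) (z : R[i]) (f : R3 -> R[i]) : R3 -> R[i] :=
  xget (fun=> 0)
    [set g | exists h, T g h /\ aeq f (fun x => h x - z * g x)].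

Definition opnorm (K : (R3 -> R[i]) -> (R3 -> R[i])) : \bar R :=
  ereal_sup [set L2norm (K f) | f in [set f | inL2 f /\ (L2norm f <= 1)%E]].

Definition bounded_operator (K : (R3 -> R[i]) -> (R3 -> R[i])) : Prop :=
  [/\ forall f, inL2 f -> inL2 (K f),
      forall (a : R[i]) f g, inL2 f -> inL2 g ->
        aeq (K (fun x => a * f x + g x)) (fun x => a * K f x + K g x) &
      (opnorm K < +oo)%E].

Definition weight (s : R) (f : R3 -> R[i]) : R3 -> R[i] :=
  fun x => (japanese x `^ s)%:C * f x.

Definition weighted_resolvent (T : graph) (s : R) (z : R[i])
    (f : R3 -> R[i]) : R3 -> R[i] :=
  weight (- s) (resolvent T z (weight (- s) f)).

(* K is the bounded operator <x>^-s R(+i0) <x>^-s if [sgn = false], and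
   <x>^-s R(-i0) <x>^-s if [sgn = true]. *)
Definition is_boundary_resolvent (T : graph) (s : R) (sgn : bool)
    (K : (R3 -> R[i]) -> (R3 -> R[i])) : Prop :=
  bounded_operator K /\
  (fun eps : R => opnorm (fun f x =>
     weighted_resolvent T s (0 +i* ((-1) ^+ sgn * eps)) f x - K f x))
    @ 0^'+ --> 0%E.

End Space.
Arguments R2 R : clear implicits.
Arguments R3 R : clear implicits.

(* Main.v *)
(* Let [f] be an eigenfunction for [E <= 0], [a] the symbol of [H0], [g = |V| f] and
   [u = <x>^s g].  Then [(a - E) fh] is the Fourier transform of [g], so by the
   Plancherel theorem [<f, g>] is the integral of [(a - E) |fh|^2].  For small
   [eps], up to a term vanishing by dominated convergence, this is at most
   [Re <R(+-i eps) g, g>] because [E <= 0], and that converges to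
   [Re <K u, u> <= |K| |u|^2].  With [B = |<x>^s |V|^(1/2)|_oo], also
   [|u|^2 <= B^2 <f, g>], which forces [u = 0] when [B^2 |K| < 1];
   then [(a - E) fh = 0], and [f = 0] as [a > 0] almost everywhere.

   The Plancherel theorem is proved on [L^1] and [L^2] by inserting the factor
   [exp(-d (|xi_1| + |xi_2| + |xi_3|))], whose transform is a product of Poisson
   kernels.  The Schur test gives the inequality.  Equality holds for boxes by
   concentration of the kernels, and the parallelogram law makes it stable under
   sums and limits, hence it spreads to all functions by the pi-lambda theorem. *)
Require Import Defs.
From HB Require Import structures.
From mathcomp Require Import measurable_realfun simple_functions measurable_fun_approximation ess_sup_inf.
From mathcomp Require Import finmap ring lra.

Set Implicit Arguments.
Unset Strict Implicit.
Unset Printing Implicit Defensive.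

Import Order.TTheory GRing.Theory Num.Theory.
Import numFieldNormedType.Exports.
Local Open Scope classical_set_scope.
Local Open Scope ring_scope.
Local Open Scope complex_scope.

(** * Integrals over product spaces *)

(** The hypothesis controls the resolvent near z = 0 only, whereas E may be negative. The equation
    (H_0 - E) f = |V| f is therefore tested against the resolvent at +-i eps, not at E +- i eps: the
    symbol is nonnegative, so trading E for 0 can only enlarge the quadratic form. A second obstacle
    is that [resolvent] is a total function with default value 0, so a priori H_0 - z may miss the
    function that it is applied to. That this function is reached is deduced from the convergence to
    K, from the linearity of K and from the positivity of its norm. Since [opnorm] is a supremum
    over the unit ball, the eigenfunction is rescaled to |u| = 1 before it meets K. Fourier
    transforms act on real parts of inner products, which polarisation recovers from equality of
    norms. The exponential factor in the Plancherel theorem makes the integrals in xi absolutely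
    convergent. It splits over the coordinates, and its one-dimensional transform is a rational
    function found from an explicit antiderivative, so the work on the kernel is calculus in one
    variable. *)

Section partial_integrals.
Context d1 d2 (X : measurableType d1) (Y : measurableType d2) (R : realType).
Variables (mu : {sigma_finite_measure set X -> \bar R})
  (nu : {sigma_finite_measure set Y -> \bar R}).

(** The integral of a signed function is the difference of the integrals of its positive and
    negative parts, which are measurable in [y] by Tonelli; slices that are not integrable are
    covered too. *)
Lemma measurable_integral_snd (H : X * Y -> R) : measurable_fun setT H ->
  measurable_fun setT (fun y => \int[mu]_x (H (x, y))%:E)%E.
Proof.
move=> mH; have mEH : measurable_fun setT (EFin \o H) by exact/measurable_EFinP.
rewrite [X in measurable_fun _ X](_ : _ = fun y =>
  (\int[mu]_x ((EFin \o H)^\+%E (x, y)) - \int[mu]_x ((EFin \o H)^\-%E (x, y)))%E).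
  apply: emeasurable_funB.
    apply: (measurable_fun_fubini_tonelli_G ((EFin \o H)^\+)%E) => //.
    exact: measurable_funepos.
  apply: (measurable_fun_fubini_tonelli_G ((EFin \o H)^\-)%E) => //.
  exact: measurable_funeneg.
apply/funext => y; rewrite -[LHS]/(\int[mu]_x (EFin \o H) (x, y))%E [LHS]integralE.
under eq_integral do rewrite funepos_comp/=.
by under [X in (_ - X)%E = _]eq_integral do rewrite funeneg_comp/=.
Qed.

Lemma measurable_Rintegral_snd (H : X * Y -> R) : measurable_fun setT H ->
  measurable_fun setT (fun y => \int[mu]_x H (x, y)).
Proof.
move=> mH.
exact: measurableT_comp (fine_measurable (R:=R) measurableT) (measurable_integral_snd mH).
Qed.

(** A majorant of product form makes every slice integrable, not merely almost every one, so the
    inner integrals are genuine real numbers and [fine] loses nothing. *)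
Lemma dominated_Fubini (H : X * Y -> R) (G : X -> R) (W : Y -> R) :
  measurable_fun setT H ->
  mu.-integrable setT (EFin \o G) -> nu.-integrable setT (EFin \o W) ->
  (forall x y, `|H (x, y)| <= G x * W y) ->
  [/\ forall x, nu.-integrable setT (fun y => (H (x, y))%:E),
      forall y, mu.-integrable setT (fun x => (H (x, y))%:E) &
      (\int[mu]_x (\int[nu]_y H (x, y))%R%:E =
       \int[nu]_y (\int[mu]_x H (x, y))%R%:E)%E].
Proof.
move=> mH iG iW HGW; have mEH : measurable_fun setT (EFin \o H) by exact/measurable_EFinP.
have iH1 x : nu.-integrable setT (fun y => (H (x, y))%:E).
  apply: (@le_integrable _ _ _ nu _ measurableT _ (fun y => (G x)%:E * (W y)%:E)%E).
  - exact: measurableT_comp mEH _.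
  - by move=> y _ /=; rewrite lee_fin (le_trans (HGW x y))// ler_norm.
  - exact: (integrableZl measurableT (G x) iW).
have iH2 y : mu.-integrable setT (fun x => (H (x, y))%:E).
  apply: (@le_integrable _ _ _ mu _ measurableT _ (fun x => (G x)%:E * (W y)%:E)%E).
  - exact: measurableT_comp mEH _.
  - by move=> x _ /=; rewrite lee_fin (le_trans (HGW x y))// ler_norm.
  - exact: (integrableZr measurableT (W y) iG).
split => //.
have E1 x : (\int[nu]_y H (x, y))%:E = (\int[nu]_y (EFin \o H) (x, y))%E.
  by rewrite /Rintegral fineK//; exact: integrable_fin_num (iH1 x).
have E2 y : (\int[mu]_x H (x, y))%:E = (\int[mu]_x (EFin \o H) (x, y))%E.
  by rewrite /Rintegral fineK//; exact: integrable_fin_num (iH2 y).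
under eq_integral do rewrite E1; under [RHS]eq_integral do rewrite E2.
apply: Fubini; apply/integrable12ltyP => //.
have mG : measurable_fun setT (fun x => `|(G x)%:E|%E).
  by apply: measurableT_comp => //; case/integrableP: iG.
have mW : measurable_fun setT (fun y => `|(W y)%:E|%E).
  by apply: measurableT_comp => //; case/integrableP: iW.
apply: (@le_lt_trans _ _ (\int[mu]_x (`|(G x)%:E| * \int[nu]_y `|(W y)%:E|))%E).
  apply: ge0_le_integral => //.
  - by move=> x _; exact: integral_ge0.
  - apply: (measurable_fun_fubini_tonelli_F (abse \o (EFin \o H))) => //=.
    exact: measurableT_comp.
  - exact: emeasurable_funM.
  - move=> x _; rewrite -ge0_integralZl//.
    apply: ge0_le_integral => //.
    + by apply: measurableT_comp => //; exact: measurableT_comp mEH _.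
    + exact: measurable_funeM.
    + move=> y _ /=; rewrite lee_fin (le_trans (HGW x y))// -normrM.
      exact: ler_norm.
rewrite ge0_integralZr//; last exact: integral_ge0.
case/integrableP: iG => _ ?; case/integrableP: iW => _ ?.
by rewrite lte_mul_pinfty// ?integral_ge0// ge0_fin_numE ?integral_ge0.
Qed.

End partial_integrals.

(** The square of an integral is a double integral, and domination lets the [y]-integral move
    inside. For [F1], [F2] the real and imaginary parts of the Fourier integrand, this turns a
    weighted norm of the transform into a quadratic form whose kernel is the transform of the
    weight. *)
Lemma integral_sqrD_partial d1 d2 (X : measurableType d1) (Y : measurableType d2)
    (R : realType) (mu : {sigma_finite_measure set X -> \bar R})
    (nu : {sigma_finite_measure set Y -> \bar R})
    (F1 F2 : X * Y -> R) (G : X -> R) (w : Y -> R) :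
  measurable_fun setT F1 -> measurable_fun setT F2 ->
  mu.-integrable setT (EFin \o G) -> nu.-integrable setT (EFin \o w) ->
  (forall y, 0 <= w y) ->
  (forall x y, `|F1 (x, y)| <= G x) -> (forall x y, `|F2 (x, y)| <= G x) ->
  (\int[nu]_y (w y * ((\int[mu]_x F1 (x, y)) ^+ 2 +
                       (\int[mu]_x F2 (x, y)) ^+ 2))%R%:E =
   \int[mu]_x \int[mu]_x' (\int[nu]_y
     (w y * (F1 (x, y) * F1 (x', y) + F2 (x, y) * F2 (x', y))))%R%:E)%E.
Proof.
move=> mF1 mF2 iG iw w0 FG1 FG2.
have G0 x : 0 <= G x by rewrite (le_trans _ (FG1 x point)).
have mw : measurable_fun setT w by apply/measurable_EFinP; case/integrableP: iw.
have iF (F : X * Y -> R) : measurable_fun setT F -> (forall x y, `|F (x, y)| <= G x) ->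
    forall y, mu.-integrable setT (fun x => (F (x, y))%:E).
  move=> mF FG y; apply: le_integrable iG => //.
    by apply/measurable_EFinP; exact: measurableT_comp mF _.
  by move=> x _ /=; rewrite lee_fin (le_trans (FG x y))// ler_norm.
pose C := \int[mu]_x G x.
have C0 : 0 <= C by exact: Rintegral_ge0.
have PC (F : X * Y -> R) : measurable_fun setT F -> (forall x y, `|F (x, y)| <= G x) ->
    forall y, `|\int[mu]_x F (x, y)| <= C.
  move=> mF FG y; rewrite (le_trans (le_normr_Rintegral measurableT (iF F mF FG y)))//.
  by apply: le_Rintegral => //; exact: integrable_norm (iF F mF FG y).
have iCw (c : R) : nu.-integrable setT (EFin \o (fun y => c * w y)).
  exact: (integrableZl measurableT c iw).
pose P1 y := \int[mu]_x F1 (x, y); pose P2 y := \int[mu]_x F2 (x, y).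
have mP1 : measurable_fun setT P1 by exact: measurable_Rintegral_snd.
have mP2 : measurable_fun setT P2 by exact: measurable_Rintegral_snd.
have RD y (a b : R) : \int[mu]_x (w y * (a * F1 (x, y) + b * F2 (x, y))) =
    w y * (a * P1 y + b * P2 y).
  have i1 : mu.-integrable setT (fun x => (a * F1 (x, y))%:E).
    exact: (integrableZl measurableT a (iF F1 mF1 FG1 y)).
  have i2 : mu.-integrable setT (fun x => (b * F2 (x, y))%:E).
    exact: (integrableZl measurableT b (iF F2 mF2 FG2 y)).
  rewrite RintegralZl//; last exact: (integrableD measurableT i1 i2).
  rewrite RintegralD// RintegralZl ?RintegralZl//; exact: iF.
have bound (u1 u2 v1 v2 : R) y a b : `|u1| <= a -> `|u2| <= a -> `|v1| <= b ->
    `|v2| <= b -> `|w y * (u1 * v1 + u2 * v2)| <= b * (2 * a * w y).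
  move=> u1a u2a v1b v2b; rewrite normrM (ger0_norm (w0 y)).
  have -> : b * (2 * a * w y) = w y * (a * b + a * b) by ring.
  apply: ler_wpM2l => //; rewrite (le_trans (ler_normD _ _))// lerD// normrM;
    exact: ler_pM.
(* One factor of each square stays the number [P1 y] or [P2 y], bounded by [C], while the other is
   expanded in [x]; the majorant is [G x] times [2 * C * w y]. *)
have [i1 i2 e12] : [/\ forall x, nu.-integrable setT
      (fun y => (w y * (P1 y * F1 (x, y) + P2 y * F2 (x, y)))%:E),
    forall y, mu.-integrable setT
      (fun x => (w y * (P1 y * F1 (x, y) + P2 y * F2 (x, y)))%:E) &
    (\int[mu]_x (\int[nu]_y (w y * (P1 y * F1 (x, y) + P2 y * F2 (x, y))))%R%:E =
     \int[nu]_y (\int[mu]_x (w y * (P1 y * F1 (x, y) + P2 y * F2 (x, y))))%R%:E)%E].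
  apply: (dominated_Fubini
      (H := fun xy => w xy.2 * (P1 xy.2 * F1 xy + P2 xy.2 * F2 xy)) _ iG
      (iCw (2 * C))) => [|x y] /=.
    apply: measurable_funM; first exact: measurableT_comp.
    by apply: measurable_funD; apply: measurable_funM => //; exact: measurableT_comp.
  by apply: bound; [exact: PC|exact: PC|exact: FG1|exact: FG2].
transitivity (\int[nu]_y (\int[mu]_x
    (w y * (P1 y * F1 (x, y) + P2 y * F2 (x, y))))%R%:E)%E.
  by apply: eq_integral => y _; rewrite RD !expr2.
rewrite -[LHS]e12; apply: eq_integral => x _.
(* Now [x] is frozen and the remaining factor is expanded in [x'], with majorant [G x'] times
   [2 * G x * w y]. *)
have [j1 j2 ->] : [/\ forall x', nu.-integrable setT
      (fun y => (w y * (F1 (x, y) * F1 (x', y) + F2 (x, y) * F2 (x', y)))%:E),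
    forall y, mu.-integrable setT
      (fun x' => (w y * (F1 (x, y) * F1 (x', y) + F2 (x, y) * F2 (x', y)))%:E) &
    (\int[mu]_x' (\int[nu]_y
       (w y * (F1 (x, y) * F1 (x', y) + F2 (x, y) * F2 (x', y))))%R%:E =
     \int[nu]_y (\int[mu]_x'
       (w y * (F1 (x, y) * F1 (x', y) + F2 (x, y) * F2 (x', y))))%R%:E)%E].
  apply: (dominated_Fubini (H := fun xy =>
      w xy.2 * (F1 (x, xy.2) * F1 xy + F2 (x, xy.2) * F2 xy)) _ iG
      (iCw (2 * G x))) => [|x' y] /=.
    have mFx (F : X * Y -> R) : measurable_fun setT F -> measurable_fun setT (fun xy : X * Y => F (x, xy.2)).
      move=> mF; have mFx : measurable_fun setT (fun y => F (x, y)).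
        exact: measurableT_comp mF _.
      exact: measurableT_comp mFx measurable_snd.
    apply: measurable_funM; first exact: measurableT_comp.
    by apply: measurable_funD; apply: measurable_funM => //; exact: mFx.
  exact: bound.
rewrite [LHS]fineK; last exact: integrable_fin_num (i1 x).
by apply: eq_integral => y _; rewrite RD (mulrC (P1 y)) (mulrC (P2 y)).
Qed.

Lemma ge0_integral_prod d1 d2 (X : measurableType d1) (Y : measurableType d2)
    (R : realType) (mu : {sigma_finite_measure set X -> \bar R})
    (nu : {sigma_finite_measure set Y -> \bar R}) (f : X -> R) (g : Y -> R) :
  measurable_fun setT f -> measurable_fun setT g ->
  (forall x, 0 <= f x) -> (forall y, 0 <= g y) ->
  (\int[mu \x nu]_z (f z.1 * g z.2)%:E =
   \int[mu]_x (f x)%:E * \int[nu]_y (g y)%:E)%E.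
Proof.
move=> mf mg f0 g0; rewrite fubini_tonelli1//=; first last.
- by move=> z; rewrite lee_fin mulr_ge0.
- by apply/measurable_EFinP; apply: measurable_funM; exact: measurableT_comp.
rewrite /fubini_F/=; under eq_integral do [under eq_integral do rewrite EFinM].
under eq_integral => x _.
  rewrite ge0_integralZl_EFin//; [over|by move=> y _; rewrite lee_fin|].
  exact/measurable_EFinP.
rewrite ge0_integralZr//; first exact/measurable_EFinP.
- by move=> x _; rewrite lee_fin.
- by apply: integral_ge0 => y _; rewrite lee_fin.
Qed.

Lemma integrable_prod d1 d2 (X : measurableType d1) (Y : measurableType d2)
    (R : realType) (mu : {sigma_finite_measure set X -> \bar R})
    (nu : {sigma_finite_measure set Y -> \bar R}) (f : X -> R) (g : Y -> R) :
  mu.-integrable setT (EFin \o f) -> nu.-integrable setT (EFin \o g) ->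
  (mu \x nu)%E.-integrable setT (EFin \o (fun z => f z.1 * g z.2)) /\
  \int[(mu \x nu)%E]_z (f z.1 * g z.2) = (\int[mu]_x f x) * (\int[nu]_y g y).
Proof.
move=> iF iG.
have mf : measurable_fun setT f by apply/measurable_EFinP; case/integrableP: iF.
have mg : measurable_fun setT g by apply/measurable_EFinP; case/integrableP: iG.
have ifg : (mu \x nu)%E.-integrable setT (EFin \o (fun z => f z.1 * g z.2)).
  apply/integrableP; split.
    by apply/measurable_EFinP; apply: measurable_funM; exact: measurableT_comp.
  under eq_integral do rewrite /= normrM.
  rewrite (ge0_integral_prod mu nu (f := fun x => `|f x|) (g := fun y => `|g y|))//;
    try exact: measurableT_comp.
  case/integrableP: iF => _ ?; case/integrableP: iG => _ ?.
  by rewrite lte_mul_pinfty// ?integral_ge0// ge0_fin_numE ?integral_ge0.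
split => //; rewrite {1}/Rintegral -integral12_prod_meas1// /fubini_F/=.
under eq_integral => x _.
  under eq_integral do rewrite EFinM.
  rewrite (integralZl measurableT iG (f x)).
  rewrite -(fineK (integrable_fin_num measurableT iG)).
  over.
by rewrite integralZr//= fineM//; exact: integrable_fin_num.
Qed.

(** * The Poisson kernel *)

Section poisson.
Context {R : realType}.
Notation leb := (@lebesgue_measure R).
Implicit Types (d t x y a b : R).

Lemma cvg_natSr : (n.+1%:R : R) @[n --> \oo] --> +oo.
Proof.
apply/cvgrnyP; rewrite [X in X @ _](_ : _ = fun n => n + 1)%N; first exact: cvg_addnr.
by apply/funext => n; rewrite addn1.
Qed.

Definition expdecay d x : R := expR (- (d * `|x|)).

Lemma expdecay_ge0 d x : 0 <= expdecay d x. Proof. exact: expR_ge0. Qed.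

Lemma expdecay_le1 d x : 0 <= d -> expdecay d x <= 1.
Proof. by move=> d0; rewrite -expR0 ler_expR oppr_le0 mulr_ge0. Qed.

Lemma continuous_expdecay d : continuous (expdecay d).
Proof.
move=> x; apply: (@continuous_comp _ _ _ (fun y => - (d * `|y|)) expR); last exact: continuous_expR.
apply: cvgN; apply: cvgM; [exact: cvg_cst|exact: norm_continuous].
Qed.

Lemma measurable_expdecay d : measurable_fun setT (expdecay d).
Proof. by apply: continuous_measurable_fun; apply: continuous_expdecay. Qed.

(** An antiderivative of (1 + cos (t x)) exp(- d x). The added 1 makes the integrand nonnegative, as
    the fundamental theorem of calculus on a half-line requires here; it is subtracted again
    later. *)
Let antideriv d t x : R := expR (- d * x) *
  (- d^-1 + (t * sin (t * x) - d * cos (t * x)) / (d ^+ 2 + t ^+ 2)).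

Let is_derive_antideriv d t x : 0 < d ->
  is_derive x 1 (antideriv d t) ((1 + cos (t * x)) * expR (- d * x)).
Proof.
move=> d0; have dt : d ^+ 2 + t ^+ 2 != 0.
  by rewrite gt_eqF// ltr_wpDr ?sqr_ge0// exprn_gt0.
have de : is_derive x 1 (fun y => expR (- d * y)) (- d * expR (- d * x)).
  by apply: is_derive_eq; rewrite /GRing.scale/=; ring.
have ds : is_derive x 1 (fun y => sin (t * y)) (t * cos (t * x)).
  by apply: is_derive_eq; rewrite /GRing.scale/=; ring.
have dc : is_derive x 1 (fun y => cos (t * y)) (- t * sin (t * x)).
  by apply: is_derive_eq; rewrite /GRing.scale/=; ring.
rewrite /antideriv.
apply: is_derive_eq; rewrite /GRing.scale/=; field.
by rewrite dt lt0r_neq0.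
Qed.

Let antideriv_cvg d t : 0 < d -> antideriv d t x @[x --> +oo] --> 0.
Proof.
move=> d0; pose C : R := d^-1 + (`|t| + d) / (d ^+ 2 + t ^+ 2).
have dt : 0 < d ^+ 2 + t ^+ 2 by rewrite ltr_wpDr ?sqr_ge0// exprn_gt0.
have e0 : expR (- d * x) @[x --> +oo] --> 0.
  rewrite (_ : (fun x => _) = (fun x => expR (- x)) \o ( *%R d)); last first.
    by apply/funext => x /=; rewrite mulNr.
  apply: (@cvg_comp _ _ _ _ _ _ (+oo)%R); last exact: cvgr_expR.
  by apply: gt0_cvgMry => //; exact: cvg_id.
have Ce0 : C * expR (- d * x) @[x --> +oo] --> 0.
  by rewrite -(mulr0 C); apply: cvgM => //; exact: cvg_cst.
apply: norm_cvg0.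
apply: (squeeze_cvgr (f := cst 0) (h := fun x => C * expR (- d * x))) => //;
  last exact: cvg_cst.
apply: nearW => x /=; rewrite normr_ge0 normrM (ger0_norm (expR_ge0 _)) mulrC.
apply: ler_wpM2r; first exact: expR_ge0.
rewrite (le_trans (ler_normD _ _))// lerD//; first by rewrite normrN gtr0_norm ?invr_gt0.
rewrite normrM (gtr0_norm (x := _^-1)) ?invr_gt0//.
apply: ler_wpM2r; first by rewrite invr_ge0 ltW.
rewrite (le_trans (ler_normB _ _))// lerD// normrM.
  by rewrite ler_piMr// ler_norml sin_geN1 sin_le1.
by rewrite gtr0_norm// ler_piMr ?(ltW d0)// ler_norml cos_geN1 cos_le1.
Qed.

Let integral_1Dcos d t : 0 < d ->
  (\int[leb]_x ((1 + cos (t * x)) * expdecay d x)%:E =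
   (2 * (d^-1 + d / (d ^+ 2 + t ^+ 2)))%:E)%E.
Proof.
move=> d0; have dt : 0 < d ^+ 2 + t ^+ 2 by rewrite ltr_wpDr ?sqr_ge0// exprn_gt0.
have cf : continuous (fun x => (1 + cos (t * x)) * expdecay d x).
  move=> x; apply: cvgM; last exact: continuous_expdecay.
  apply: cvgD; first exact: cvg_cst.
  apply: (@continuous_comp _ _ _ (fun y => t * y) cos); last exact: continuous_cos.
  exact: mulrl_continuous.
have f0 x : 0 <= (1 + cos (t * x)) * expdecay d x.
  by rewrite mulr_ge0 ?expR_ge0// -lerBlDl sub0r cos_geN1.
rewrite ge0_symfun_integralT//; last first.
  by move=> x /=; rewrite /expdecay normrN mulrN cosN.
rewrite -set_itvcy EFinM; congr (_ * _)%E.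
transitivity (\int[leb]_(x in `[0%R, +oo[) ((1 + cos (t * x)) * expR (- d * x))%:E)%E.
  apply: eq_integral => /= x /set_mem/=; rewrite in_itv/= andbT => x0.
  by rewrite /expdecay ger0_norm// mulNr.
rewrite (ge0_continuous_FTC2y _ _ (antideriv_cvg t d0))/=.
- rewrite /antideriv !mulr0 expR0 sin0 cos0 mul1r mulr0 mulr1 sub0r -EFinB.
  by congr EFin; field; rewrite !gt_eqF.
- by move=> x _; rewrite mulr_ge0 ?expR_ge0// -lerBlDl sub0r cos_geN1.
- apply: continuous_subspaceT => x; apply: cvgM.
    apply: cvgD; first exact: cvg_cst.
    apply: (@continuous_comp _ _ _ (fun y => t * y) cos); last exact: continuous_cos.
    exact: mulrl_continuous.
  apply: (@continuous_comp _ _ _ (fun y => - d * y) expR); last exact: continuous_expR.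
  exact: mulrl_continuous.
- by move=> x x0; case: (is_derive_antideriv t x d0).
- have := is_derive_antideriv t 0 d0 => -[/derivable1_diffP/differentiable_continuous + _].
  by move=> c; apply: cvg_at_right_filter; exact: c.
- by move=> x _; rewrite derive1E; case: (is_derive_antideriv t x d0).
Qed.

Let measurable_trig (f : R -> R) t : continuous f -> measurable_fun setT (fun x => f (t * x)).
Proof.
move=> cf; apply: continuous_measurable_fun => x.
apply: (@continuous_comp _ _ _ (fun y => t * y) f); last exact: cf.
exact: mulrl_continuous.
Qed.

Lemma integrable_expdecay d : 0 < d -> leb.-integrable setT (EFin \o expdecay d).
Proof.
move=> d0; apply/integrableP; split.
  by apply/measurable_EFinP; exact: measurable_expdecay.
(* At frequency 0 the integrand known in closed form is [2 * expdecay d x]. *)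
apply: (@le_lt_trans _ _ (\int[leb]_x ((1 + cos (0 * x)) * expdecay d x)%:E)%E).
  apply: ge0_le_integral => //.
  - apply/measurable_EFinP; apply: measurableT_comp => //; exact: measurable_expdecay.
  - apply/measurable_EFinP; apply: measurable_funM; last exact: measurable_expdecay.
    apply: measurable_funD => //; apply: measurable_trig; exact: continuous_cos.
  - move=> x _; rewrite /= lee_fin ger0_norm ?expdecay_ge0// mul0r cos0.
    by rewrite ler_peMl ?expdecay_ge0// lerDl.
by rewrite integral_1Dcos// ltry.
Qed.

Lemma integrable_cos_expdecay d t : 0 < d ->
  leb.-integrable setT (EFin \o (fun x => cos (t * x) * expdecay d x)).
Proof.
move=> d0; apply: le_integrable (integrable_expdecay d0) => //.
  apply/measurable_EFinP; apply: measurable_funM.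
    apply: measurable_trig; exact: continuous_cos.
  exact: measurable_expdecay.
move=> x _ /=; rewrite lee_fin normrM ler_piMl// ler_norml cos_geN1.
exact: cos_le1.
Qed.

Lemma integrable_sin_expdecay d t : 0 < d ->
  leb.-integrable setT (EFin \o (fun x => sin (t * x) * expdecay d x)).
Proof.
move=> d0; apply: le_integrable (integrable_expdecay d0) => //.
  apply/measurable_EFinP; apply: measurable_funM.
    apply: measurable_trig; exact: continuous_sin.
  exact: measurable_expdecay.
move=> x _ /=; rewrite lee_fin normrM ler_piMl// ler_norml sin_geN1.
exact: sin_le1.
Qed.

Lemma integral_cos_expdecay d t : 0 < d ->
  \int[leb]_x (cos (t * x) * expdecay d x) = 2 * d / (d ^+ 2 + t ^+ 2).
Proof.
move=> d0; have dt : d ^+ 2 + t ^+ 2 != 0.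
  by rewrite gt_eqF// ltr_wpDr ?sqr_ge0// exprn_gt0.
have I u : \int[leb]_x expdecay d x + \int[leb]_x (cos (u * x) * expdecay d x) =
    2 * (d^-1 + d / (d ^+ 2 + u ^+ 2)).
  rewrite -RintegralD//; [|exact: integrable_expdecay|exact: integrable_cos_expdecay].
  under eq_Rintegral do rewrite -{1}(mul1r (expdecay d _)) -mulrDl.
  by rewrite /Rintegral integral_1Dcos.
(* For [u = 0] both terms on the left of [I] are this integral; once known, it is removed from
   [I t]. *)
have I0 : \int[leb]_x expdecay d x = 2 / d.
  have := I 0; under [X in _ + X]eq_Rintegral do rewrite mul0r cos0 mul1r.
  rewrite expr0n addr0 => e; apply: (@mulfI _ 2) => //.
  by rewrite mulr_natl mulr2n e; field; rewrite gt_eqF.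
by have := I t; rewrite I0 => /(canRL (addKr _)) ->; field; rewrite dt lt0r_neq0.
Qed.

(** The integrand is odd and Lebesgue measure is invariant under reflection, so the integral equals
    its own opposite. *)
Lemma integral_sin_expdecay d t : 0 < d ->
  \int[leb]_x (sin (t * x) * expdecay d x) = 0.
Proof.
have aux (r : R) : r = - r -> r = 0 by move=> ?; lra.
move=> d0; pose g x := sin (t * x) * expdecay d x.
rewrite -[LHS]/(\int[leb]_x g x).
have ig : leb.-integrable setT (EFin \o g) by exact: integrable_sin_expdecay.
have mg : measurable_fun setT (EFin \o g) by case/integrableP: ig.
have mN : measurable_fun setT (-%R : R -> measurableTypeR R) by exact: oppr_measurable.
have gN : (EFin \o g) \o (-%R : R -> measurableTypeR R) = -%E \o (EFin \o g).
  by apply/funext => x /=; rewrite /g /expdecay mulrN sinN normrN mulNr.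
have : (\int[leb]_x (g x)%:E = - \int[leb]_x (g x)%:E)%E.
  rewrite -(integralN (D := setT)).
    rewrite -[RHS]/(\int[leb]_x ((-%E \o (EFin \o g)) x))%E -gN.
    have := @integral_pushforward _ _ (measurableTypeR R) (measurableTypeR R) R _ mN leb
      setT (EFin \o g) mg _ measurableT.
    rewrite preimage_setT gN => <-; last exact: integrableN.
    by apply: eq_measure_integral => A mA _; exact/esym/lebesgue_measureN.
  exact: integrable_add_def.
rewrite -(fineK (integrable_fin_num measurableT ig)) -EFinN => -[].
exact: aux.
Qed.

(** The Poisson kernel of the half-plane at height [d]; for [d > 0] the factor pi gives it total
    mass 1. *)
Definition poisson d x : R := d / (pi * (d ^+ 2 + x ^+ 2)).

Lemma poisson_ge0 d x : 0 <= d -> 0 <= poisson d x.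
Proof.
by move=> d0; rewrite divr_ge0// mulr_ge0 ?pi_ge0// addr_ge0// sqr_ge0.
Qed.

Lemma poissonN d x : poisson d (- x) = poisson d x.
Proof. by rewrite /poisson sqrrN. Qed.

Lemma integral_cos_poisson d t : 0 < d ->
  \int[leb]_x (cos (t * x) * expdecay d x) = 2 * pi * poisson d t.
Proof.
move=> d0; rewrite integral_cos_expdecay// /poisson.
have p0 : (pi : R) != 0 by rewrite gt_eqF ?pi_gt0.
have dt : d ^+ 2 + t ^+ 2 != 0 by rewrite gt_eqF// ltr_wpDr ?sqr_ge0 ?exprn_gt0.
by move: (pi : R) p0 => P P0; field; rewrite dt P0.
Qed.

Lemma continuous_poisson d : 0 < d -> continuous (poisson d).
Proof.
move=> d0 x; apply: cvgM; first exact: cvg_cst.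
apply: cvgV; first by rewrite mulf_neq0// gt_eqF ?pi_gt0 ?ltr_wpDr ?sqr_ge0 ?exprn_gt0.
apply: cvgM; first exact: cvg_cst.
by apply: cvgD; [exact: cvg_cst|exact: exprn_continuous].
Qed.

Lemma measurable_poisson d : 0 < d -> measurable_fun setT (poisson d).
Proof. by move=> d0; apply: continuous_measurable_fun; apply: continuous_poisson. Qed.

Lemma integral_poisson d x a b : 0 < d -> a < b ->
  (\int[leb]_(y in `[a, b]) (poisson d (x - y))%:E =
   ((atan ((b - x) / d) - atan ((a - x) / d)) / pi)%:E)%E.
Proof.
move=> d0 ab; pose F y : R := atan ((y - x) / d) / pi.
have p0 : (pi : R) != 0 by rewrite gt_eqF ?pi_gt0.
have d1 : d != 0 by rewrite gt_eqF.
have dF y : is_derive y 1 F (poisson d (x - y)).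
  rewrite /F; apply: is_derive_eq; rewrite /GRing.scale/= /poisson.
  have dt : d ^+ 2 + (x - y) ^+ 2 != 0.
    by rewrite gt_eqF// ltr_wpDr ?sqr_ge0 ?exprn_gt0.
  have dt' : d ^+ 2 + (y - x) ^+ 2 != 0.
    by rewrite gt_eqF// ltr_wpDr ?sqr_ge0 ?exprn_gt0.
  have dt'' : 1 + ((y - x) / d) ^+ 2 != 0 by rewrite gt_eqF// ltr_wpDr ?sqr_ge0.
  by move: (pi : R) p0 => P P0; field; rewrite dt P0 d1.
have cF : continuous F.
  by move=> y; case: (dF y) => /derivable1_diffP/differentiable_continuous.
have cp : continuous (fun y => poisson d (x - y)).
  move=> y; apply: (@continuous_comp _ _ _ (fun y => x - y) (poisson d)).
    by apply: cvgB; [exact: cvg_cst|exact: cvg_id].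
  exact: continuous_poisson.
rewrite (continuous_FTC2 ab (F := F)).
- by rewrite /F -EFinB -mulrBl.
- exact: continuous_subspaceT.
- split.
  + by move=> y _; case: (dF y).
  + by apply: cvg_at_right_filter; exact: cF.
  + by apply: cvg_at_left_filter; exact: cF.
- by move=> y _; rewrite derive1E; case: (dF y).
Qed.

Let atan_diff_le1 (u v : R) : (atan u - atan v) / pi <= 1.
Proof.
rewrite ler_pdivrMr ?pi_gt0// mul1r [leRHS]splitr lerD ?(ltW (atan_ltpi2 _))//.
by rewrite lerNl ltW// atan_gtNpi2.
Qed.

(** Over a bounded interval the integral is a difference of two arctangents divided by pi, hence at
    most 1; the intervals [[- n.+1, n.+1]] exhaust the line. *)
Lemma integral_poisson_le1 d x : 0 < d ->
  (\int[leb]_y (poisson d (x - y))%:E <= 1)%E.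
Proof.
move=> d0; pose F (n : nat) : set R := `[- n.+1%:R, n.+1%:R]%classic.
have FT : \bigcup_n F n = setT.
  rewrite -subTset => y _; exists (Num.trunc `|y|) => //=.
  by rewrite /F/= in_itv/= -ler_norml ltW// truncnS_gt.
have mp : measurable_fun setT (fun y => poisson d (x - y)).
  apply: (measurableT_comp (measurable_poisson d0)).
  by apply: measurable_funB.
have ndF : nondecreasing_seq F.
  move=> m n mn; apply/subsetPset; apply: subset_itv; rewrite bnd_simp.
    by rewrite lerN2 ler_nat.
  by rewrite ler_nat.
have := @ge0_nondecreasing_set_cvg_integral _ (measurableTypeR R) R F
  (EFin \o (fun y => poisson d (x - y))) leb ndF.
rewrite FT => cvgF; apply: (cvge_to_le (cvgF _ _ _)).
- by move=> n; exact: measurable_itv.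
- by move=> n; apply/measurable_EFinP; exact: measurable_funS mp.
- by move=> n y _ /=; rewrite lee_fin poisson_ge0// ltW.
- apply: nearW => n; rewrite integral_poisson ?lee_fin ?atan_diff_le1//.
  by rewrite (@lt_trans _ _ 0)// oppr_lt0.
Qed.

(** For [x] strictly between [a] and [b] the two arctangents tend to pi/2 and - pi/2, so the inner
    integral tends to 1, and it never exceeds 1: dominated convergence applies. *)
Lemma poisson_concentration a b : a < b ->
  (\int[leb]_(x in `[a, b]) \int[leb]_(y in `[a, b])
    (poisson n.+1%:R^-1 (x - y))%:E)%E @[n --> \oo] --> (b - a)%:E.
Proof.
move=> ab; pose g n x : R := (atan ((b - x) / n.+1%:R^-1) - atan ((a - x) / n.+1%:R^-1)) / pi.
have cg n : continuous (g n).
  move=> x; apply: cvgM; last exact: cvg_cst.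
  have cu (c : R) : (fun y => atan ((c - y) / n.+1%:R^-1)) @ x --> atan ((c - x) / n.+1%:R^-1).
    apply: (@continuous_comp _ _ _ (fun y => (c - y) / n.+1%:R^-1) atan); last exact: continuous_atan.
    apply: cvgM; last exact: cvg_cst.
    by apply: cvgB; [exact: cvg_cst|exact: cvg_id].
  exact: cvgB.
have mg n : measurable_fun setT (g n) by exact: continuous_measurable_fun.
(* The endpoints are dropped because the inner integral tends to 1/2 there, not to 1. *)
rewrite (_ : (fun n => _) = (fun n => \int[leb]_(x in `]a, b[) (g n x)%:E)%E); last first.
  apply/funext => n; rewrite -(integral_itv_bndoo true false); last first.
    by apply/measurable_EFinP; exact: measurable_funTS.
  by apply: eq_integral => x _; rewrite integral_poisson.
have : (\int[leb]_(x in `]a, b[) (1 : R)%:E = (b - a)%:E)%E.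
  by rewrite integral_cst//= mul1e lebesgue_measure_itv/= lte_fin ab.
move=> <-.
have [|||||_ _] := @dominated_convergence _ (measurableTypeR R) R leb `]a, b[ (measurable_itv _)
  (fun n x => (g n x)%:E) (cst 1%:E) (cst 1%:E).
- by move=> n; apply: measurable_funTS; apply/measurable_EFinP; exact: mg.
- exact: measurable_cst.
- apply/nearW => x /=; rewrite in_itv/= => /andP[ax xb].
  apply: cvg_EFin; first exact: nearW.
  rewrite [X in _ --> X](_ : 1 = (pi / 2 - - (pi / 2)) / pi); last first.
    by rewrite opprK -splitr divff// gt_eqF ?pi_gt0.
  apply: cvgM; last exact: cvg_cst.
  have atan_y (c : R) : 0 < c -> atan (c / n.+1%:R^-1) @[n --> \oo] --> pi / 2.
    move=> c0; apply: (@cvg_comp _ _ _ (fun n => c / n.+1%:R^-1) atan _ (+oo)%R); last exact: cvgy_atan.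
    under eq_fun do rewrite invrK.
    apply: (@cvg_comp _ _ _ (fun n => n.+1%:R : R) ( *%R c) _ (+oo)%R).
      exact: cvg_natSr.
    by apply: gt0_cvgMry => //; exact: cvg_id.
  apply: cvgB; first by apply: atan_y; rewrite subr_gt0.
  under eq_fun do rewrite -opprB mulNr atanN.
  by apply: cvgN; apply: atan_y; rewrite subr_gt0.
- apply/integrableP; split => //=.
  under eq_integral do rewrite normr1.
  by rewrite integral_cst//= mul1e lebesgue_measure_itv/= lte_fin ab ltry.
- apply/nearW => x n /= _; rewrite lee_fin ger0_norm ?atan_diff_le1//.
  rewrite divr_ge0 ?pi_ge0// subr_ge0; apply: le_atan.
  by rewrite ler_wpM2r// lerD2r ltW.
- by [].
Qed.

End poisson.

(** * Tensor products and the Poisson kernel in three dimensions *)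

Section space.
Context {R : realType}.
Notation leb := (@lebesgue_measure R).
Notation mu := (@mu3 R).
Implicit Types (x y xi : R3 R) (u v : R3 R -> R[i]) (d : R).

Lemma measurable_coord1 : measurable_fun setT (fun x => x.1.1 : R).
Proof. exact: (@measurableT_comp _ _ _ _ _ _ (@fst R R) _ (@fst (R2 R) R)). Qed.

Lemma measurable_coord2 : measurable_fun setT (fun x => x.1.2 : R).
Proof. exact: (@measurableT_comp _ _ _ _ _ _ (@snd R R) _ (@fst (R2 R) R)). Qed.

Lemma measurable_coord3 : measurable_fun setT (fun x => x.2 : R).
Proof. exact: (@measurable_snd _ _ (R2 R) (measurableTypeR R)). Qed.

Definition tensor (f1 f2 f3 : R -> R) x : R := f1 x.1.1 * f2 x.1.2 * f3 x.2.

Lemma measurable_tensor (f1 f2 f3 : R -> R) :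
  measurable_fun setT f1 -> measurable_fun setT f2 -> measurable_fun setT f3 ->
  measurable_fun setT (tensor f1 f2 f3).
Proof.
move=> m1 m2 m3; apply: measurable_funM; first apply: measurable_funM.
- exact: measurableT_comp m1 measurable_coord1.
- exact: measurableT_comp m2 measurable_coord2.
- exact: measurableT_comp m3 measurable_coord3.
Qed.

Lemma ge0_integral_tensor (f1 f2 f3 : R -> R) :
  measurable_fun setT f1 -> measurable_fun setT f2 -> measurable_fun setT f3 ->
  (forall t, 0 <= f1 t) -> (forall t, 0 <= f2 t) -> (forall t, 0 <= f3 t) ->
  (\int[mu]_x (tensor f1 f2 f3 x)%:E =
   \int[leb]_t (f1 t)%:E * \int[leb]_t (f2 t)%:E * \int[leb]_t (f3 t)%:E)%E.
Proof.
move=> m1 m2 m3 p1 p2 p3.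
rewrite -(ge0_integral_prod leb leb m1 m2 p1 p2).
apply: (ge0_integral_prod mu2 leb (f := fun z : R2 R => f1 z.1 * f2 z.2) _ m3 _ p3).
  apply: measurable_funM.
    exact: measurableT_comp m1 (@measurable_fst _ _ (measurableTypeR R) (measurableTypeR R)).
  exact: measurableT_comp m2 (@measurable_snd _ _ (measurableTypeR R) (measurableTypeR R)).
by move=> z; rewrite mulr_ge0.
Qed.

Lemma integrable_tensor (f1 f2 f3 : R -> R) :
  leb.-integrable setT (EFin \o f1) -> leb.-integrable setT (EFin \o f2) ->
  leb.-integrable setT (EFin \o f3) ->
  mu.-integrable setT (EFin \o tensor f1 f2 f3) /\
  \int[mu]_x tensor f1 f2 f3 x =
    (\int[leb]_t f1 t) * (\int[leb]_t f2 t) * (\int[leb]_t f3 t).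
Proof.
move=> i1 i2 i3; have [i12 <-] := integrable_prod i1 i2.
exact: (integrable_prod (mu := mu2) (nu := leb) i12 i3).
Qed.

Definition expdecay3 d : R3 R -> R := tensor (expdecay d) (expdecay d) (expdecay d).

Definition sub3 x y : R3 R := ((x.1.1 - y.1.1, x.1.2 - y.1.2), x.2 - y.2).

Definition poisson3 d : R3 R -> R := tensor (poisson d) (poisson d) (poisson d).

Lemma integrable_expdecay3 d : 0 < d -> mu.-integrable setT (EFin \o expdecay3 d).
Proof. by move=> d0; apply: (integrable_tensor _ _ _).1; exact: integrable_expdecay. Qed.

(** By the addition formulas the cosine and the sine of [dot3 x xi] are signed sums of four products
    of one-variable factors. A product containing a sine integrates to 0, so only the product of
    three cosines survives. *)
Lemma integral_trig_expdecay3 d x : 0 < d ->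
  [/\ mu.-integrable setT (fun xi => (expdecay3 d xi * cos (dot3 x xi))%:E),
      mu.-integrable setT (fun xi => (expdecay3 d xi * sin (dot3 x xi))%:E),
      \int[mu]_xi (expdecay3 d xi * cos (dot3 x xi)) = (2 * pi) ^+ 3 * poisson3 d x &
      \int[mu]_xi (expdecay3 d xi * sin (dot3 x xi)) = 0].
Proof.
move=> d0.
pose C t r := cos (t * r) * expdecay d r; pose S t r := sin (t * r) * expdecay d r.
have iC t : leb.-integrable setT (EFin \o C t) by exact: integrable_cos_expdecay.
have iS t : leb.-integrable setT (EFin \o S t) by exact: integrable_sin_expdecay.
have IC t : \int[leb]_r C t r = 2 * pi * poisson d t by exact: integral_cos_poisson.
have IS t : \int[leb]_r S t r = 0 by exact: integral_sin_expdecay.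
have [ccc Iccc] := integrable_tensor (iC x.1.1) (iC x.1.2) (iC x.2).
have [ssc Issc] := integrable_tensor (iS x.1.1) (iS x.1.2) (iC x.2).
have [scs Iscs] := integrable_tensor (iS x.1.1) (iC x.1.2) (iS x.2).
have [css Icss] := integrable_tensor (iC x.1.1) (iS x.1.2) (iS x.2).
have [scc Iscc] := integrable_tensor (iS x.1.1) (iC x.1.2) (iC x.2).
have [csc Icsc] := integrable_tensor (iC x.1.1) (iS x.1.2) (iC x.2).
have [ccs Iccs] := integrable_tensor (iC x.1.1) (iC x.1.2) (iS x.2).
have [sss Isss] := integrable_tensor (iS x.1.1) (iS x.1.2) (iS x.2).
have cE : (fun xi => expdecay3 d xi * cos (dot3 x xi)) = (fun xi =>
    (tensor (C x.1.1) (C x.1.2) (C x.2) xi - tensor (S x.1.1) (S x.1.2) (C x.2) xi) -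
    (tensor (S x.1.1) (C x.1.2) (S x.2) xi + tensor (C x.1.1) (S x.1.2) (S x.2) xi)).
  apply/funext => xi; rewrite /dot3 !(cosD, sinD) /expdecay3 /tensor /C /S.
  ring.
have sE : (fun xi => expdecay3 d xi * sin (dot3 x xi)) = (fun xi =>
    (tensor (S x.1.1) (C x.1.2) (C x.2) xi + tensor (C x.1.1) (S x.1.2) (C x.2) xi) +
    (tensor (C x.1.1) (C x.1.2) (S x.2) xi - tensor (S x.1.1) (S x.1.2) (S x.2) xi)).
  apply/funext => xi; rewrite /dot3 !(cosD, sinD) /expdecay3 /tensor /C /S.
  ring.
have ic1 := integrableB measurableT ccc ssc.
have ic2 := integrableD measurableT scs css.
have is1 := integrableD measurableT scc csc.
have is2 := integrableB measurableT ccs sss.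
rewrite -[fun xi => (expdecay3 d xi * cos (dot3 x xi))%:E]/
  (EFin \o (fun xi => expdecay3 d xi * cos (dot3 x xi))).
rewrite -[fun xi => (expdecay3 d xi * sin (dot3 x xi))%:E]/
  (EFin \o (fun xi => expdecay3 d xi * sin (dot3 x xi))).
rewrite cE sE; split.
- exact: (integrableB measurableT ic1 ic2).
- exact: (integrableD measurableT is1 is2).
- rewrite RintegralB// RintegralB// RintegralD// Iccc Issc Iscs Icss !IC !IS /poisson3 /tensor.
  by ring.
- rewrite RintegralD// RintegralD// RintegralB// Iscc Icsc Iccs Isss !IC !IS.
  by ring.
Qed.

End space.

(** * The Bessel inequality *)

Section energy.
Context {R : realType}.
Notation mu := (@mu3 R).
Implicit Types (x y xi : R3 R) (u v f g : R3 R -> R[i]) (z : R[i]) (d : R).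

Definition cnorm2 z : R := complex.Re z ^+ 2 + complex.Im z ^+ 2.

(** The square of [L2norm]. It is a plain integral and obeys the parallelogram law, which the whole
    passage to Plancherel rests on. *)
Definition energy f : \bar R := (\int[mu]_x (cnorm2 (f x))%:E)%E.

Lemma cnorm2_ge0 z : 0 <= cnorm2 z.
Proof. by rewrite addr_ge0 ?sqr_ge0. Qed.

Lemma normc_cnorm2 z : Normc.normc z ^+ 2 = cnorm2 z.
Proof. by case: z => a b; rewrite /Normc.normc sqr_sqrtr// addr_ge0 ?sqr_ge0. Qed.

Lemma normc_ge0 z : 0 <= Normc.normc z.
Proof. by case: z => a b; exact: sqrtr_ge0. Qed.

Lemma normcE z : Normc.normc z = Num.sqrt (cnorm2 z).
Proof. by case: z. Qed.

Lemma cnorm2_eq0 z : cnorm2 z = 0 -> z = 0.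
Proof. by move=> z0; apply: Normc.eq0_normc; rewrite normcE z0 sqrtr0. Qed.

Lemma cnorm2M z z' : cnorm2 (z * z') = cnorm2 z * cnorm2 z'.
Proof. by case: z => a b; case: z' => c e; rewrite /cnorm2/=; ring. Qed.

Lemma cnorm2_parallelogram z z' :
  cnorm2 (z + z') + cnorm2 (z - z') = 2 * cnorm2 z + 2 * cnorm2 z'.
Proof. by case: z => a b; case: z' => c e; rewrite /cnorm2/=; ring. Qed.

Lemma le_Re_normc z : `|complex.Re z| <= Normc.normc z.
Proof.
rewrite normcE -sqrtr_sqr ler_sqrt ?cnorm2_ge0//.
by rewrite /cnorm2 lerDl sqr_ge0.
Qed.

Lemma le_Im_normc z : `|complex.Im z| <= Normc.normc z.
Proof.
rewrite normcE -sqrtr_sqr ler_sqrt ?cnorm2_ge0//.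
by rewrite /cnorm2 lerDr sqr_ge0.
Qed.

Lemma measurable_cnorm2 f : cmeasurable f -> measurable_fun setT (fun x => cnorm2 (f x)).
Proof.
by move=> [mr mi]; apply: measurable_funD; exact: (measurable_funX 2).
Qed.

Lemma measurable_normc f : cmeasurable f ->
  measurable_fun setT (fun x => Normc.normc (f x)).
Proof.
move=> mf; rewrite (_ : (fun x => _) = (@powR R ^~ 2^-1) \o (fun x => cnorm2 (f x))).
  exact: measurableT_comp (measurable_powR _) (measurable_cnorm2 mf).
by apply/funext => x /=; rewrite powR12_sqrt ?cnorm2_ge0// normcE.
Qed.

Lemma measurable_ecnorm2 f : cmeasurable f ->
  measurable_fun setT (fun x => (cnorm2 (f x))%:E).
Proof. by move=> mf; apply/measurable_EFinP; exact: measurable_cnorm2. Qed.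

Lemma cmeasurableD f g : cmeasurable f -> cmeasurable g ->
  cmeasurable (fun x => f x + g x).
Proof.
move=> [f1 f2] [g1 g2]; split.
- rewrite (_ : (fun x => _) = (fun x => complex.Re (f x) + complex.Re (g x))).
    exact: measurable_funD.
  by apply/funext => x; case: (f x) => a b; case: (g x).
- rewrite (_ : (fun x => _) = (fun x => complex.Im (f x) + complex.Im (g x))).
    exact: measurable_funD.
  by apply/funext => x; case: (f x) => a b; case: (g x).
Qed.

Lemma cmeasurableM f g : cmeasurable f -> cmeasurable g ->
  cmeasurable (fun x => f x * g x).
Proof.
move=> [f1 f2] [g1 g2]; split.
- rewrite (_ : (fun x => _) = (fun x => complex.Re (f x) * complex.Re (g x) -
     complex.Im (f x) * complex.Im (g x))).
    by apply: measurable_funB; exact: measurable_funM.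
  by apply/funext => x; case: (f x) => a b; case: (g x).
- rewrite (_ : (fun x => _) = (fun x => complex.Re (f x) * complex.Im (g x) +
     complex.Im (f x) * complex.Re (g x))).
    by apply: measurable_funD; exact: measurable_funM.
  by apply/funext => x; case: (f x) => a b; case: (g x).
Qed.

Lemma cmeasurable_real (a : R3 R -> R) : measurable_fun setT a ->
  cmeasurable (fun x => (a x)%:C).
Proof. by move=> ma; split => //=; exact: measurable_cst. Qed.

Lemma cmeasurable_cst z : cmeasurable (fun=> z).
Proof. by split; exact: measurable_cst. Qed.

Lemma L2normE f : L2norm f = (energy f `^ 2^-1)%E.
Proof.
rewrite /L2norm unlock /energy; congr (_ `^ _)%E; apply: eq_integral => x _ /=.
by rewrite ger0_norm ?normc_ge0// powR_mulrn ?normc_ge0// normc_cnorm2.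
Qed.

Lemma energy_ge0 f : (0 <= energy f)%E.
Proof. by apply: integral_ge0 => x _; rewrite lee_fin cnorm2_ge0. Qed.

Lemma energy0 : energy (fun=> 0) = 0%E.
Proof.
by rewrite /energy; under eq_integral do rewrite /cnorm2/= expr0n addr0; exact: integral0.
Qed.

Lemma L2norm_energy f : (L2norm f `^ 2 = energy f)%E.
Proof. by rewrite L2normE -poweRrM mulVf// poweRe1// energy_ge0. Qed.

Lemma L2norm_lty f : (L2norm f < +oo)%E <-> (energy f < +oo)%E.
Proof.
split; last first.
  move=> fy; rewrite L2normE -(fineK (x := energy f)); last by rewrite ge0_fin_numE ?energy_ge0.
  by rewrite poweR_EFin ltry.
by rewrite L2normE; apply: lty_poweRy; rewrite invr_eq0.
Qed.

Lemma energyM (a : R[i]) f : cmeasurable f ->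
  energy (fun x => a * f x) = ((cnorm2 a)%:E * energy f)%E.
Proof.
move=> mf; rewrite /energy; under eq_integral do rewrite cnorm2M EFinM.
rewrite ge0_integralZl_EFin ?cnorm2_ge0//.
- by move=> x _; rewrite lee_fin cnorm2_ge0.
- exact: measurable_ecnorm2.
Qed.

Lemma energy_parallelogram f g : cmeasurable f -> cmeasurable g ->
  (energy (fun x => f x + g x)%R + energy (fun x => f x - g x)%R =
   2%:E * energy f + 2%:E * energy g)%E.
Proof.
move=> mf mg; rewrite /energy -ge0_integralD//; first last.
- apply: measurable_ecnorm2; apply: cmeasurableD => //.
  rewrite (_ : (fun x => _) = (fun x => (-1) * g x)).
    by apply: cmeasurableM => //; exact: cmeasurable_cst.
  by apply/funext => x; rewrite mulN1r.
- by move=> x _; rewrite lee_fin cnorm2_ge0.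
- by apply: measurable_ecnorm2; exact: cmeasurableD.
- by move=> x _; rewrite lee_fin cnorm2_ge0.
under eq_integral do rewrite -EFinD cnorm2_parallelogram EFinD !EFinM.
have c0 h x : (0 <= 2%:E * (cnorm2 (h x))%:E)%E by rewrite mule_ge0// lee_fin cnorm2_ge0.
rewrite ge0_integralD//; last 2 first.
- by apply: measurable_funeM; exact: measurable_ecnorm2.
- by apply: measurable_funeM; exact: measurable_ecnorm2.
by rewrite !ge0_integralZl_EFin//; by [exact: measurable_ecnorm2|move=> x _; rewrite lee_fin cnorm2_ge0].
Qed.

End energy.

(** * The Fourier transform on L^1 and its weighted norm *)

Section fourierL1.
Context {R : realType}.
Notation mu := (@mu3 R).
Implicit Types (x y xi : R3 R) (u v f g : R3 R -> R[i]) (z : R[i]) (d : R).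

Lemma inL1P f : inL1 f <->
  cmeasurable f /\ mu.-integrable setT (fun x => (Normc.normc (f x))%:E).
Proof.
split=> -[mf If]; split => //.
  apply/integrableP; split.
    by apply/measurable_EFinP; exact: measurable_normc.
  by rewrite /L1norm Lnorm1 in If.
by rewrite /L1norm Lnorm1; case/integrableP: If.
Qed.

Lemma integrable_Re_Im f : inL1 f ->
  mu.-integrable setT (fun x => (complex.Re (f x))%:E) /\
  mu.-integrable setT (fun x => (complex.Im (f x))%:E).
Proof.
move=> /inL1P[[mr mi] If]; split.
- apply: le_integrable If => //; first exact/measurable_EFinP.
  by move=> x _ /=; rewrite lee_fin (ger0_norm (normc_ge0 _)) le_Re_normc.
- apply: le_integrable If => //; first exact/measurable_EFinP.
  by move=> x _ /=; rewrite lee_fin (ger0_norm (normc_ge0 _)) le_Im_normc.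
Qed.

Lemma le_inL1 f g : cmeasurable f -> inL1 g ->
  (forall x, Normc.normc (f x) <= Normc.normc (g x)) -> inL1 f.
Proof.
move=> mf /inL1P[mg Ig] fg; apply/inL1P; split => //.
apply: le_integrable Ig => //.
  by apply/measurable_EFinP; exact: measurable_normc.
by move=> x _ /=; rewrite lee_fin !ger0_norm ?normc_ge0.
Qed.

Lemma inL1D f g : inL1 f -> inL1 g -> inL1 (fun x => f x + g x).
Proof.
move=> /inL1P[mf If] /inL1P[mg Ig]; apply/inL1P; split; first exact: cmeasurableD.
apply: le_integrable (integrableD measurableT If Ig) => //.
  by apply/measurable_EFinP; apply: measurable_normc; exact: cmeasurableD.
move=> x _ /=; rewrite lee_fin !ger0_norm ?normc_ge0 ?addr_ge0 ?normc_ge0//.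
exact: le_normcD.
Qed.

Lemma inL1Z z f : inL1 f -> inL1 (fun x => z * f x).
Proof.
move=> /inL1P[mf If]; have mzf : cmeasurable (fun x => z * f x).
  by apply: cmeasurableM => //; exact: cmeasurable_cst.
apply/inL1P; split => //.
apply: le_integrable (integrableZl measurableT (Normc.normc z) If) => //.
  by apply/measurable_EFinP; exact: measurable_normc.
by move=> x _ /=; rewrite lee_fin Normc.normcM.
Qed.

Lemma cintegralD f g : inL1 f -> inL1 g ->
  cintegral (fun x => f x + g x) = cintegral f + cintegral g.
Proof.
move=> /integrable_Re_Im[f1 f2] /integrable_Re_Im[g1 g2].
rewrite /cintegral; congr Complex.
- rewrite -RintegralD//; apply: eq_Rintegral => x _.
  by case: (f x) => a b; case: (g x).
- rewrite -RintegralD//; apply: eq_Rintegral => x _.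
  by case: (f x) => a b; case: (g x).
Qed.

Lemma cintegralZ z f : inL1 f ->
  cintegral (fun x => z * f x) = z * cintegral f.
Proof.
move=> /integrable_Re_Im[f1 f2]; case: z => a b.
have iZ c (h : R3 R -> R) : mu.-integrable setT (fun x => (h x)%:E) ->
    mu.-integrable setT (fun x => (c * h x)%:E).
  by move=> ih; exact: (integrableZl measurableT c ih).
rewrite /cintegral; congr Complex.
- rewrite -!RintegralZl// -RintegralB//; try exact: iZ.
  by apply: eq_Rintegral => x _; case: (f x).
- rewrite -!RintegralZl// -RintegralD//; try exact: iZ.
  by apply: eq_Rintegral => x _; case: (f x).
Qed.

Definition wave xi x : R[i] := cos (dot3 x xi) -i* sin (dot3 x xi).

Lemma cnorm2_wave xi x : cnorm2 (wave xi x) = 1.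
Proof. by rewrite /cnorm2/= sqrrN cos2Dsin2. Qed.

Lemma measurable_dot3 : measurable_fun setT (fun z : R3 R * R3 R => dot3 z.1 z.2).
Proof.
have m1 := @measurable_fst _ _ (R3 R) (R3 R).
have m2 := @measurable_snd _ _ (R3 R) (R3 R).
apply: measurable_funD; first apply: measurable_funD.
- apply: measurable_funM.
    exact: measurableT_comp measurable_coord1 m1.
  exact: measurableT_comp measurable_coord1 m2.
- apply: measurable_funM.
    exact: measurableT_comp measurable_coord2 m1.
  exact: measurableT_comp measurable_coord2 m2.
- apply: measurable_funM.
    exact: measurableT_comp measurable_coord3 m1.
  exact: measurableT_comp measurable_coord3 m2.
Qed.

Lemma measurable_cos_dot3 : measurable_fun setT (fun z : R3 R * R3 R => cos (dot3 z.1 z.2)).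
Proof.
by apply: measurableT_comp measurable_dot3; apply: continuous_measurable_fun; exact: continuous_cos.
Qed.

Lemma measurable_sin_dot3 : measurable_fun setT (fun z : R3 R * R3 R => sin (dot3 z.1 z.2)).
Proof.
by apply: measurableT_comp measurable_dot3; apply: continuous_measurable_fun; exact: continuous_sin.
Qed.

Lemma cmeasurable_wave xi : cmeasurable (wave xi).
Proof.
have mx : measurable_fun setT (fun x : R3 R => (x, xi)).
  exact: (@pair2_measurable _ _ (R3 R) (R3 R)).
split => /=; first exact: measurableT_comp measurable_cos_dot3 mx.
by apply: measurable_funN; exact: measurableT_comp measurable_sin_dot3 mx.
Qed.

Lemma inL1_wave xi f : inL1 f -> inL1 (fun x => wave xi x * f x).
Proof.
move=> If; have mf := If.1; apply: le_inL1 (If) _.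
  by apply: cmeasurableM => //; exact: cmeasurable_wave.
by move=> x; rewrite Normc.normcM [X in X * _]normcE cnorm2_wave sqrtr1 mul1r.
Qed.

Lemma fourierL1D f g xi : inL1 f -> inL1 g ->
  fourierL1 (fun x => f x + g x) xi = fourierL1 f xi + fourierL1 g xi.
Proof.
move=> If Ig; rewrite /fourierL1 -mulrDr -cintegralD; [|exact: inL1_wave|exact: inL1_wave].
by congr (_ * cintegral _); apply/funext => x; rewrite mulrDr.
Qed.

Lemma fourierL1Z z f xi : inL1 f ->
  fourierL1 (fun x => z * f x) xi = z * fourierL1 f xi.
Proof.
move=> If; rewrite /fourierL1 mulrCA -(cintegralZ z); last exact: inL1_wave.
by congr (_ * cintegral _); apply/funext => x; rewrite mulrCA.
Qed.

(** [F1 u] and [F2 u] are the real and imaginary parts of [wave xi x * u x] as functions of the pair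
    (x, xi). *)
Let F1 u (z : R3 R * R3 R) : R :=
  cos (dot3 z.1 z.2) * complex.Re (u z.1) + sin (dot3 z.1 z.2) * complex.Im (u z.1).
Let F2 u (z : R3 R * R3 R) : R :=
  cos (dot3 z.1 z.2) * complex.Im (u z.1) - sin (dot3 z.1 z.2) * complex.Re (u z.1).

Let mF1 u : cmeasurable u -> measurable_fun setT (F1 u).
Proof.
move=> [mr mi]; have m1 := @measurable_fst _ _ (R3 R) (R3 R).
apply: measurable_funD; apply: measurable_funM.
- exact: measurable_cos_dot3.
- exact: measurableT_comp mr m1.
- exact: measurable_sin_dot3.
- exact: measurableT_comp mi m1.
Qed.

Let mF2 u : cmeasurable u -> measurable_fun setT (F2 u).
Proof.
move=> [mr mi]; have m1 := @measurable_fst _ _ (R3 R) (R3 R).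
apply: measurable_funB; apply: measurable_funM.
- exact: measurable_cos_dot3.
- exact: measurableT_comp mi m1.
- exact: measurable_sin_dot3.
- exact: measurableT_comp mr m1.
Qed.

Let c3 : R := (2 * pi) `^ (- (3 / 2)).

(** The squared normalisation of the transform cancels the (2 pi)^3 in front of the Poisson kernel;
    this is what makes the transform an isometry. *)
Let c3_sqr : c3 ^+ 2 * (2 * pi) ^+ 3 = 1.
Proof.
have p0 : 0 < 2 * pi :> R by rewrite mulr_gt0 ?pi_gt0.
rewrite /c3 -!powR_mulrn ?powR_ge0 ?(ltW p0)// -powRrM -powRD; last first.
  by rewrite (gt_eqF p0) implybT.
rewrite (_ : _ + _ = 0); last by field.
by rewrite powRr0.
Qed.

Let fourierL1E u xi : fourierL1 u xi =
  c3%:C * (Rintegral mu setT (fun x => F1 u (x, xi)) +i*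
           Rintegral mu setT (fun x => F2 u (x, xi))).
Proof.
rewrite /fourierL1; congr (_ * _); rewrite /cintegral; congr Complex.
- apply: eq_Rintegral => x _; rewrite /F1/=.
  by case: (u x) => a b /=; rewrite mulNr opprK.
- apply: eq_Rintegral => x _; rewrite /F2/=.
  by case: (u x) => a b /=; rewrite mulNr.
Qed.

Lemma cmeasurable_fourierL1 u : cmeasurable u -> cmeasurable (fourierL1 u).
Proof.
move=> mu_; rewrite (_ : fourierL1 u = fun xi => c3%:C *
  (Rintegral mu setT (fun x => F1 u (x, xi)) +i*
   Rintegral mu setT (fun x => F2 u (x, xi)))); last exact/funext/fourierL1E.
apply: cmeasurableM; first exact: cmeasurable_cst.
split => /=.
- exact: (@measurable_Rintegral_snd _ _ (R3 R) (R3 R) R mu _ (mF1 mu_)).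
- exact: (@measurable_Rintegral_snd _ _ (R3 R) (R3 R) R mu _ (mF2 mu_)).
Qed.

(** The real part of z times the conjugate of z', that is, the Euclidean inner product of the
    plane. *)
Definition cross z z' : R := complex.Re z * complex.Re z' + complex.Im z * complex.Im z'.

Lemma dot3_sub x y xi : dot3 (sub3 x y) xi = dot3 x xi - dot3 y xi.
Proof. by rewrite /dot3/=; ring. Qed.

(** Expanding the squared modulus of the transform leaves the transform of the weight at x - y. Its
    sine part vanishes, hence only the real part [cross] of the product is seen. *)
Lemma weighted_energy_fourierL1 u d : 0 < d -> inL1 u ->
  (\int[mu]_xi (expdecay3 d xi * cnorm2 (fourierL1 u xi))%R%:E =
   \int[mu]_x \int[mu]_y (cross (u x) (u y) * poisson3 d (sub3 x y))%R%:E)%E.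
Proof.
move=> d0 uL1; have [ir ii] := integrable_Re_Im uL1; have mu_ := uL1.1.
pose G x := `|complex.Re (u x)| + `|complex.Im (u x)|.
have iG : mu.-integrable setT (EFin \o G).
  exact: (integrableD measurableT (integrable_norm ir) (integrable_norm ii)).
have ew0 xi : 0 <= c3 ^+ 2 * expdecay3 d xi.
  by rewrite mulr_ge0 ?sqr_ge0// /expdecay3 /tensor !mulr_ge0 ?expdecay_ge0.
have iw : mu.-integrable setT (EFin \o (fun xi => c3 ^+ 2 * expdecay3 d xi)).
  exact: (integrableZl measurableT _ (integrable_expdecay3 d0)).
have trig_le (c s a b : R) : `|c| <= 1 -> `|s| <= 1 -> `|c * a + s * b| <= `|a| + `|b|.
  by move=> c1 s1; rewrite (le_trans (ler_normD _ _))// !normrM lerD// ler_piMl.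
have cos_le t : `|cos t : R| <= 1 by rewrite ler_norml cos_geN1 cos_le1.
have sin_le t : `|sin t : R| <= 1 by rewrite ler_norml sin_geN1 sin_le1.
have := integral_sqrD_partial (mu := mu) (nu := mu) (mF1 mu_) (mF2 mu_) iG iw ew0 _ _.
move=> E; transitivity (\int[mu]_y (c3 ^+ 2 * expdecay3 d y *
   ((Rintegral mu setT (fun x => F1 u (x, y))) ^+ 2 +
    (Rintegral mu setT (fun x => F2 u (x, y))) ^+ 2))%R%:E)%E.
  apply: eq_integral => xi _; congr EFin; rewrite fourierL1E cnorm2M /cnorm2/=.
  by ring.
rewrite E; first last.
- move=> x xi; rewrite /F2/= /G addrC.
  by rewrite -mulNr addrC [leRHS]addrC; apply: trig_le; rewrite ?normrN.
- by move=> x xi; apply: trig_le.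
apply: eq_integral => x _; apply: eq_integral => y _; congr EFin.
have [ic is_ Ic Is] := integral_trig_expdecay3 (sub3 x y) d0.
(* The sum of the products of [F1] and of [F2] is the real part of exp(- i (x - y).xi) u(x) times
   the conjugate of u(y); [A] and [B] are [c3 ^+ 2] times the coefficients of its cosine and its
   sine. *)
pose A := c3 ^+ 2 * cross (u x) (u y).
pose B := c3 ^+ 2 * (complex.Im (u x) * complex.Re (u y) - complex.Re (u x) * complex.Im (u y)).
transitivity (\int[mu]_xi (A * (expdecay3 d xi * cos (dot3 (sub3 x y) xi)) +
    B * (expdecay3 d xi * sin (dot3 (sub3 x y) xi)))).
  apply: eq_Rintegral => xi _; rewrite dot3_sub cosB sinB /F1 /F2 /A /B /cross/=.
  have aux (c e p p' q q' k k' l l' : R) : c * e * ((k * p + l * q) * (k' * p' + l' * q') +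
      (k * q - l * p) * (k' * q' - l' * p')) = c * (p * p' + q * q') * (e * (k * k' + l * l')) +
      c * (q * p' - p * q') * (e * (l * k' - k * l')) by ring.
  exact: aux.
rewrite RintegralD//; first last.
- exact: (integrableZl measurableT B is_).
- exact: (integrableZl measurableT A ic).
rewrite !RintegralZl// Ic Is mulr0 addr0 /A.
transitivity (c3 ^+ 2 * (2 * pi) ^+ 3 * (cross (u x) (u y) * poisson3 d (sub3 x y))).
  exact: mulrACA.
by rewrite c3_sqr mul1r.
Qed.

End fourierL1.

(** * The Schur test for the Poisson kernel *)

Section bessel.
Context {R : realType}.
Notation leb := (@lebesgue_measure R).
Notation mu := (@mu3 R).
Implicit Types (x y xi : R3 R) (u v f g : R3 R -> R[i]) (z : R[i]) (d : R).

Lemma poisson3_ge0 d x : 0 <= d -> 0 <= poisson3 d x.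
Proof.
move=> d0; apply: mulr_ge0; last exact: poisson_ge0.
by apply: mulr_ge0; exact: poisson_ge0.
Qed.

Lemma poisson3_subC d x y : poisson3 d (sub3 x y) = poisson3 d (sub3 y x).
Proof.
rewrite /poisson3 /tensor/=.
by congr (_ * _ * _); rewrite -poissonN opprB.
Qed.

Lemma measurable_poisson3 d : 0 < d ->
  measurable_fun setT (fun z : R3 R * R3 R => poisson3 d (sub3 z.1 z.2)).
Proof.
move=> d0; have m1 := @measurable_fst _ _ (R3 R) (R3 R).
have m2 := @measurable_snd _ _ (R3 R) (R3 R).
apply: measurable_funM; first apply: measurable_funM.
- apply: (measurableT_comp (measurable_poisson d0)); apply: measurable_funB.
    exact: measurableT_comp measurable_coord1 m1.
  exact: measurableT_comp measurable_coord1 m2.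
- apply: (measurableT_comp (measurable_poisson d0)); apply: measurable_funB.
    exact: measurableT_comp measurable_coord2 m1.
  exact: measurableT_comp measurable_coord2 m2.
- apply: (measurableT_comp (measurable_poisson d0)); apply: measurable_funB.
    exact: measurableT_comp measurable_coord3 m1.
  exact: measurableT_comp measurable_coord3 m2.
Qed.

Lemma integral_poisson3_le1 d x : 0 < d ->
  (\int[mu]_y (poisson3 d (sub3 x y))%:E <= 1)%E.
Proof.
move=> d0.
have mp c : measurable_fun setT (fun t : R => poisson d (c - t)).
  by apply: (measurableT_comp (measurable_poisson d0)); exact: measurable_funB.
have p0 c t : 0 <= poisson d (c - t) by rewrite poisson_ge0// ltW.
have I0 c : (0 <= \int[leb]_t (poisson d (c - t))%:E)%E.
  by apply: integral_ge0 => t _; rewrite lee_fin.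
have := ge0_integral_tensor (mp x.1.1) (mp x.1.2) (mp x.2) (p0 _) (p0 _) (p0 _).
rewrite /tensor => ->.
rewrite -[leRHS]mule1; apply: lee_pmul => //; [exact: mule_ge0| |exact: integral_poisson_le1].
by rewrite -[leRHS]mule1; apply: lee_pmul => //; exact: integral_poisson_le1.
Qed.

(** The row half of the Schur test: each row of the kernel has mass at most 1. The column half
    [schur2] follows by Tonelli, as the kernel is symmetric. *)
Let schur1 d (h : R3 R -> R) : 0 < d -> measurable_fun setT h -> (forall x, 0 <= h x) ->
  (\int[mu]_x \int[mu]_y (h x * poisson3 d (sub3 x y))%:E <= \int[mu]_x (h x)%:E)%E.
Proof.
move=> d0 mh h0.
have mk x : measurable_fun setT (fun y => (poisson3 d (sub3 x y))%:E).
  apply/measurable_EFinP.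
  exact: (measurableT_comp (measurable_poisson3 d0) (@pair1_measurable _ _ (R3 R) (R3 R) x)).
have k0 x y : (0 <= (poisson3 d (sub3 x y))%:E)%E by rewrite lee_fin poisson3_ge0// ltW.
apply: ge0_le_integral => //.
- by move=> x _; apply: integral_ge0 => y _; rewrite lee_fin mulr_ge0// -lee_fin.
- apply: (measurable_fun_fubini_tonelli_F (m2 := mu)
    (fun z : R3 R * R3 R => (h z.1 * poisson3 d (sub3 z.1 z.2))%:E)).
    apply/measurable_EFinP; apply: measurable_funM; last exact: measurable_poisson3.
    exact: measurableT_comp mh (@measurable_fst _ _ (R3 R) (R3 R)).
  by move=> z; rewrite lee_fin mulr_ge0// -lee_fin.
- exact/measurable_EFinP.
- move=> x _; under eq_integral do rewrite EFinM.
  rewrite ge0_integralZl_EFin//.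
  by rewrite -[leRHS]mule1 lee_wpmul2l ?lee_fin// integral_poisson3_le1.
Qed.

Let schur2 d (h : R3 R -> R) : 0 < d -> measurable_fun setT h -> (forall x, 0 <= h x) ->
  (\int[mu]_x \int[mu]_y (h y * poisson3 d (sub3 x y))%:E <= \int[mu]_x (h x)%:E)%E.
Proof.
move=> d0 mh h0.
have -> : (\int[mu]_x \int[mu]_y (h y * poisson3 d (sub3 x y))%:E =
    \int[mu]_y \int[mu]_x (h y * poisson3 d (sub3 x y))%:E)%E.
  apply: (fubini_tonelli (m1 := mu) (m2 := mu)
    (fun z : R3 R * R3 R => (h z.2 * poisson3 d (sub3 z.1 z.2))%:E)).
    apply/measurable_EFinP; apply: measurable_funM; last exact: measurable_poisson3.
    exact: measurableT_comp mh (@measurable_snd _ _ (R3 R) (R3 R)).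
  by move=> z; rewrite lee_fin mulr_ge0// poisson3_ge0// ltW.
under eq_integral do [under eq_integral do rewrite poisson3_subC].
exact: schur1.
Qed.

Lemma cross_le z z' : `|cross z z'| <= cnorm2 z / 2 + cnorm2 z' / 2.
Proof.
case: z => a b; case: z' => c e; rewrite /cross /cnorm2/= ler_norml.
have := sqr_ge0 (a - c); have := sqr_ge0 (a + c).
have := sqr_ge0 (b - e); have := sqr_ge0 (b + e).
move=> h1 h2 h3 h4; apply/andP; split; nra.
Qed.

Lemma measurable_cross f g : cmeasurable f -> cmeasurable g ->
  measurable_fun setT (fun x => cross (f x) (g x)).
Proof.
by move=> [f1 f2] [g1 g2]; apply: measurable_funD; exact: measurable_funM.
Qed.

(** The inequality [cross_le] replaces the product of two values of [u] by half the sum of their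
    squared moduli; against the kernel each half contributes at most half of the energy. *)
Lemma weighted_energy_le u d : 0 < d -> inL1 u ->
  (\int[mu]_xi (expdecay3 d xi * cnorm2 (fourierL1 u xi))%R%:E <= energy u)%E.
Proof.
move=> d0 uL1; rewrite weighted_energy_fourierL1//; have mu_ := uL1.1.
pose h x := cnorm2 (u x) / 2.
have mh : measurable_fun setT h.
  by apply: measurable_funM => //; exact: measurable_cnorm2.
have h0 x : 0 <= h x by rewrite divr_ge0 ?cnorm2_ge0.
have mk := measurable_poisson3 d0.
have m1 := @measurable_fst _ _ (R3 R) (R3 R).
have m2 := @measurable_snd _ _ (R3 R) (R3 R).
have mh1 : measurable_fun setT (fun z : R3 R * R3 R => h z.1 * poisson3 d (sub3 z.1 z.2)).
  by apply: measurable_funM => //; exact: measurableT_comp mh m1.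
have mh2 : measurable_fun setT (fun z : R3 R * R3 R => h z.2 * poisson3 d (sub3 z.1 z.2)).
  by apply: measurable_funM => //; exact: measurableT_comp mh m2.
have mc : measurable_fun setT (fun z : R3 R * R3 R =>
    cross (u z.1) (u z.2) * poisson3 d (sub3 z.1 z.2)).
  apply: measurable_funM => //; case: mu_ => mr mi.
  apply: measurable_funD; apply: measurable_funM.
  - exact: measurableT_comp mr m1.
  - exact: measurableT_comp mr m2.
  - exact: measurableT_comp mi m1.
  - exact: measurableT_comp mi m2.
have k0 x y : 0 <= poisson3 d (sub3 x y) by rewrite poisson3_ge0// ltW.
have mx (f : R3 R * R3 R -> R) x : measurable_fun setT f ->
    measurable_fun setT (fun y => (f (x, y))%:E).
  move=> mf; apply/measurable_EFinP.
  exact: (measurableT_comp mf (@pair1_measurable _ _ (R3 R) (R3 R) x)).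
have mF (f : R3 R * R3 R -> R) : measurable_fun setT f -> (forall xy, 0 <= f xy) ->
    measurable_fun setT (fun x => \int[mu]_y (f (x, y))%:E)%E.
  move=> mf f0; apply: (measurable_fun_fubini_tonelli_F (m2 := mu) (EFin \o f)).
    exact/measurable_EFinP.
  by move=> z; rewrite lee_fin.
apply: (@le_trans _ _ (\int[mu]_x (\int[mu]_y (h x * poisson3 d (sub3 x y))%:E +
    \int[mu]_y (h y * poisson3 d (sub3 x y))%:E))%E).
  apply: (le_trans (lee_abs _)).
  apply: (le_trans (le_abse_integral _ _ _)) => //.
    (* [measurable_integral_snd] integrates the first variable out, so the integrand is swapped. *)
    have mc' : measurable_fun setT (fun z : R3 R * R3 R =>
        cross (u z.2) (u z.1) * poisson3 d (sub3 z.2 z.1)).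
      exact: (measurableT_comp mc (@measurable_swap _ _ (R3 R) (R3 R))).
    exact: (@measurable_integral_snd _ _ (R3 R) (R3 R) R mu _ mc').
  apply: ge0_le_integral => //.
  - apply: measurableT_comp => //.
    have mc' : measurable_fun setT (fun z : R3 R * R3 R =>
        cross (u z.2) (u z.1) * poisson3 d (sub3 z.2 z.1)).
      exact: (measurableT_comp mc (@measurable_swap _ _ (R3 R) (R3 R))).
    exact: (@measurable_integral_snd _ _ (R3 R) (R3 R) R mu _ mc').
  - apply: emeasurable_funD.
      by apply: (mF _ mh1) => z; rewrite mulr_ge0.
    by apply: (mF _ mh2) => z; rewrite mulr_ge0.
  move=> x _; apply: (le_trans (le_abse_integral _ _ (mx _ x mc))) => //.
  rewrite -ge0_integralD//; first last.
  - exact: (mx _ x mh2).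
  - by move=> y _; rewrite lee_fin mulr_ge0.
  - exact: (mx _ x mh1).
  - by move=> y _; rewrite lee_fin mulr_ge0.
  apply: ge0_le_integral => //.
  - by apply: measurableT_comp => //; exact: (mx _ x mc).
  - by apply: emeasurable_funD; [exact: (mx _ x mh1)|exact: (mx _ x mh2)].
  move=> y _; rewrite lee_fin normrM (ger0_norm (k0 _ _)) -mulrDl.
  by apply: ler_wpM2r => //; exact: cross_le.
rewrite ge0_integralD//; first last.
- by apply: (mF _ mh2) => z; rewrite mulr_ge0.
- by move=> x _; apply: integral_ge0 => y _; rewrite lee_fin mulr_ge0.
- by apply: (mF _ mh1) => z; rewrite mulr_ge0.
- by move=> x _; apply: integral_ge0 => y _; rewrite lee_fin mulr_ge0.
apply: (le_trans (leeD (schur1 d0 mh h0) (schur2 d0 mh h0))).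
rewrite -ge0_integralD//; first last.
- exact/measurable_EFinP.
- by move=> x _; rewrite lee_fin.
- exact/measurable_EFinP.
- by move=> x _; rewrite lee_fin.
by rewrite /energy; under eq_integral do rewrite -EFinD -splitr.
Qed.

Lemma expdecay3_le1 d x : 0 <= d -> expdecay3 d x <= 1.
Proof.
move=> d0; rewrite /expdecay3 /tensor.
by rewrite !mulr_ile1 ?mulr_ge0 ?expdecay_ge0 ?expdecay_le1.
Qed.

Lemma expdecay3_ge0 d x : 0 <= expdecay3 d x.
Proof. by rewrite /expdecay3 /tensor !mulr_ge0 ?expdecay_ge0. Qed.

(** For d = 1/(n+1) the weight increases to 1, so monotone convergence removes it from a bound that
    is uniform in d. *)
Lemma energy_fourierL1_le u : inL1 u -> (energy (fourierL1 u) <= energy u)%E.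
Proof.
move=> uL1; have muh := cmeasurable_fourierL1 uL1.1.
pose w n xi := expdecay3 n.+1%:R^-1 xi * cnorm2 (fourierL1 u xi).
have mw n : measurable_fun setT (fun xi => (w n xi)%:E).
  apply/measurable_EFinP; apply: measurable_funM; last exact: measurable_cnorm2.
  by apply: measurable_tensor; exact: measurable_expdecay.
have w0 n xi : 0 <= w n xi by rewrite mulr_ge0 ?expdecay3_ge0 ?cnorm2_ge0.
have expdecay_homo n m t : (n <= m)%N -> expdecay n.+1%:R^-1 t <= expdecay m.+1%:R^-1 t :> R.
  move=> nm; rewrite ler_expR lerN2 ler_wpM2r// lef_pV2 ?posrE//.
  by rewrite ler_nat.
have ndw xi : {homo (fun n => (w n xi)%:E) : n m / (n <= m)%N >-> (n <= m)%E}.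
  move=> n m nm; rewrite lee_fin ler_wpM2r ?cnorm2_ge0// /expdecay3 /tensor.
  by rewrite !ler_pM ?mulr_ge0 ?expdecay_ge0 ?expdecay_homo.
have wE xi : limn (fun n => (w n xi)%:E) = (cnorm2 (fourierL1 u xi))%:E.
  apply/cvg_lim => //; apply: cvg_EFin; first exact: nearW.
  rewrite -[X in _ --> X]mul1r; apply: cvgM; last exact: cvg_cst.
  have cv t : expdecay n.+1%:R^-1 t @[n --> \oo] --> (1 : R).
    rewrite -[X in _ --> X]expR0; apply: continuous_cvg; first exact: continuous_expR.
    rewrite -oppr0; apply: cvgN; rewrite -[X in _ --> X](mul0r `|t|); apply: cvgM; last exact: cvg_cst.
    exact: cvg_harmonic.
  rewrite -[X in _ --> X]mul1r -[X in X * _]mul1r.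
  by apply: cvgM; [apply: cvgM|]; exact: cv.
rewrite /energy; under eq_integral do rewrite -wE.
rewrite monotone_convergence//; last by move=> n xi _; rewrite lee_fin.
apply: lime_le.
  apply: ereal_nondecreasing_is_cvgn => n m nm; apply: ge0_le_integral => //.
  - by move=> xi _; rewrite lee_fin.
  - by move=> xi _; exact: ndw.
by apply: nearW => n; exact: weighted_energy_le.
Qed.

End bessel.

(** * The Plancherel theorem *)

Section plancherel.
Context {R : realType}.
Notation mu := (@mu3 R).
Implicit Types (x y xi : R3 R) (u v f g : R3 R -> R[i]) (z : R[i]).

Lemma inL2P f : inL2 f <-> cmeasurable f /\ (energy f < +oo)%E.
Proof. by split=> -[mf Ef]; split=> //; apply/L2norm_lty. Qed.

Lemma inL2_fin_num f : inL2 f -> energy f \is a fin_num.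
Proof. by move=> /inL2P[_ fy]; rewrite ge0_fin_numE ?energy_ge0. Qed.

Lemma inL2Z z f : inL2 f -> inL2 (fun x => z * f x).
Proof.
move=> /inL2P[mf Ef]; apply/inL2P; split.
  by apply: cmeasurableM => //; exact: cmeasurable_cst.
rewrite energyM//; apply: lte_mul_pinfty => //; first by rewrite lee_fin cnorm2_ge0.
Qed.

Lemma inL2D f g : inL2 f -> inL2 g -> inL2 (fun x => f x + g x).
Proof.
move=> If Ig; have [mf _] := If; have [mg _] := Ig.
apply/inL2P; split; first exact: cmeasurableD.
apply: (@le_lt_trans _ _ (2%:E * energy f + 2%:E * energy g)%E).
  by rewrite -energy_parallelogram// leeDl// energy_ge0.
by rewrite -(fineK (inL2_fin_num If)) -(fineK (inL2_fin_num Ig)) -!EFinM -EFinD ltry.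
Qed.

Lemma cmeasurableB f g : cmeasurable f -> cmeasurable g -> cmeasurable (fun x => f x - g x).
Proof.
move=> mf mg; under eq_fun do rewrite -mulN1r.
by apply: cmeasurableD => //; apply: cmeasurableM => //; exact: cmeasurable_cst.
Qed.

Lemma inL2B f g : inL2 f -> inL2 g -> inL2 (fun x => f x - g x).
Proof.
by move=> If Ig; under eq_fun do rewrite -mulN1r; apply: inL2D => //; exact: inL2Z.
Qed.

Lemma inL1B f g : inL1 f -> inL1 g -> inL1 (fun x => f x - g x).
Proof.
by move=> If Ig; under eq_fun do rewrite -mulN1r; apply: inL1D => //; exact: inL1Z.
Qed.

Lemma fourierL1B f g xi : inL1 f -> inL1 g ->
  fourierL1 (fun x => f x - g x) xi = fourierL1 f xi - fourierL1 g xi.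
Proof.
move=> If Ig; under eq_fun do rewrite -mulN1r.
by rewrite fourierL1D ?fourierL1Z ?mulN1r//; exact: inL1Z.
Qed.

(** Integrability is bundled with the equality so that the class is stable under linear combinations
    and limits, and can be fed to the pi-lambda theorem. *)
Definition plancherel u : Prop :=
  [/\ inL1 u, inL2 u & energy (fourierL1 u) = energy u].

Let fourier_parallelogram u v : inL1 u -> inL1 v ->
  (energy (fourierL1 (fun x => u x + v x)%R) + energy (fourierL1 (fun x => u x - v x)%R) =
   2%:E * energy (fourierL1 u) + 2%:E * energy (fourierL1 v))%E.
Proof.
move=> u1 v1; rewrite -energy_parallelogram; last 2 first.
- exact: cmeasurable_fourierL1 u1.1.
- exact: cmeasurable_fourierL1 v1.1.
congr (energy _ + energy _)%E; apply/funext => xi; first exact: fourierL1D.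
exact: fourierL1B.
Qed.

Let fourier_fin_num u : inL1 u -> inL2 u -> energy (fourierL1 u) \is a fin_num.
Proof.
move=> u1 /inL2P[_ u2]; rewrite ge0_fin_numE ?energy_ge0//.
exact: le_lt_trans (energy_fourierL1_le u1) u2.
Qed.

Lemma plancherelZ z u : plancherel u -> plancherel (fun x => z * u x).
Proof.
move=> [u1 u2 uE]; split; [exact: inL1Z|exact: inL2Z|].
rewrite energyM; last exact: u1.1.
rewrite -uE -energyM; last exact: cmeasurable_fourierL1 u1.1.
by congr energy; apply/funext => xi; exact: fourierL1Z.
Qed.

Let defect_aux (a b c e : R) : (a%:E <= c%:E)%E -> (b%:E <= e%:E)%E ->
  (a%:E + b%:E = c%:E + e%:E)%E -> a%:E = c%:E.
Proof. by rewrite -!EFinD !lee_fin => ab ce -[] E; congr EFin; lra. Qed.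

Let closed_aux (a b c d f g h e : R) : 0 <= a -> (a%:E <= f%:E)%E -> (b%:E <= g%:E)%E ->
  (f%:E <= (e / 2)%:E)%E ->
  (d%:E + g%:E = 2%:E * h%:E + 2%:E * f%:E)%E ->
  (c%:E + b%:E = 2%:E * h%:E + 2%:E * a%:E)%E ->
  (d%:E <= c%:E + e%:E)%E.
Proof. by rewrite -!EFinM -!EFinD !lee_fin => ? ? ? ? -[] ? -[] ?; lra. Qed.

(* Both sides satisfy the parallelogram law, so the Bessel defect of [u + v]
   and that of [u - v], which are nonnegative, add up to zero. *)
Lemma plancherelD u v : plancherel u -> plancherel v ->
  plancherel (fun x => u x + v x).
Proof.
move=> [u1 u2 uE] [v1 v2 vE].
have s1 := inL1D u1 v1; have s2 := inL2D u2 v2.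
have d1 := inL1B u1 v1; have d2 := inL2B u2 v2.
split => //.
have := fourier_parallelogram u1 v1.
rewrite uE vE -energy_parallelogram; [|exact: u1.1|exact: v1.1].
move: (energy_fourierL1_le s1) (energy_fourierL1_le d1).
rewrite -(fineK (fourier_fin_num s1 s2)) -(fineK (fourier_fin_num d1 d2)).
rewrite -(fineK (inL2_fin_num s2)) -(fineK (inL2_fin_num d2)).
exact: defect_aux.
Qed.

(** Put w = u - v, so that u = v + w. By the parallelogram law for v and w, the Bessel defects of v
    + w and v - w add up to twice those of v and w. The defect of v is 0 and that of v - w is
    nonnegative, so the defect of u is at most twice the energy of w. *)
Lemma plancherel_closed u : inL1 u -> inL2 u ->
  (forall e : R, 0 < e -> exists2 v, plancherel v &
     (energy (fun x => u x - v x)%R <= e%:E)%E) ->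
  plancherel u.
Proof.
move=> u1 u2 happrox; split => //; apply/eqP; rewrite eq_le energy_fourierL1_le//=.
apply/lee_addgt0Pr => e e0.
have [v [v1 v2 vE] uv] := happrox (e / 2) (divr_gt0 e0 (ltr0n _ 2)).
have w1 := inL1B u1 v1; have w2 := inL2B u2 v2.
have d1 := inL1B v1 w1; have d2 := inL2B v2 w2.
have uvw : (fun x => v x + (u x - v x)) = u.
  by apply/funext => x; rewrite addrC subrK.
have := fourier_parallelogram v1 w1.
have := energy_parallelogram v1.1 w1.1.
rewrite uvw vE.
move: (energy_fourierL1_le w1) (energy_fourierL1_le d1) uv.
rewrite -(fineK (fourier_fin_num w1 w2)) -(fineK (fourier_fin_num d1 d2)).
rewrite -(fineK (fourier_fin_num u1 u2)) -(fineK (inL2_fin_num u2)).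
rewrite -(fineK (inL2_fin_num w2)) -(fineK (inL2_fin_num d2)) -(fineK (inL2_fin_num v2)).
have : (0 <= fine (energy (fourierL1 (fun x => u x - v x)%R)))%R.
  by rewrite fine_ge0// energy_ge0.
exact: closed_aux.
Qed.

End plancherel.

(** * Plancherel equality for indicators of boxes *)

Section boxes.
Context {R : realType}.
Notation leb := (@lebesgue_measure R).
Notation mu := (@mu3 R).
Implicit Types (x y xi : R3 R) (u v f g : R3 R -> R[i]) (A : set (R3 R)).

Definition cindic A : R3 R -> R[i] := fun x => (\1_A x : R)%:C.

Lemma cnorm2_cindic A x : cnorm2 (cindic A x) = \1_A x.
Proof. by rewrite /cnorm2/= indicE; case: (x \in A); rewrite ?expr1n ?expr0n addr0. Qed.

Lemma cmeasurable_cindic A : measurable A -> cmeasurable (cindic A).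
Proof. by move=> mA; apply: cmeasurable_real; exact: measurable_indic. Qed.

Lemma energy_cindic A : measurable A -> energy (cindic A) = mu A.
Proof.
move=> mA; rewrite /energy; under eq_integral do rewrite cnorm2_cindic.
by rewrite integral_indic// setIT.
Qed.

Lemma inL2_cindic A : measurable A -> (mu A < +oo)%E -> inL2 (cindic A).
Proof.
by move=> mA Aoo; apply/inL2P; split; [exact: cmeasurable_cindic|rewrite energy_cindic].
Qed.

Lemma inL1_cindic A : measurable A -> (mu A < +oo)%E -> inL1 (cindic A).
Proof.
move=> mA Aoo; apply/inL1P; split; first exact: cmeasurable_cindic.
have E x : Normc.normc (cindic A x) = \1_A x.
  by rewrite normcE cnorm2_cindic indicE; case: (x \in A); rewrite ?sqrtr1 ?sqrtr0.
apply/integrableP; split.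
  by apply/measurable_EFinP; apply: measurable_normc; exact: cmeasurable_cindic.
under eq_integral do rewrite E /= ger0_norm//.
by rewrite integral_indic// setIT.
Qed.

Lemma plancherel0 : plancherel (fun _ : R3 R => 0 : R[i]).
Proof.
have E : (fun _ : R3 R => 0 : R[i]) = cindic set0.
  by apply/funext => x; rewrite /cindic indicE in_set0.
have u1 : inL1 (fun _ : R3 R => 0 : R[i]).
  by rewrite E; apply: inL1_cindic => //; rewrite measure0.
split => //; first by rewrite E; apply: inL2_cindic => //; rewrite measure0.
apply/eqP; rewrite eq_le energy_fourierL1_le// andTb.
by rewrite [in leLHS]E energy_cindic// measure0 energy_ge0.
Qed.

Definition box (I1 I2 I3 : set R) : set (R3 R) := (I1 `*` I2) `*` I3.

Lemma indic_box (I1 I2 I3 : set R) x :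
  \1_(box I1 I2 I3) x = tensor \1_I1 \1_I2 \1_I3 x :> R.
Proof.
rewrite /tensor !indicE /box !in_setX.
by case: (_ \in I1); case: (_ \in I2); case: (_ \in I3); rewrite ?mulr0 ?mul0r ?mulr1.
Qed.

Lemma measurable_box (I1 I2 I3 : set (measurableTypeR R)) :
  measurable I1 -> measurable I2 -> measurable I3 -> measurable (box I1 I2 I3).
Proof.
move=> m1 m2 m3; apply: (@measurableX _ _ (R2 R) (measurableTypeR R)) => //.
exact: (@measurableX _ _ (measurableTypeR R) (measurableTypeR R)).
Qed.

Lemma mu3_box (I1 I2 I3 : set (measurableTypeR R)) :
  measurable I1 -> measurable I2 -> measurable I3 ->
  (mu (box I1 I2 I3) = leb I1 * leb I2 * leb I3)%E.
Proof.
move=> m1 m2 m3.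
rewrite -(setIT (box _ _ _)) -(integral_indic mu measurableT); last exact: measurable_box.
under eq_integral do rewrite indic_box.
rewrite ge0_integral_tensor//; try by exact: measurable_indic.
by rewrite !integral_indic// !setIT.
Qed.

(** The Poisson kernel cut down to a square. For the indicator of a box the kernel in
    [weighted_energy_fourierL1] is a product of three of these. *)
Definition poisson_itv (a b e s t : R) : R := \1_`]a, b] s * \1_`]a, b] t * poisson e (s - t).

Definition poisson_itv_mass (a b e s : R) : R := \int[leb]_t poisson_itv a b e s t.

Section one_dim.
Variables (a b e : R).
Hypotheses (ab : a < b) (e0 : 0 < e).
Let I : set R := `]a, b]%classic.

Lemma poisson_itv_ge0 s t : 0 <= poisson_itv a b e s t.
Proof. by apply: mulr_ge0; [rewrite mulr_ge0|apply: poisson_ge0; exact: ltW]. Qed.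

Let measurable_poisson_itv : measurable_fun setT (fun z : R * R => poisson_itv a b e z.1 z.2).
Proof.
have mI : measurable_fun setT (\1_I : R -> R) by apply: measurable_indic; exact: measurable_itv.
apply: measurable_funM; first by apply: measurable_funM; exact: (measurableT_comp mI).
by apply: (measurableT_comp (measurable_poisson e0)); exact: measurable_funB.
Qed.

Lemma measurable_poisson_itv_snd s : measurable_fun setT (poisson_itv a b e s).
Proof. exact: (measurableT_comp measurable_poisson_itv (@pair1_measurable _ _ R R s)). Qed.

Let integral_poisson_itv_le1 s : (\int[leb]_t (poisson_itv a b e s t)%:E <= 1)%E.
Proof.
apply: le_trans (integral_poisson_le1 s e0); apply: ge0_le_integral => //.
- by move=> t _; rewrite lee_fin; exact: poisson_itv_ge0.
- by apply/measurable_EFinP; exact: measurable_poisson_itv_snd.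
- apply/measurable_EFinP; apply: (measurableT_comp (measurable_poisson e0)).
  exact: measurable_funB.
- move=> t _; rewrite lee_fin /poisson_itv ler_piMl ?poisson_ge0 ?(ltW e0)// mulr_ile1//.
Qed.

Lemma EFin_poisson_itv_mass s : ((poisson_itv_mass a b e s)%:E = \int[leb]_t (poisson_itv a b e s t)%:E)%E.
Proof.
rewrite /poisson_itv_mass /Rintegral fineK// ge0_fin_numE; last first.
  by apply: integral_ge0 => t _; rewrite lee_fin; exact: poisson_itv_ge0.
by apply: (le_lt_trans (integral_poisson_itv_le1 s)); rewrite ltry.
Qed.

Lemma poisson_itv_mass_ge0 s : 0 <= poisson_itv_mass a b e s.
Proof. by apply: Rintegral_ge0 => t _; exact: poisson_itv_ge0. Qed.

Lemma measurable_poisson_itv_mass : measurable_fun setT (poisson_itv_mass a b e).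
Proof.
apply: (@measurable_Rintegral_snd _ _ (measurableTypeR R) (measurableTypeR R) R leb
  (fun z : R * R => poisson_itv a b e z.2 z.1)).
exact: (measurableT_comp measurable_poisson_itv (@measurable_swap _ _ R R)).
Qed.

(** Half-open intervals suit the generation of Borel sets, closed ones suit [poisson_concentration];
    they differ by a null set. *)
Lemma integral_poisson_itv_mass : (\int[leb]_s (poisson_itv_mass a b e s)%:E =
  \int[leb]_(s in `[a, b]) \int[leb]_(t in `[a, b]) (poisson e (s - t))%:E)%E.
Proof.
have mp s : measurable_fun setT (fun t : R => (poisson e (s - t))%:E).
  apply/measurable_EFinP; apply: (measurableT_comp (measurable_poisson e0)).
  exact: measurable_funB.
have inner s : (\int[leb]_(t in `[a, b]) (poisson e (s - t))%:E =
    \int[leb]_(t in I) (poisson e (s - t))%:E)%E.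
  by rewrite -integral_itv_obnd_cbnd//; exact: measurable_funTS.
under [RHS]eq_integral do rewrite inner.
have KE s : s \in I -> (\int[leb]_(t in I) (poisson e (s - t))%:E)%E = (poisson_itv_mass a b e s)%:E.
  move=> sI; rewrite EFin_poisson_itv_mass integral_mkcond; apply: eq_integral => t _.
  rewrite patchE /poisson_itv !indicE sI mul1r.
  by case: ifPn => _; rewrite ?mul1r ?mul0r.
rewrite -integral_itv_obnd_cbnd; last first.
  apply: (eq_measurable_fun (fun s => (poisson_itv_mass a b e s)%:E)).
    by move=> s sI; rewrite KE.
  by apply: measurable_funTS; apply/measurable_EFinP; exact: measurable_poisson_itv_mass.
rewrite [RHS]integral_mkcond; apply: eq_integral => s _.
rewrite patchE; case: ifPn => sI; first by rewrite KE.
rewrite EFin_poisson_itv_mass; under eq_integral do rewrite /poisson_itv indicE (negbTE sI) !mul0r.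
by rewrite integral0.
Qed.

End one_dim.

Lemma plancherel_box (a1 b1 a2 b2 a3 b3 : R) :
  plancherel (cindic (box `]a1, b1] `]a2, b2] `]a3, b3])).
Proof.
set B := box _ _ _.
(* The endpoints may come in any order: boxes obtained by intersecting intervals can be empty. *)
have box0 : B = set0 -> plancherel (cindic B).
  move=> ->; rewrite (_ : cindic set0 = fun=> 0); first exact: plancherel0.
  by apply/funext => x; rewrite /cindic indicE in_set0.
have itv0 (a b : R) : b <= a -> `]a, b]%classic = set0 :> set R.
  by move=> ba; rewrite set_itv_ge// bnd_simp -leNgt.
have [ab1|/itv0 I0] := ltP a1 b1; last by apply: box0; rewrite /B /box I0 !set0X.
have [ab2|/itv0 I0] := ltP a2 b2; last by apply: box0; rewrite /B /box I0 setX0 set0X.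
have [ab3|/itv0 I0] := ltP a3 b3; last by apply: box0; rewrite /B /box I0 setX0.
have mI (a b : R) : measurable (`]a, b]%classic : set (measurableTypeR R)) by exact: measurable_itv.
have mB : measurable B by exact: measurable_box.
pose V : R := (b1 - a1) * (b2 - a2) * (b3 - a3).
have BV : mu B = V%:E.
  rewrite mu3_box// !lebesgue_measure_itv/= !lte_fin ab1 ab2 ab3.
  by rewrite -!EFinD -!EFinM.
have Boo : (mu B < +oo)%E by rewrite BV ltry.
have u1 := inL1_cindic mB Boo; have u2 := inL2_cindic mB Boo.
split => //; apply/eqP; rewrite eq_le energy_fourierL1_le// andTb.
rewrite energy_cindic// BV.
(* The weighted energy is a product of three one-dimensional Poisson masses, and
   each of them tends to the length of its interval. *)
pose q (a b : R) n := (\int[leb]_s (poisson_itv_mass a b n.+1%:R^-1 s)%:E)%E.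
have qcvg a b : a < b -> q a b n @[n --> \oo] --> (b - a)%:E.
  move=> ab; rewrite (_ : q a b = fun n => \int[leb]_(s in `[a, b])
    \int[leb]_(t in `[a, b]) (poisson n.+1%:R^-1 (s - t))%:E)%E.
    exact: poisson_concentration.
  by apply/funext => n; rewrite /q integral_poisson_itv_mass.
have q0 a b n : (0 <= q a b n)%E.
  by apply: integral_ge0 => s _; rewrite lee_fin; apply: poisson_itv_mass_ge0.
(* The weight is at most 1, so the weighted energies bound the energy of the transform from below;
   with Bessel, their limit [V] forces equality. *)
have qle n : (q a1 b1 n * q a2 b2 n * q a3 b3 n <= energy (fourierL1 (cindic B)))%E.
  set e : R := n.+1%:R^-1; have e0 : 0 < e by rewrite invr_gt0.
  rewrite /q -/e -ge0_integral_tensor//;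
    try by [exact: measurable_poisson_itv_mass|move=> t; exact: poisson_itv_mass_ge0].
  apply: (@le_trans _ _ (\int[mu]_xi (expdecay3 e xi * cnorm2 (fourierL1 (cindic B) xi))%R%:E)%E).
    rewrite weighted_energy_fourierL1//.
    rewrite le_eqVlt; apply/orP; left; apply/eqP; apply: eq_integral => x _.
    transitivity (\int[mu]_y (tensor (poisson_itv a1 b1 e x.1.1) (poisson_itv a2 b2 e x.1.2)
        (poisson_itv a3 b3 e x.2) y)%:E)%E.
      rewrite ge0_integral_tensor;
        try by [exact: measurable_poisson_itv_snd|move=> t; exact: poisson_itv_ge0].
      by rewrite -!EFin_poisson_itv_mass.
    apply: eq_integral => y _; congr EFin; rewrite /cross/= mulr0 addr0 !indic_box.
    by rewrite /tensor /poisson_itv /poisson3 /tensor/=; ring.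
  apply: ge0_le_integral => //.
  - by move=> xi _; rewrite lee_fin mulr_ge0 ?expdecay3_ge0 ?cnorm2_ge0.
  - apply/measurable_EFinP; apply: measurable_funM.
      by apply: measurable_tensor; exact: measurable_expdecay.
    by apply: measurable_cnorm2; exact: cmeasurable_fourierL1 u1.1.
  - by apply: measurable_ecnorm2; exact: cmeasurable_fourierL1 u1.1.
  - by move=> xi _; rewrite lee_fin ler_piMl ?cnorm2_ge0// expdecay3_le1// ltW.
have qV : (q a1 b1 n * q a2 b2 n * q a3 b3 n)%E @[n --> \oo] --> V%:E.
  rewrite /V !EFinM; apply: cvgeM => //; last exact: qcvg.
  by apply: cvgeM => //; exact: qcvg.
by apply: (cvge_to_le qV); exact: nearW.
Qed.

End boxes.

(** * From boxes to bounded measurable sets *)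

Section measurable_sets.
Context {R : realType}.
Notation leb := (@lebesgue_measure R).
Notation mu := (@mu3 R).
Implicit Types (A B C : set (R3 R)).

Lemma cindicD A B x : B `<=` A -> cindic (A `\` B) x = cindic A x - cindic B x.
Proof.
move=> BA; rewrite /cindic !indicE in_setD.
have [xB|xB] := boolP (x \in B); last by rewrite andbT subr0.
by rewrite andbF mem_set ?subrr//; apply: BA; exact: set_mem.
Qed.

Lemma plancherel_setD A B : B `<=` A -> plancherel (cindic A) ->
  plancherel (cindic B) -> plancherel (cindic (A `\` B)).
Proof.
move=> BA pA pB; rewrite (_ : cindic _ = fun x => cindic A x + (-1) * cindic B x).
  by apply: plancherelD => //; exact: plancherelZ.
by apply/funext => x; rewrite cindicD// mulN1r.
Qed.

(** The energy of the difference of the two indicators is the measure of the set difference, which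
    tends to 0 by continuity of the measure. *)
Lemma plancherel_bigcup (S : (set (R3 R))^nat) : nondecreasing_seq S ->
  (forall n, measurable (S n)) -> (mu (\bigcup_n S n) < +oo)%E ->
  (forall n, plancherel (cindic (S n))) -> plancherel (cindic (\bigcup_n S n)).
Proof.
move=> ndS mS Soo pS; have mU : measurable (\bigcup_n S n) by exact: bigcup_measurable.
apply: plancherel_closed; [exact: inL1_cindic|exact: inL2_cindic|move=> e e0].
have SU n : S n `<=` \bigcup_n S n by exact: bigcup_sup.
have Snoo n : (mu (S n) < +oo)%E.
  by apply: le_lt_trans Soo; apply: le_measure; rewrite ?in_setE.
have fU : mu (\bigcup_n S n) \is a fin_num by rewrite ge0_fin_numE.
have fS n : mu (S n) \is a fin_num by rewrite ge0_fin_numE.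
have : mu (S n) @[n --> \oo] --> (fine (mu (\bigcup_n S n)))%:E.
  by rewrite fineK//; exact: nondecreasing_cvg_mu.
move=> /fine_cvgP[_ /cvgrPdist_le/(_ e e0)[n _ Hn]].
exists (cindic (S n)) => //.
rewrite (_ : (fun x => _) = cindic (\bigcup_n S n `\` S n)); last first.
  by apply/funext => x; rewrite cindicD.
rewrite energy_cindic; last exact: measurableD.
have -> : (mu (\bigcup_n S n `\` S n) = mu (\bigcup_n S n) - mu (S n))%E.
  by rewrite measureD// setIidr.
rewrite -(fineK fU) -(fineK (fS n)) -EFinB lee_fin.
by apply: le_trans (Hn n (leqnn n)); exact: ler_norm.
Qed.

(** The pi-lambda theorem for the sets cut out of a fixed [C] by a map [p]. The finite measure of
    [C] keeps all indicators in L^1 and L^2, and the choice of [p] lets one factor be generalised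
    while the others stay fixed. *)
Lemma plancherel_preimage d (T : measurableType d) (G : set (set T))
    (p : R3 R -> T) C :
  measurable = <<s G >> :> set (set T) -> setI_closed G ->
  measurable_fun setT p -> measurable C -> (mu C < +oo)%E ->
  plancherel (cindic C) ->
  (forall X, G X -> plancherel (cindic (p @^-1` X `&` C))) ->
  forall X, measurable X -> plancherel (cindic (p @^-1` X `&` C)).
Proof.
move=> TG GI mp mC Coo pC pG X0.
pose H := [set X : set T | measurable X /\ plancherel (cindic (p @^-1` X `&` C))].
have mpre (X : set T) : measurable X -> measurable (p @^-1` X `&` C).
  move=> mX; apply: measurableI => //; rewrite -(setTI (p @^-1` X)); exact: mp.
suff : measurable `<=` H by move=> mH /mH[].
rewrite TG; apply: (@lambda_system_subset _ _ GI setT) => //; last first.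
  move=> X GX; split; last exact: pG.
  by rewrite TG; exact: sub_gen_smallest.
split => //.
- by split => //; rewrite preimage_setT setTI.
- move=> X Y YX [mX pX] [mY pY]; split; first exact: measurableD.
  rewrite (_ : _ `&` _ = (p @^-1` X `&` C) `\` (p @^-1` Y `&` C)).
    by apply: plancherel_setD => // x [Yx Cx]; split => //; exact: YX.
  apply/seteqP; split => [x [[Xx Yx] Cx]|x [[Xx Cx] YCx]].
    by split => // -[].
  by split => //; split => // Yx; apply: YCx.
- move=> F ndF HF.
  have mF n : measurable (F n) by have [] := HF n.
  split; first exact: bigcup_measurable.
  rewrite preimage_bigcup setI_bigcupl; apply: plancherel_bigcup => //.
  + by move=> n m nm; apply/subsetPset; apply: setSI; apply: preimage_subset; apply/subsetPset/ndF.
  + by move=> n; exact: mpre.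
  + rewrite -setI_bigcupl -preimage_bigcup; apply: le_lt_trans Coo.
    by apply: le_measure; rewrite ?in_setE//; apply: mpre; exact: bigcup_measurable.
  + by move=> n; have [] := HF n.
Qed.

Let Io (a b : R) : set (measurableTypeR R) := `]a, b]%classic.

Let mIo a b : measurable (Io a b). Proof. exact: measurable_itv. Qed.

Let gen1 : measurable = <<s @ocitv R >> :> set (set (measurableTypeR R)).
Proof. by []. Qed.

Let ocitv_setI a b (X : set R) : ocitv X -> exists c d, X `&` Io a b = Io c d.
Proof.
move=> oX; have [] : ocitv (X `&` Io a b) by apply: ocitvI => //; exact: is_ocitv.
by move=> [c e] _ <-; exists c, e.
Qed.

Let box_fin a1 b1 a2 b2 a3 b3 A : measurable A ->
  A `<=` box (Io a1 b1) (Io a2 b2) (Io a3 b3) -> (mu A < +oo)%E.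
Proof.
move=> mA AB; apply: (@le_lt_trans _ _ (mu (box (Io a1 b1) (Io a2 b2) (Io a3 b3)))).
  by apply: le_measure; rewrite ?in_setE//; exact: measurable_box.
have fin a b : leb (Io a b) \is a fin_num.
  by rewrite /Io lebesgue_measure_itv/=; case: ifPn.
rewrite mu3_box// -(fineK (fin a1 b1)) -(fineK (fin a2 b2)) -(fineK (fin a3 b3)).
by rewrite -!EFinM ltry.
Qed.

(** The product structure is climbed with one choice of [p] per level: each coordinate passes from
    intervals to Borel sets, then [fst] from rectangles to measurable sets of the plane, and the
    identity from products to measurable sets of space. The cube supplies the finite measure
    throughout. *)
Lemma plancherel_bounded (r : R) A : measurable A ->
  plancherel (cindic (A `&` box (Io (- r) r) (Io (- r) r) (Io (- r) r))).
Proof.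
pose D := Io (- r) r.
have mD0 : measurable D by exact: mIo.
have mD X : measurable X -> measurable (X `&` D) by move=> mX; exact: measurableI.
have step1 (X1 : set (measurableTypeR R)) c2 e2 c3 e3 : measurable X1 ->
    plancherel (cindic (box (X1 `&` D) (Io c2 e2) (Io c3 e3))).
  move=> m1; pose C := box D (Io c2 e2) (Io c3 e3).
  have mC : measurable C by apply: measurable_box; [exact: measurable_itv|exact: mIo|exact: mIo].
  have CE (X : set R) : (fun x => x.1.1) @^-1` X `&` C = box (X `&` D) (Io c2 e2) (Io c3 e3).
    by apply/seteqP; split=> [x [? [[? ?] ?]]|x [[[? ?] ?] ?]].
  rewrite -CE; apply: (plancherel_preimage gen1 (@ocitvI R) measurable_coord1) => //.
  - exact: (box_fin
      (a1 := - r) (b1 := r) (a2 := c2) (b2 := e2) (a3 := c3) (b3 := e3) mC).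
  - exact: plancherel_box.
  - by move=> X /(ocitv_setI (- r) r)[c [e XE]]; rewrite CE XE; exact: plancherel_box.
have step2 (X1 X2 : set (measurableTypeR R)) c3 e3 : measurable X1 -> measurable X2 ->
    plancherel (cindic (box (X1 `&` D) (X2 `&` D) (Io c3 e3))).
  move=> m1 m2; pose C := box (X1 `&` D) D (Io c3 e3).
  have mC : measurable C by apply: measurable_box => //; exact: mD.
  have CE (X : set R) : (fun x => x.1.2) @^-1` X `&` C = box (X1 `&` D) (X `&` D) (Io c3 e3).
    by apply/seteqP; split=> [x [? [[? ?] ?]]|x [[? [? ?]] ?]].
  rewrite -CE; apply: (plancherel_preimage gen1 (@ocitvI R) measurable_coord2) => //.
  - by apply: (box_fin mC
      (a1 := - r) (b1 := r) (a2 := - r) (b2 := r) (a3 := c3) (b3 := e3)) => x [[[_ ?] ?] ?].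
  - exact: step1.
  - by move=> X /(ocitv_setI (- r) r)[c [e XE]]; rewrite CE XE; exact: step1.
have step3 (X1 X2 X3 : set (measurableTypeR R)) : measurable X1 -> measurable X2 ->
    measurable X3 -> plancherel (cindic (box (X1 `&` D) (X2 `&` D) (X3 `&` D))).
  move=> m1 m2 m3; pose C := box (X1 `&` D) (X2 `&` D) D.
  have mC : measurable C by apply: measurable_box => //; exact: mD.
  have CE (X : set R) : (fun x => x.2) @^-1` X `&` C = box (X1 `&` D) (X2 `&` D) (X `&` D).
    by apply/seteqP; split=> [x [? [[? ?] ?]]|x [[? ?] [? ?]]].
  rewrite -CE; apply: (plancherel_preimage gen1 (@ocitvI R) measurable_coord3) => //.
  - by apply: (box_fin mC
      (a1 := - r) (b1 := r) (a2 := - r) (b2 := r) (a3 := - r) (b3 := r)) => x [[[_ ?] [_ ?]] ?].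
  - exact: step2.
  - by move=> X /(ocitv_setI (- r) r)[c [e XE]]; rewrite CE XE; exact: step2.
have prodI d1 d2 (T1 : measurableType d1) (T2 : measurableType d2) :
    setI_closed [set X1 `*` X2 | X1 in @measurable _ T1 & X2 in @measurable _ T2].
  move=> X Y [X1 mX1 [X2 mX2 <-{X}]] [Y1 mY1 [Y2 mY2 <-{Y}]].
  exists (X1 `&` Y1); first exact: measurableI.
  by exists (X2 `&` Y2); [exact: measurableI|rewrite setXI].
have step4 (S : set (R2 R)) (X3 : set (measurableTypeR R)) : measurable S -> measurable X3 ->
    plancherel (cindic (fst @^-1` S `&` box D D (X3 `&` D))).
  move=> mS m3; have mC : measurable (box D D (X3 `&` D)).
    by apply: measurable_box => //; exact: mD.
  apply: (plancherel_preimage (@measurable_prod_measurableType _ _ (measurableTypeR R)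
    (measurableTypeR R)) (@prodI _ _ _ _)
    (@measurable_fst _ _ (R2 R) (measurableTypeR R))) => //.
  - by apply: (box_fin mC
      (a1 := - r) (b1 := r) (a2 := - r) (b2 := r) (a3 := - r) (b3 := r)) => x [[? ?] [_ ?]].
  - by have := step3 setT setT X3 measurableT measurableT m3; rewrite !setTI.
  - move=> _ [X1 m1 [X2 m2 <-]]; rewrite (_ : _ `&` _ = box (X1 `&` D) (X2 `&` D) (X3 `&` D)).
      exact: step3.
    by apply/seteqP; split=> [x [[? ?] [[? ?] [? ?]]]|x [[[? ?] [? ?]] [? ?]]].
move=> mA.
apply: (plancherel_preimage (p := idfun) (@measurable_prod_measurableType _ _ (R2 R)
    (measurableTypeR R)) (@prodI _ _ _ _)) => //.
- exact: (@measurable_id _ (R3 R) setT).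
- by apply: measurable_box; exact: mIo.
- by apply: (box_fin
      (a1 := - r) (b1 := r) (a2 := - r) (b2 := r) (a3 := - r) (b3 := r)) => //; exact: measurable_box.
- exact: plancherel_box.
move=> _ [S mS [X3 m3 <-]]; rewrite (_ : _ `&` _ = fst @^-1` S `&` box D D (X3 `&` D)).
  exact: step4.
by apply/seteqP; split=> [x [[? ?] [[? ?] ?]]|x [? [[? ?] [? ?]]]].
Qed.

End measurable_sets.

Import HBNNSimple.

(** * From bounded sets to functions in L^1 and L^2 *)

Section plancherel_L1L2.
Context {R : realType}.
Notation mu := (@mu3 R).
Implicit Types (x y xi : R3 R) (u v f g : R3 R -> R[i]) (z : R[i]).

Lemma le_energy f g : cmeasurable f -> cmeasurable g ->
  (forall x, cnorm2 (f x) <= cnorm2 (g x)) -> (energy f <= energy g)%E.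
Proof.
move=> mf mg fg; apply: ge0_le_integral => //.
- by move=> x _; rewrite lee_fin cnorm2_ge0.
- exact: measurable_ecnorm2.
- exact: measurable_ecnorm2.
- by move=> x _; rewrite lee_fin.
Qed.

Lemma le_inL2 f g : cmeasurable f -> inL2 g ->
  (forall x, cnorm2 (f x) <= cnorm2 (g x)) -> inL2 f.
Proof.
move=> mf /inL2P[mg gy] fg; apply/inL2P; split => //.
exact: le_lt_trans (le_energy mf mg fg) gy.
Qed.

Lemma plancherel_sum (I : Type) (s : seq I) (F : I -> R3 R -> R[i]) :
  (forall i, plancherel (F i)) -> plancherel (fun x => \sum_(i <- s) F i x).
Proof.
move=> pF; elim: s => [|i s IH].
  by under eq_fun do rewrite big_nil; exact: plancherel0.
by under eq_fun do rewrite big_cons; exact: plancherelD.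
Qed.

Let Io (r : R) : set (measurableTypeR R) := `](- r), r]%classic.
Let cube (r : R) : set (R3 R) := box (Io r) (Io r) (Io r).

Let measurable_cube r : measurable (cube r).
Proof. by apply: measurable_box; exact: measurable_itv. Qed.

(** The level sets of [g] may have infinite measure; cutting them by a cube makes their indicators
    integrable. *)
Let plancherel_simple (g : {nnsfun (R3 R) >-> R}) (r : R) :
  plancherel (fun x => (g x * \1_(cube r) x)%:C).
Proof.
rewrite (_ : (fun x => _) = (fun x => \sum_(c <- fset_set (range g))
    c%:C * cindic (g @^-1` [set c] `&` cube r) x)).
  apply: plancherel_sum => c; apply: plancherelZ; apply: plancherel_bounded.
  exact: measurable_funPTI.
apply/funext => x; rewrite [in LHS]fimfunE fsbig_finite//= mulr_suml rmorph_sum/=.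
apply: eq_bigr => c _; rewrite -rmorphM/=; congr (_%:C).
by rewrite -mulrA; congr (_ * _); rewrite indicI.
Qed.

Let cube_cvg x : \1_(cube n.+1%:R) x @[n --> \oo] --> (1 : R).
Proof.
have [N HN] : exists N : nat, forall n, (N <= n)%N -> x \in cube n.+1%:R.
  pose M : R := `|x.1.1| + `|x.1.2| + `|x.2|.
  exists (Num.trunc M) => n nN; apply: mem_set; rewrite /cube /box /Io/=.
  have Mn : M < n.+1%:R.
    by rewrite (lt_le_trans (truncnS_gt M))// ler_nat ltnS.
  have itv (t : R) : `|t| <= M -> t \in `](- n.+1%:R), n.+1%:R].
    move=> /le_lt_trans/(_ Mn); rewrite ltr_norml in_itv/= => /andP[-> /ltW ->//].
  have h1 := normr_ge0 x.1.1; have h2 := normr_ge0 x.1.2; have h3 := normr_ge0 x.2.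
  by split; [split|]; apply: itv; rewrite /M; lra.
apply: (@cvg_trans _ ((fun=> 1 : R) @ \oo)); last exact: cvg_cst.
apply: near_eq_cvg; exists N => // n /= Nn.
by rewrite indicE HN.
Qed.

(** Simple functions below [p], cut to growing cubes, converge to [p] in energy, and
    [plancherel_closed] concludes. *)
Let plancherel_ge0 (p : R3 R -> R) : measurable_fun setT p -> (forall x, 0 <= p x) ->
  inL1 (fun x => (p x)%:C) -> inL2 (fun x => (p x)%:C) -> plancherel (fun x => (p x)%:C).
Proof.
move=> mp p0 u1 u2; apply: plancherel_closed => // e e0.
have mEp : measurable_fun setT (EFin \o p) by exact/measurable_EFinP.
pose g n := nnsfun_approx measurableT mEp n.
have gp n x : g n x <= p x.
  rewrite -lee_fin /g nnsfun_approxE; apply: le_approx => // t _.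
  by rewrite lee_fin.
have gcvg x : g n x @[n --> \oo] --> p x.
  have := cvg_nnsfun_approx measurableT mEp (fun t _ => _) (x := x) I.
  by move=> /(_ (fun t => p0 t)) /fine_cvgP[].
pose v n x : R := g n x * \1_(cube n.+1%:R) x.
have v0 n x : 0 <= v n x by rewrite mulr_ge0.
have vp n x : v n x <= p x.
  by rewrite (le_trans _ (gp n x))// ler_piMr// indicE; case: (_ \in _).
have mv n : measurable_fun setT (v n).
  by apply: measurable_funM => //; apply: measurable_indic; exact: measurable_cube.
have mc n : cmeasurable (fun x => (p x)%:C - (v n x)%:C).
  apply: cmeasurableB; exact: cmeasurable_real.
(* Since 0 <= [v n] <= [p], the square of [p - v n] is dominated by that of [p]. *)
have [|||||_ _] := @dominated_convergence _ (R3 R) R mu setT measurableT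
  (fun n x => (cnorm2 ((p x)%:C - (v n x)%:C))%:E) (cst 0%E) (fun x => (cnorm2 (p x)%:C)%:E).
- by move=> n; exact: measurable_ecnorm2.
- exact: measurable_cst.
- apply/nearW => x _; apply: cvg_EFin; first exact: nearW.
  rewrite (_ : _ \o _ = fun n => (p x - v n x) ^+ 2); last first.
    by apply/funext => n; rewrite /cnorm2/= subrr expr0n addr0.
  rewrite [X in _ --> X](_ : _ = (p x - p x) ^+ 2); last by rewrite subrr expr0n.
  have vcvg : v n x @[n --> \oo] --> p x.
    by rewrite -[X in _ --> X]mulr1; apply: cvgM => //; exact: cube_cvg.
  by rewrite expr2; under eq_fun do rewrite expr2; apply: cvgM; apply: cvgB => //; exact: cvg_cst.
- apply/integrableP; split; first by apply: measurable_ecnorm2; exact: u1.1.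
  have [_] := (inL2P _).1 u2; apply: le_lt_trans.
  rewrite le_eqVlt; apply/orP; left; apply/eqP; apply: eq_integral => x _.
  by rewrite gee0_abs// lee_fin cnorm2_ge0.
- apply/nearW => x n _; rewrite /= lee_fin ger0_norm ?cnorm2_ge0// /cnorm2/=.
  rewrite ?subrr ?expr0n/= ?addr0 ler_pXn2r ?nnegrE ?subr_ge0//.
  by rewrite lerBlDr lerDl.
rewrite integral0 => /fine_cvgP[fin /cvgrPdist_le/(_ e e0) near].
have [N _ /(_ N (leqnn N))[/= finN leN]] := filterI fin near.
exists (fun x => (v N x)%:C); first exact: plancherel_simple.
rewrite /energy -(fineK finN) lee_fin; apply: le_trans leN.
by rewrite sub0r normrN ler_norm.
Qed.

Let pos (r : R) := Num.max r 0.

Let posE (r : R) : r = pos r - pos (- r).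
Proof.
rewrite /pos; have [r0|r0] := leP r 0.
  by rewrite max_l ?oppr_ge0// opprK add0r.
by rewrite max_r ?subr0// oppr_le0 ltW.
Qed.

Let le_pos (r : R) : `|pos r| <= `|r|.
Proof.
rewrite /pos; have [r0|r0] := leP r 0; first by rewrite normr0.
by [].
Qed.

Let plancherel_pos (p : R3 R -> R) u : inL1 u -> inL2 u -> measurable_fun setT p ->
  (forall x, `|p x| <= Normc.normc (u x)) -> plancherel (fun x => (pos (p x))%:C).
Proof.
move=> u1 u2 mp pu.
have mpos : measurable_fun setT (fun x => pos (p x)).
  by apply: measurable_maxr => //; exact: measurable_cst.
have mc := cmeasurable_real mpos.
have le x : Normc.normc ((pos (p x))%:C : R[i]) <= Normc.normc (u x).
  rewrite (le_trans _ (pu x))// (le_trans _ (le_pos (p x)))//.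
  by rewrite normcE /cnorm2/= expr0n addr0 sqrtr_sqr.
apply: plancherel_ge0 => //.
- by move=> x; rewrite /pos le_max lexx orbT.
- exact: le_inL1 u1 le.
- apply: (le_inL2 mc u2) => x; rewrite -!normc_cnorm2.
  by rewrite ler_pXn2r ?nnegrE ?normc_ge0.
Qed.

(** [u] is a complex combination of the positive and negative parts of its real and imaginary parts,
    each dominated by the modulus of [u]. *)
Lemma plancherel_inL1_inL2 u : inL1 u -> inL2 u -> plancherel u.
Proof.
move=> u1 u2; have [mr mi] := u1.1.
have Re_le x : `|complex.Re (u x)| <= Normc.normc (u x) by exact: le_Re_normc.
have Im_le x : `|complex.Im (u x)| <= Normc.normc (u x) by exact: le_Im_normc.
have p1 := plancherel_pos u1 u2 mr Re_le.
have p2 : plancherel (fun x => (pos (- complex.Re (u x)))%:C).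
  by apply: (plancherel_pos u1 u2) => [|x]; [exact: measurable_funN|rewrite normrN].
have p3 := plancherel_pos u1 u2 mi Im_le.
have p4 : plancherel (fun x => (pos (- complex.Im (u x)))%:C).
  by apply: (plancherel_pos u1 u2) => [|x]; [exact: measurable_funN|rewrite normrN].
rewrite (_ : u = fun x => ((pos (complex.Re (u x)))%:C + (-1) * (pos (- complex.Re (u x)))%:C) +
  'i * ((pos (complex.Im (u x)))%:C + (-1) * (pos (- complex.Im (u x)))%:C)).
  by apply: plancherelD; [|apply: plancherelZ]; apply: plancherelD => //; exact: plancherelZ.
apply/funext => x; rewrite !mulN1r -!rmorphB/= -!posE.
by case: (u x) => a b; congr Complex => /=; ring.
Qed.

End plancherel_L1L2.

(** * The Fourier transform on L^2 *)

Section L2space.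
Context {R : realType}.
Notation mu := (@mu3 R).
Implicit Types (x y xi : R3 R) (u v f g fh gh : R3 R -> R[i]) (z : R[i]).

Lemma L2normZ z f : cmeasurable f ->
  L2norm (fun x => z * f x) = ((Normc.normc z)%:E * L2norm f)%E.
Proof.
move=> mf; rewrite !L2normE energyM// poweRM ?energy_ge0//; last first.
  by rewrite lee_fin cnorm2_ge0.
by rewrite poweR_EFin powR12_sqrt ?cnorm2_ge0// -normcE.
Qed.

Lemma L2normD f g : cmeasurable f -> cmeasurable g ->
  (L2norm (fun x => f x + g x)%R <= L2norm f + L2norm g)%E.
Proof.
move=> mf mg; apply: le_trans (eminkowski mu (p := 2%:E) (measurable_normc mf)
  (measurable_normc mg) _); last by rewrite lee_fin ler1n.
rewrite L2normE unlock; apply: gt0_ler_poweR; rewrite ?invr_ge0//.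
- by rewrite in_itv/= energy_ge0 leey.
- by rewrite in_itv/= leey andbT; apply: integral_ge0 => x _; rewrite /= lee_fin powR_ge0.
apply: ge0_le_integral => //.
- by move=> x _; rewrite lee_fin cnorm2_ge0.
- by apply: measurable_ecnorm2; exact: cmeasurableD.
- apply: (measurableT_comp (measurable_poweR _)); apply/measurable_EFinP.
  apply: measurableT_comp => //; apply: measurable_funD; exact: measurable_normc.
move=> x _; rewrite /= lee_fin powR_mulrn// -normc_cnorm2.
rewrite ler_pXn2r ?nnegrE ?normc_ge0 ?normr_ge0//.
by rewrite (le_trans (le_normcD _ _))// ler_norm.
Qed.

Lemma energy_aeq f g : cmeasurable f -> cmeasurable g -> aeq f g -> energy f = energy g.
Proof.
move=> mf mg fg; apply: ge0_ae_eq_integral => //.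
- exact: measurable_ecnorm2.
- exact: measurable_ecnorm2.
- by move=> x _; rewrite lee_fin cnorm2_ge0.
- by move=> x _; rewrite lee_fin cnorm2_ge0.
- by apply: filterS fg => x /= -> _.
Qed.

Lemma L2norm_aeq f g : cmeasurable f -> cmeasurable g -> aeq f g -> L2norm f = L2norm g.
Proof. by move=> mf mg fg; rewrite !L2normE (energy_aeq mf mg fg). Qed.

Lemma inL2_aeq f g : inL2 f -> cmeasurable g -> aeq f g -> inL2 g.
Proof.
by move=> /inL2P[mf fy] mg fg; apply/inL2P; split => //; rewrite -(energy_aeq mf mg fg).
Qed.

Lemma energy_eq0 f : cmeasurable f -> energy f = 0%E -> aeq f (fun=> 0).
Proof.
move=> mf f0.
have /ae_eq_integral_abs : measurable_fun setT (fun x => (cnorm2 (f x))%:E).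
  exact: measurable_ecnorm2.
move=> /(_ mu measurableT)[+ _] => /(_ _)[].
  rewrite -[RHS]f0; apply: eq_integral => x _.
  by rewrite gee0_abs// lee_fin cnorm2_ge0.
move=> N [mN N0 sub]; exists N; split => // x /= fx; apply: sub => /= /(_ I)[] e.
by apply: fx; exact: cnorm2_eq0.
Qed.

Lemma L2norm_subC f g : L2norm (fun x => f x - g x) = L2norm (fun x => g x - f x).
Proof.
rewrite !L2normE; congr (_ `^ _)%E; apply: eq_integral => x _; congr EFin.
by rewrite -opprB; case: (g x - f x) => a b; rewrite /cnorm2/= !sqrrN.
Qed.

Lemma aeq_refl f : aeq f f.
Proof. by apply: nearW. Qed.

(** The triangle inequality through [u n] and [v n], then the limit. The sequences are abstract so
    that exchanging them yields the reverse inequality. *)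
Let L2norm_limit_le f fh (u v : nat -> R3 R -> R[i]) :
  cmeasurable f -> cmeasurable fh ->
  (forall n, cmeasurable (u n)) -> (forall n, cmeasurable (v n)) ->
  (forall n, L2norm (u n) = L2norm (v n)) ->
  (fun n => L2norm (fun x => u n x - f x)) @ \oo --> 0%E ->
  (fun n => L2norm (fun x => v n x - fh x)) @ \oo --> 0%E ->
  (L2norm f <= L2norm fh)%E.
Proof.
move=> mf mfh mu_ mv uv uf vfh.
have : (fun n => L2norm fh + (L2norm (fun x => v n x - fh x)%R +
    L2norm (fun x => u n x - f x)%R))%E @ \oo --> (L2norm fh + (0 + 0))%E.
  apply: cvgeD; [by rewrite adde0 fin_num_adde_defl|exact: cvg_cst|].
  by apply: cvgeD.
rewrite !adde0 => lim; apply: (cvge_to_ge lim); apply: nearW => n.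
have fE : L2norm f = L2norm (fun x => u n x + (f x - u n x)).
  by congr L2norm; apply/funext => x; rewrite addrC subrK.
rewrite fE; apply: (le_trans (L2normD (mu_ n) (cmeasurableB mf (mu_ n)))).
rewrite uv addeA (L2norm_subC f); apply: leeD => //.
rewrite [X in L2norm X](_ : _ = (fun x => fh x + (v n x - fh x))).
  by apply: L2normD => //; exact: cmeasurableB.
by apply/funext => x; rewrite addrC subrK.
Qed.

Lemma fourierL2_isometry f fh : fourierL2 f fh -> energy f = energy fh.
Proof.
move=> [[mf _] [mfh _] [u [u12 uf uhf]]].
have mu_ n : cmeasurable (u n) by have [[]] := u12 n.
have muh n : cmeasurable (fourierL1 (u n)) by exact: cmeasurable_fourierL1.
have uuh n : L2norm (u n) = L2norm (fourierL1 (u n)).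
  have [u1 u2] := u12 n; rewrite !L2normE.
  by have [_ _ ->] := plancherel_inL1_inL2 u1 u2.
have huu n : L2norm (fourierL1 (u n)) = L2norm (u n) by [].
rewrite -!L2norm_energy; congr (_ `^ _)%E; apply/eqP; rewrite eq_le.
rewrite (L2norm_limit_le mf mfh mu_ muh uuh uf uhf).
by rewrite (L2norm_limit_le mfh mf muh mu_ huu uhf uf).
Qed.

Let L2norm_lin_cvg z (u v : nat -> R3 R -> R[i]) f g :
  (forall n, cmeasurable (u n)) -> (forall n, cmeasurable (v n)) ->
  cmeasurable f -> cmeasurable g ->
  (fun n => L2norm (fun x => u n x - f x)) @ \oo --> 0%E ->
  (fun n => L2norm (fun x => v n x - g x)) @ \oo --> 0%E ->
  (fun n => L2norm (fun x => (z * u n x + v n x) - (z * f x + g x))) @ \oo --> 0%E.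
Proof.
move=> mu_ mv mf mg uf vg.
have : (fun n => (Normc.normc z)%:E * L2norm (fun x => u n x - f x)%R +
    L2norm (fun x => v n x - g x)%R)%E @ \oo --> ((Normc.normc z)%:E * 0 + 0)%E.
  apply: cvgeD; [by rewrite mule0|exact: cvgeZl|exact: vg].
rewrite mule0 adde0 => lim.
apply: (squeeze_cvge (f := cst 0%E) _ _ lim); last exact: cvg_cst.
apply: nearW => n; apply/andP; split; first by rewrite /= Lnorm_ge0.
have mB := cmeasurableB (mu_ n) mf.
rewrite -L2normZ//.
rewrite [X in L2norm X](_ : _ = (fun x => z * (u n x - f x) + (v n x - g x))).
  apply: L2normD; last exact: cmeasurableB.
  by apply: cmeasurableM => //; exact: cmeasurable_cst.
by apply/funext => x; ring.
Qed.

Lemma fourierL2_lin z f fh g gh : fourierL2 f fh -> fourierL2 g gh ->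
  fourierL2 (fun x => z * f x + g x) (fun x => z * fh x + gh x).
Proof.
move=> [f2 fh2 [u [u12 uf uhf]]] [g2 gh2 [v [v12 vg vhg]]].
split; [by apply: inL2D => //; exact: inL2Z|by apply: inL2D => //; exact: inL2Z|].
exists (fun n x => z * u n x + v n x); split.
- move=> n; have [u1 u2] := u12 n; have [v1 v2] := v12 n.
  by split; [apply: inL1D => //; exact: inL1Z|apply: inL2D => //; exact: inL2Z].
- apply: L2norm_lin_cvg => //; [| |exact: f2.1|exact: g2.1].
    by move=> n; have [[]] := u12 n.
  by move=> n; have [[]] := v12 n.
rewrite (_ : (fun n => _) = (fun n => L2norm (fun x =>
    (z * fourierL1 (u n) x + fourierL1 (v n) x) - (z * fh x + gh x)))).
  apply: L2norm_lin_cvg => //; [| |exact: fh2.1|exact: gh2.1].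
    by move=> n; apply: cmeasurable_fourierL1; have [[]] := u12 n.
  by move=> n; apply: cmeasurable_fourierL1; have [[]] := v12 n.
apply/funext => n; congr L2norm; apply/funext => x.
have [u1 _] := u12 n; have [v1 _] := v12 n.
by rewrite fourierL1D ?fourierL1Z//; exact: inL1Z.
Qed.

Lemma fourierL2_aeq f g fh gh : fourierL2 f fh -> aeq f g -> aeq fh gh ->
  cmeasurable g -> cmeasurable gh -> fourierL2 g gh.
Proof.
move=> [f2 fh2 [u [u12 uf uhf]]] fg fhgh mg mgh.
have mu_ n : cmeasurable (u n) by have [[]] := u12 n.
split; [exact: inL2_aeq f2 mg fg|exact: inL2_aeq fh2 mgh fhgh|].
exists u; split => //.
- rewrite (_ : (fun n => _) = (fun n => L2norm (fun x => u n x - f x)))//.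
  apply/funext => n; apply: L2norm_aeq; [exact: cmeasurableB|exact: cmeasurableB f2.1|].
  by apply: filterS fg => x ->.
- rewrite (_ : (fun n => _) = (fun n => L2norm (fun x => fourierL1 (u n) x - fh x)))//.
  apply/funext => n; have muh := cmeasurable_fourierL1 (mu_ n).
  apply: L2norm_aeq; [exact: cmeasurableB|exact: cmeasurableB fh2.1|].
  by apply: filterS fhgh => x ->.
Qed.

Lemma fourierL2B f fh g gh : fourierL2 f fh -> fourierL2 g gh ->
  fourierL2 (fun x => f x - g x) (fun x => fh x - gh x).
Proof.
move=> Ff Fg; have := fourierL2_lin (-1) Fg Ff.
by under eq_fun do rewrite mulN1r addrC; under [X in fourierL2 _ X]eq_fun do rewrite mulN1r addrC.
Qed.

Lemma fourierL2D f fh g gh : fourierL2 f fh -> fourierL2 g gh ->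
  fourierL2 (fun x => f x + g x) (fun x => fh x + gh x).
Proof.
move=> Ff Fg; have := fourierL2_lin 1 Ff Fg.
by under eq_fun do rewrite mul1r; under [X in fourierL2 _ X]eq_fun do rewrite mul1r.
Qed.

Lemma fourierL2Z z f fh : fourierL2 f fh ->
  fourierL2 (fun x => z * f x) (fun x => z * fh x).
Proof.
(* [fourierL2_lin] has a second summand, so z f is read as (z - 1) f + f. *)
move=> Ff; have := fourierL2_lin (z - 1) Ff Ff.
by under eq_fun do rewrite mulrBl mul1r subrK; under [X in fourierL2 _ X]eq_fun do rewrite mulrBl mul1r subrK.
Qed.

(** [fourierL2] is a relation, so its functionality has to be proved: the isometry, applied to the
    difference, gives it. *)
Lemma fourierL2_unique f g fh gh : fourierL2 f fh -> fourierL2 g gh -> aeq f g ->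
  aeq fh gh.
Proof.
move=> Ff Fg fg; have Fd := fourierL2B Ff Fg; have [[md _] [mdh _] _] := Fd.
have E0 : energy (fun x => fh x - gh x) = 0%E.
  rewrite -(fourierL2_isometry Fd) (@energy_aeq _ (fun=> 0)) ?energy0//.
  by apply: filterS fg => x ->; rewrite subrr.
by apply: filterS (energy_eq0 mdh E0) => x /eqP; rewrite subr_eq0 => /eqP.
Qed.

(** The real part of the L^2 inner product, exactly what polarising [energy] produces and all that
    the final estimates compare. *)
Definition rinner f g : R := Rintegral mu setT (fun x => cross (f x) (g x)).

Lemma integrable_cnorm2 f : inL2 f -> mu.-integrable setT (fun x => (cnorm2 (f x))%:E).
Proof.
move=> /inL2P[mf fy]; apply/integrableP; split; first exact: measurable_ecnorm2.
apply: le_lt_trans fy; rewrite le_eqVlt; apply/orP; left; apply/eqP.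
by apply: eq_integral => x _; rewrite gee0_abs// lee_fin cnorm2_ge0.
Qed.

Lemma integrable_cross f g : inL2 f -> inL2 g ->
  mu.-integrable setT (fun x => (cross (f x) (g x))%:E).
Proof.
move=> f2 g2; have if2 := integrable_cnorm2 f2; have ig2 := integrable_cnorm2 g2.
apply: le_integrable (integrableD measurableT (integrableZl measurableT 2^-1 if2)
  (integrableZl measurableT 2^-1 ig2)) => //.
  by apply/measurable_EFinP; apply: measurable_cross; [exact: f2.1|exact: g2.1].
move=> x _ /=; rewrite lee_fin.
apply: (le_trans (cross_le _ _)); rewrite ger0_norm ?(mulrC _ 2^-1)//.
by rewrite addr_ge0// mulr_ge0 ?invr_ge0 ?cnorm2_ge0.
Qed.

Let fine_energyE f : fine (energy f) = \int[mu]_x cnorm2 (f x).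
Proof. by []. Qed.

Let energy_polar f g : inL2 f -> inL2 g ->
  fine (energy (fun x => f x + g x)) =
  fine (energy f) + fine (energy g) + 2 * rinner f g.
Proof.
move=> f2 g2; have if2 := integrable_cnorm2 f2; have ig2 := integrable_cnorm2 g2.
have ic := integrable_cross f2 g2.
rewrite !fine_energyE /rinner -RintegralZl// -RintegralD// -RintegralD//; first last.
- exact: (integrableZl measurableT 2 ic).
- exact: (integrableD measurableT if2 ig2).
apply: eq_Rintegral => x _; case: (f x) => a b; case: (g x) => c e.
by rewrite /cnorm2 /cross/=; ring.
Qed.

Lemma fourierL2_rinner f fh g gh : fourierL2 f fh -> fourierL2 g gh ->
  rinner f g = rinner fh gh.
Proof.
move=> Ff Fg; have [f2 fh2 _] := Ff; have [g2 gh2 _] := Fg.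
have := fourierL2_isometry (fourierL2D Ff Fg).
move=> /(congr1 fine); rewrite !energy_polar//.
rewrite (fourierL2_isometry Ff) (fourierL2_isometry Fg).
by move=> /addrI /(mulfI _); apply.
Qed.

(** Cauchy-Schwarz through the weighted inequality Re <f, g> <= |f|^2 / (2c) + c |g|^2 / 2, with
    weight chosen so that each term is at most c/2. *)
Lemma rinner_le f g (c : R) : inL2 f -> inL2 g -> 0 < c ->
  (energy f <= (c ^+ 2)%:E)%E -> (energy g <= 1)%E -> rinner f g <= c.
Proof.
move=> f2 g2 c0 fc g1; have if2 := integrable_cnorm2 f2; have ig2 := integrable_cnorm2 g2.
have i1 := integrableZl measurableT (2 * c)^-1 if2.
have i2 := integrableZl measurableT (c / 2) ig2.
apply: (@le_trans _ _ (\int[mu]_x ((2 * c)^-1 * cnorm2 (f x) + c / 2 * cnorm2 (g x)))).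
  apply: le_Rintegral => //; [exact: integrable_cross|exact: (integrableD measurableT i1 i2)|].
  move=> x _; case: (f x) => a b; case: (g x) => p q; rewrite /cross /cnorm2/= -subr_ge0.
  rewrite (_ : _ - _ = (2 * c)^-1 * ((a - c * p) ^+ 2 + (b - c * q) ^+ 2)).
    by rewrite mulr_ge0 ?addr_ge0 ?sqr_ge0// invr_ge0 mulr_ge0// ltW.
  by field; rewrite gt_eqF.
rewrite RintegralD// RintegralZl// RintegralZl// -!fine_energyE.
have fc' : fine (energy f) <= c ^+ 2.
  by rewrite -lee_fin fineK ?inL2_fin_num.
have g1' : fine (energy g) <= 1.
  by rewrite -lee_fin fineK ?inL2_fin_num.
rewrite [leRHS](_ : c = (2 * c)^-1 * c ^+ 2 + c / 2 * 1).
  apply: lerD; first by rewrite ler_wpM2l// invr_ge0 mulr_ge0// ltW.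
  by rewrite ler_wpM2l// divr_ge0// ltW.
by field; rewrite gt_eqF.
Qed.

Lemma rinnerD f g h : inL2 f -> inL2 g -> inL2 h ->
  rinner (fun x => f x + g x) h = rinner f h + rinner g h.
Proof.
move=> f2 g2 h2; rewrite /rinner -RintegralD//; [|exact: integrable_cross|exact: integrable_cross].
apply: eq_Rintegral => x _; case: (f x) => a b; case: (g x) => c e; case: (h x) => p q.
by rewrite /cross/=; ring.
Qed.

End L2space.

(** * Resolvents of Fourier multipliers *)

(** The minimum of [F] and [G] equals [F] almost everywhere and lies below [G] everywhere. *)
Lemma le_Rintegral_ae d (X : measurableType d) (R : realType)
    (mu : {measure set X -> \bar R}) (F G : X -> R) :
  mu.-integrable setT (fun x => (F x)%:E) -> mu.-integrable setT (fun x => (G x)%:E) ->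
  {ae mu, forall x, F x <= G x} ->
  Rintegral mu setT F <= Rintegral mu setT G.
Proof.
move=> iF iG FG; pose H x := Num.min (F x) (G x).
have mF : measurable_fun setT F by apply/measurable_EFinP; case/integrableP: iF.
have mG : measurable_fun setT G by apply/measurable_EFinP; case/integrableP: iG.
have mH : measurable_fun setT H by exact: measurable_minr.
have iH : mu.-integrable setT (fun x => (H x)%:E).
  apply: le_integrable (integrableD measurableT (integrable_norm iF) (integrable_norm iG)) => //.
    exact/measurable_EFinP.
  move=> x _ /=; rewrite lee_fin [leRHS]ger0_norm ?addr_ge0// /H.
  by case: (leP (F x) (G x)) => _; rewrite ?lerDl ?lerDr.
have -> : Rintegral mu setT F = Rintegral mu setT H.
  congr fine; apply: ae_eq_integral => //; [exact/measurable_EFinP|exact/measurable_EFinP|].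
  by apply: filterS FG => x FGx _; rewrite /H min_l.
by apply: le_Rintegral => // x _; rewrite /H ge_min lexx orbT.
Qed.

Section multiplier.
Context {R : realType}.
Notation mu := (@mu3 R).
Implicit Types (x y xi : R3 R) (f g h r phi fh gh rh : R3 R -> R[i]) (z : R[i]).
Variable a : R3 R -> R.
Hypothesis a_ge0 : forall xi, 0 <= a xi.
Hypothesis ma : measurable_fun setT a.
Notation T := (fourier_multiplier a).

(** [phi] lies in the range of T - z up to a null set: precisely the case in which [resolvent] does
    not fall back on its default value. *)
Definition solvable z phi : Prop :=
  exists r h, T r h /\ aeq phi (fun x => h x - z * r x).

Lemma fourier_multiplier_lin z f f' g g' : T f f' -> T g g' ->
  T (fun x => z * f x + g x) (fun x => z * f' x + g' x).
Proof.
move=> [fh [Ff Ff']] [gh [Fg Fg']]; exists (fun xi => z * fh xi + gh xi).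
split; first exact: fourierL2_lin.
have := fourierL2_lin z Ff' Fg'; congr fourierL2; apply/funext => xi.
by ring.
Qed.

Lemma solvable_lin z c phi psi : solvable z phi -> solvable z psi ->
  solvable z (fun x => c * phi x + psi x).
Proof.
move=> [r [h [Tr E]]] [r' [h' [Tr' E']]].
exists (fun x => c * r x + r' x), (fun x => c * h x + h' x).
split; first exact: fourier_multiplier_lin.
by apply: filterS2 E E' => x -> ->; ring.
Qed.

Lemma resolventP z phi : solvable z phi ->
  exists h, T (resolvent T z phi) h /\ aeq phi (fun x => h x - z * resolvent T z phi x).
Proof.
move=> [r sol]; apply: (@xgetPex _ (fun=> 0)
  [set g | exists h, T g h /\ aeq phi (fun x => h x - z * g x)]).
by exists r.
Qed.

Lemma resolvent_unsolvable z phi : ~ solvable z phi -> resolvent T z phi = fun=> 0.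
Proof. by move=> nsol; apply: xgetPN => r [h hr]; apply: nsol; exists r, h. Qed.

Lemma fourier_equation z r h g : T r h -> aeq g (fun x => h x - z * r x) ->
  cmeasurable g ->
  exists rh, fourierL2 r rh /\ fourierL2 g (fun xi => ((a xi)%:C - z) * rh xi).
Proof.
move=> [rh [Fr Fh]] gE mg; exists rh; split => //.
have F := fourierL2_lin (- z) Fr Fh.
have [_ [mF _] _] := F.
apply: (fourierL2_aeq F) => //.
- by apply: filterS gE => x ->; ring.
- by apply: nearW => xi; ring.
- congr cmeasurable: mF; apply/funext => xi; ring.
Qed.

(** With gh = (a - E) fh and rh = gh / (a - i s), this is the exact amount by which [cross fh gh]
    exceeds [cross rh gh] when E = 0, and an upper bound for it when E < 0. *)
Definition defect (E s : R) fh xi : R :=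
  (a xi - E) * cnorm2 (fh xi) * (s ^+ 2 / (a xi ^+ 2 + s ^+ 2)).

Let cross_real (t : R) z z' : cross z (t%:C * z') = t * cross z z'.
Proof. by case: z => p q; case: z' => p' q'; rewrite /cross/=; ring. Qed.

Let cross_self z : cross z z = cnorm2 z.
Proof. by case: z => p q; rewrite /cross /cnorm2/= !expr2. Qed.

Let defect_ge0 E s fh xi : E <= 0 -> 0 <= defect E s fh xi.
Proof.
move=> E0; rewrite /defect mulr_ge0 ?divr_ge0 ?addr_ge0 ?sqr_ge0//.
by rewrite mulr_ge0 ?cnorm2_ge0// subr_ge0 (le_trans E0).
Qed.

Let defect_le E s fh xi : E <= 0 ->
  defect E s fh xi <= (a xi - E) * cnorm2 (fh xi).
Proof.
move=> E0; rewrite /defect ler_piMr//.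
  by rewrite mulr_ge0 ?cnorm2_ge0// subr_ge0 (le_trans E0).
have [->|s0] := eqVneq s 0; first by rewrite expr0n mul0r ler01.
rewrite ler_pdivrMr ?mul1r ?lerDr ?sqr_ge0//.
by rewrite ltr_wpDl ?sqr_ge0// exprn_even_gt0.
Qed.

Let measurable_defect E s fh : cmeasurable fh -> measurable_fun setT (defect E s fh).
Proof.
move=> mfh; apply: measurable_funM.
  by apply: measurable_funM; [exact: measurable_funB|exact: measurable_cnorm2].
rewrite (_ : (fun xi => _) = (fun xi => s ^+ 2 * (a xi ^+ 2 + s ^+ 2)`^ (-1))).
  apply: measurable_funM => //.
  apply: (measurableT_comp (measurable_powR _)); apply: measurable_funD => //.
  exact: measurable_funX.
by apply/funext => xi; rewrite powR_inv1// addr_ge0 ?sqr_ge0.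
Qed.

Let integrable_energy E fh : cmeasurable fh -> inL2 fh ->
  inL2 (fun xi => (a xi - E)%:C * fh xi) ->
  mu.-integrable setT (fun xi => ((a xi - E) * cnorm2 (fh xi))%:E).
Proof.
move=> mfh f2 af2; apply: eq_integrable (integrable_cross f2 af2) => // xi _.
by rewrite cross_real cross_self.
Qed.

Let integrable_defect E s fh : E <= 0 -> cmeasurable fh -> inL2 fh ->
  inL2 (fun xi => (a xi - E)%:C * fh xi) ->
  mu.-integrable setT (fun xi => (defect E s fh xi)%:E).
Proof.
move=> E0 mfh f2 af2; apply: le_integrable (integrable_energy mfh f2 af2) => //.
  by apply/measurable_EFinP; exact: measurable_defect.
move=> xi _; rewrite /= lee_fin ger0_norm ?defect_ge0//.
by rewrite (le_trans _ (ler_norm _))// defect_le.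
Qed.

(* With [t = a xi - E], the relation [(a - i s) rh = t fh] gives
   [cross rh (t fh) = a |rh|^2 = a t^2 |fh|^2 / (a^2 + s^2)], and
   [t a >= a^2] since [E <= 0]. *)
Let cross_resolvent (p t s : R) z z' : 0 <= p -> p <= t -> s != 0 ->
  (p +i* (- s)) * z = t%:C * z' ->
  t * cnorm2 z' <= cross z (t%:C * z') + t * cnorm2 z' * (s ^+ 2 / (p ^+ 2 + s ^+ 2)).
Proof.
case: z => x y; case: z' => u v p0 pt s0 /= [] e1 e2.
have d0 : 0 < p ^+ 2 + s ^+ 2 by rewrite ltr_wpDl ?sqr_ge0// exprn_even_gt0.
rewrite /cross /cnorm2/= !mul0r subr0 addr0.
have E1 : p * x + s * y = t * u by lra.
have E2 : p * y - s * x = t * v by lra.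
have -> : x * (t * u) + y * (t * v) = p * (x ^+ 2 + y ^+ 2).
  by rewrite -E1 -E2; ring.
have N : (p ^+ 2 + s ^+ 2) * (x ^+ 2 + y ^+ 2) = t ^+ 2 * (u ^+ 2 + v ^+ 2).
  have -> : t ^+ 2 * (u ^+ 2 + v ^+ 2) = (t * u) ^+ 2 + (t * v) ^+ 2 by ring.
  by rewrite -E1 -E2; ring.
have -> : x ^+ 2 + y ^+ 2 = t ^+ 2 * (u ^+ 2 + v ^+ 2) / (p ^+ 2 + s ^+ 2).
  by rewrite -N; field; rewrite gt_eqF.
rewrite -subr_ge0 (_ : _ - _ = t * (u ^+ 2 + v ^+ 2) * (p * (t - p)) / (p ^+ 2 + s ^+ 2)).
  apply: divr_ge0; last exact: ltW.
  apply: mulr_ge0; last by apply: mulr_ge0; rewrite ?subr_ge0.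
  by apply: mulr_ge0; [exact: le_trans pt|rewrite addr_ge0 ?sqr_ge0].
by field; rewrite gt_eqF.
Qed.

(** Both inner products move to the Fourier side. There the two transforms of [g] agree almost
    everywhere, which is the relation between [rh] and [fh] that [cross_resolvent] needs. *)
Lemma rinner_resolvent_ge (E s : R) f fh g r rh : E <= 0 -> s != 0 ->
  fourierL2 f fh -> fourierL2 g (fun xi => (a xi - E)%:C * fh xi) ->
  fourierL2 r rh -> fourierL2 g (fun xi => ((a xi)%:C - (0 +i* s)) * rh xi) ->
  rinner f g <= rinner r g + \int[mu]_xi defect E s fh xi.
Proof.
move=> E0 s0 Ff Fg Fr Fg'; have [_ fh2 _] := Ff; have [_ gh2 _] := Fg; have [_ rh2 _] := Fr.
have rfE := fourierL2_unique Fg' Fg (aeq_refl g).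
rewrite (fourierL2_rinner Ff Fg) (fourierL2_rinner Fr Fg) /rinner.
have ic := integrable_cross rh2 gh2.
have id := integrable_defect s E0 fh2.1 fh2 gh2.
rewrite -RintegralD//; apply: le_Rintegral_ae => //.
- exact: integrable_cross fh2 gh2.
- exact: (integrableD measurableT ic id).
apply: filterS rfE => xi rfE; rewrite cross_real cross_self.
apply: cross_resolvent => //; first by rewrite lerBrDr gerDl.
rewrite -rfE; congr (_ * _).
by congr Complex; rewrite /= ?subr0 ?sub0r.
Qed.

(** The ratio s^2 / (a^2 + s^2) tends to 0 where a > 0 but stays 1 where a = 0, hence the positivity
    almost everywhere. The majorant (a - E) |fh|^2 is integrable as a product of two L^2
    functions. *)
Lemma cvg_defect (E : R) fh : E <= 0 -> inL2 fh ->
  inL2 (fun xi => (a xi - E)%:C * fh xi) -> {ae mu, forall xi, 0 < a xi} ->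
  \int[mu]_xi defect E n.+1%:R^-1 fh xi @[n --> \oo] --> (0 : R).
Proof.
move=> E0 f2 af2 a0; have mfh := f2.1.
have iE := integrable_energy mfh f2 af2.
have [|||||_ _] := @dominated_convergence _ (R3 R) R mu setT measurableT
  (fun n xi => (defect E n.+1%:R^-1 fh xi)%:E) (cst 0%E)
  (fun xi => ((a xi - E) * cnorm2 (fh xi))%:E).
- by move=> n; apply/measurable_EFinP; exact: measurable_defect.
- exact: measurable_cst.
- apply: filterS a0 => xi axi _; apply: cvg_EFin; first exact: nearW.
  rewrite [X in _ --> X](_ : _ = (a xi - E) * cnorm2 (fh xi) * (0 * 0 / (a xi ^+ 2 + 0 * 0)));
    last by rewrite !mul0r mulr0.
  have h0 : (n.+1%:R^-1 : R) @[n --> \oo] --> 0 by exact: cvg_harmonic.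
  have h2 : ((n.+1%:R^-1 : R) ^+ 2) @[n --> \oo] --> (0 * 0 : R).
    by under eq_fun do rewrite expr2; exact: cvgM.
  apply: cvgM; first exact: cvg_cst.
  apply: cvgM => //; apply: cvgV; first by rewrite mul0r addr0 gt_eqF// exprn_gt0.
  by apply: cvgD => //; exact: cvg_cst.
- exact: iE.
- apply: nearW => xi n _; rewrite /= lee_fin ger0_norm ?defect_ge0//.
  exact: defect_le.
rewrite integral0 => /fine_cvgP[_].
by [].
Qed.

End multiplier.

(** * The symbol of H_0, the weights and the weighted resolvent *)

Section symbol.
Context {R : realType}.
Notation mu := (@mu3 R).
Implicit Types (x y xi : R3 R) (f g h r phi psi u : R3 R -> R[i]) (z : R[i]).

Definition symbol (alpha m : R) xi : R :=
  (dot3 xi xi + m `^ (2 / alpha)) `^ (alpha / 2) - m.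

Lemma dot3_ge0 x : 0 <= dot3 x x.
Proof. by rewrite /dot3 !addr_ge0// -expr2 sqr_ge0. Qed.

Lemma measurable_dot3_diag : measurable_fun setT (fun x : R3 R => dot3 x x).
Proof.
have mp : measurable_fun setT (fun x : R3 R => (x, x)) by exact: measurable_fun_pair.
exact: (measurableT_comp measurable_dot3 mp).
Qed.

Lemma measurable_symbol alpha m : measurable_fun setT (symbol alpha m).
Proof.
apply: measurable_funB => //; apply: (measurableT_comp (measurable_powR _)).
by apply: measurable_funD => //; exact: measurable_dot3_diag.
Qed.

(** Hence the symbol vanishes at the origin; monotonicity of powers makes it positive elsewhere. *)
Let symbol0 (alpha m : R) : 0 < alpha -> 0 < m -> (m `^ (2 / alpha)) `^ (alpha / 2) = m.
Proof.
move=> a0 m0; rewrite -powRrM (_ : _ * _ = 1) ?powRr1 ?ltW//.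
by field; rewrite gt_eqF.
Qed.

Lemma symbol_ge0 (alpha m : R) xi : 0 < alpha -> 0 < m -> 0 <= symbol alpha m xi.
Proof.
move=> a0 m0; rewrite subr_ge0 -[leLHS](symbol0 a0 m0).
have c0 := powR_ge0 m (2 / alpha); have d0 := dot3_ge0 xi.
have r0 : 0 <= alpha / 2 by rewrite divr_ge0// ltW.
by apply: (ge0_ler_powR r0); rewrite ?nnegrE ?lerDr// addr_ge0.
Qed.

Lemma symbol_gt0 (alpha m : R) xi : 0 < alpha -> 0 < m -> 0 < dot3 xi xi ->
  0 < symbol alpha m xi.
Proof.
move=> a0 m0 xi0; rewrite subr_gt0 -[ltLHS](symbol0 a0 m0).
have c0 := powR_ge0 m (2 / alpha); have d0 := dot3_ge0 xi.
have r0 : 0 < alpha / 2 by rewrite divr_gt0.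
by apply: (gt0_ltr_powR r0); rewrite ?nnegrE ?ltrDr// addr_ge0.
Qed.

Lemma ae_symbol_gt0 (alpha m : R) : 0 < alpha -> 0 < m ->
  {ae mu, forall xi, 0 < symbol alpha m xi}.
Proof.
move=> a0 m0; exists (box [set 0] [set 0] [set 0]); split.
- by apply: measurable_box; exact: measurable_set1.
- rewrite mu3_box; try exact: measurable_set1.
  by rewrite lebesgue_measure_set1 mule0.
move=> xi /= nxi; have : dot3 xi xi = 0.
  apply/eqP; rewrite eq_le dot3_ge0 andbT leNgt; apply/negP => xi0.
  by apply: nxi; exact: symbol_gt0.
rewrite /dot3 -!expr2 => /eqP; rewrite !paddr_eq0 ?addr_ge0 ?sqr_ge0//.
by rewrite !sqrf_eq0 => /andP[/andP[/eqP ? /eqP ?] /eqP ?].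
Qed.

Lemma japanese_ge1 x : 1 <= japanese x.
Proof. by rewrite -[leLHS]sqrtr1 ler_sqrt ?lerDl ?dot3_ge0// addr_ge0 ?dot3_ge0. Qed.

Lemma measurable_japanese : measurable_fun setT (@japanese R).
Proof.
rewrite (_ : @japanese R = fun x => (1 + dot3 x x) `^ 2^-1).
  apply: (measurableT_comp (measurable_powR _)).
  by apply: measurable_funD => //; exact: measurable_dot3_diag.
by apply/funext => x; rewrite powR12_sqrt// addr_ge0// dot3_ge0.
Qed.

Lemma cmeasurable_weight (s : R) f : cmeasurable f -> cmeasurable (weight s f).
Proof.
move=> mf; apply: cmeasurableM => //; apply: cmeasurable_real.
exact: (measurableT_comp (measurable_powR _) measurable_japanese).
Qed.

Lemma weight_lin (s : R) z f g :
  weight s (fun x => z * f x + g x) = (fun x => z * weight s f x + weight s g x).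
Proof. by apply/funext => x; rewrite /weight; ring. Qed.

Lemma weightK (s : R) f : weight (- s) (weight s f) = f.
Proof.
apply/funext => x; rewrite /weight mulrA -rmorphM/= -powRD.
  by rewrite addNr powRr0 mul1r.
by rewrite (gt_eqF (lt_le_trans ltr01 (japanese_ge1 x))) implybT.
Qed.

Lemma inL2_weight (s : R) f : 0 <= s -> inL2 f -> inL2 (weight (- s) f).
Proof.
move=> s0 f2; apply: (le_inL2 (cmeasurable_weight _ f2.1) f2) => x.
rewrite /weight cnorm2M ler_piMl ?cnorm2_ge0// /cnorm2/= expr0n addr0.
rewrite expr_le1 ?powR_ge0// -[leRHS](powRr0 (japanese x)).
by apply: ler_powR; [exact: japanese_ge1|rewrite oppr_le0].
Qed.

(** Opposite weights cancel in the pairing, so <r, g> becomes the pairing of the weighted resolvent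
    of u with u itself. *)
Lemma cross_weight (s : R) f g x :
  cross (weight (- s) f x) (weight s g x) = cross (f x) (g x).
Proof.
have e : japanese x `^ (- s) * japanese x `^ s = 1.
  rewrite -powRD; first by rewrite addNr powRr0.
  by rewrite (gt_eqF (lt_le_trans ltr01 (japanese_ge1 x))) implybT.
rewrite /weight; case: (f x) => a b; case: (g x) => c d; rewrite /cross/=.
rewrite !mul0r !subr0 !addr0.
by rewrite -[RHS]mul1r -e; ring.
Qed.

Lemma le_opnorm (K : (R3 R -> R[i]) -> R3 R -> R[i]) f :
  inL2 f -> (L2norm f <= 1)%E -> (L2norm (K f) <= opnorm K)%E.
Proof. by move=> f2 f1; apply: ereal_sup_ubound; exists f. Qed.

Variable a : R3 R -> R.
Notation T := (fourier_multiplier a).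

(* Where [T - z] does not reach [weight (- s) phi], [resolvent] is the junk value [0],
   so [K phi] has norm at most [d].  If it does not reach [weight (- s) u]
   then, for every [phi], this applies to [phi] or to both [u / 2] and
   [(phi + u) / 2]. *)
Lemma weighted_resolvent_solvable (s : R) z K (d : R) :
  bounded_operator K ->
  (opnorm (fun f x => weighted_resolvent T s z f x - K f x)%R <= d%:E)%E ->
  ((4 * d)%:E < opnorm K)%E ->
  forall u, inL2 u -> (L2norm u <= 1)%E -> solvable a z (weight (- s) u).
Proof.
move=> [KL2 Klin _] Kd Kgt u u2 u1; apply: contrapT => nsol.
have small phi : inL2 phi -> (L2norm phi <= 1)%E -> ~ solvable a z (weight (- s) phi) ->
    (L2norm (K phi) <= d%:E)%E.
  move=> phi2 phi1 nphi; apply: (le_trans _ Kd).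
  apply: le_trans (le_opnorm _ phi2 phi1); rewrite L2norm_subC.
  rewrite /weighted_resolvent (resolvent_unsolvable nphi).
  rewrite le_eqVlt; apply/orP; left; apply/eqP; congr L2norm; apply/funext => x.
  by rewrite /weight mulr0 subr0.
have := Kgt; rewrite ltNge => /negP; apply; apply: ge_ereal_sup => _ [phi [phi2 phi1] <-].
have d0 : 0 <= d.
  by rewrite -lee_fin (le_trans _ (small u u2 u1 nsol))// Lnorm_ge0.
have [sphi|nphi] := pselect (solvable a z (weight (- s) phi)); last first.
  by apply: (le_trans (small phi phi2 phi1 nphi)); rewrite lee_fin ler_peMl// ler1n.
pose psi x := 2^-1 * u x; pose chi x := 2^-1 * phi x + psi x.
have half_norm h : inL2 h -> (L2norm h <= 1)%E -> (L2norm (fun x => 2^-1 * h x)%R <= (2^-1)%:E)%E.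
  move=> h2 h1; rewrite L2normZ; last exact: h2.1.
  have -> : Normc.normc (2^-1 : R[i]) = 2^-1 :> R.
    rewrite Normc.normcV (_ : 2 = (2 : R)%:C); last by rewrite rmorph_nat.
    by rewrite normcE /cnorm2/= expr0n addr0 sqrtr_sqr ger0_norm.
  by rewrite -[leRHS]mule1 lee_wpmul2l// lee_fin invr_ge0.
have psi2 : inL2 psi by exact: inL2Z.
have chi2 : inL2 chi by apply: inL2D => //; exact: inL2Z.
have psi1 : (L2norm psi <= 1)%E.
  by apply: (le_trans (half_norm u u2 u1)); rewrite lee_fin invf_le1 ?ler1n.
have chi1 : (L2norm chi <= 1)%E.
  apply: (le_trans (L2normD (inL2Z 2^-1 phi2).1 psi2.1)).
  apply: (le_trans (leeD (half_norm phi phi2 phi1) (half_norm u u2 u1))).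
  by rewrite -EFinD lee_fin; lra.
have npsi : ~ solvable a z (weight (- s) psi).
  move=> sol; apply: nsol; have := solvable_lin 1 sol sol.
  rewrite -weight_lin; congr (solvable a z (weight _ _)); apply/funext => x.
  have half : 2^-1 + 2^-1 = 1 :> R[i] by field.
  by rewrite /psi mul1r -mulrDl half mul1r.
have nchi : ~ solvable a z (weight (- s) chi).
  move=> sol; apply: npsi; have := solvable_lin (- 2^-1) sphi sol.
  rewrite -weight_lin; congr (solvable a z (weight _ _)); apply/funext => x.
  by rewrite /chi mulNr addrA addNr add0r.
have Kchi := Klin 2^-1 phi psi phi2 psi2.
have mK h : inL2 h -> cmeasurable (K h) by move=> /KL2[].
(* Almost everywhere half of [K phi] is [K chi - K psi], of norm at most d + d; doubling gives the
   constant 4. *)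
have phi_le : (L2norm (fun x => 2^-1 * K phi x)%R <= (2 * d)%:E)%E.
  rewrite (@L2norm_aeq _ _ (fun x => K chi x - K psi x)); first last.
  - by apply: filterS Kchi => x ->; rewrite addrK.
  - by apply: cmeasurableB; exact: mK.
  - by apply: cmeasurableM; [exact: cmeasurable_cst|exact: mK].
  have -> : (fun x => K chi x - K psi x) = (fun x => K chi x + (-1) * K psi x).
    by apply/funext => x; rewrite mulN1r.
  have mN : cmeasurable (fun x => (-1) * K psi x).
    by apply: cmeasurableM; [exact: cmeasurable_cst|exact: mK].
  apply: (le_trans (L2normD (mK _ chi2) mN)).
  rewrite L2normZ; last exact: mK.
  rewrite normcN Normc.normc1 mul1e mulrDl mul1r EFinD.
  by apply: leeD; exact: small.
have -> : K phi = (fun x => 2 * (2^-1 * K phi x)).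
  by apply/funext => x; rewrite mulrA divff ?mul1r.
rewrite L2normZ; last by apply: cmeasurableM; [exact: cmeasurable_cst|exact: mK].
have -> : Normc.normc (2 : R[i]) = 2 :> R.
  rewrite (_ : 2 = (2 : R)%:C); last by rewrite rmorph_nat.
  by rewrite normcE /cnorm2/= expr0n addr0 sqrtr_sqr ger0_norm.
rewrite (_ : 4 * d = 2 * (2 * d)); last by ring.
by rewrite EFinM lee_wpmul2l.
Qed.

End symbol.

(** * The Birman-Schwinger argument *)

Section birman_schwinger.
Context {R : realType}.
Notation mu := (@mu3 R).
Implicit Types (x y xi : R3 R) (f g h r fh gh rh u : R3 R -> R[i]).

Lemma energy_le_sqr f (c : R) : 0 <= c -> (L2norm f <= c%:E)%E ->
  (energy f <= (c ^+ 2)%:E)%E.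
Proof.
move=> c0 fc; rewrite -L2norm_energy -powR_mulrn// -poweR_EFin.
by apply: gt0_ler_poweR => //; rewrite in_itv/= leey ?Lnorm_ge0 ?lee_fin ?c0.
Qed.

Lemma opnorm_ge0 (K : (R3 R -> R[i]) -> R3 R -> R[i]) : (0 <= opnorm K)%E.
Proof.
have z2 : inL2 (fun _ : R3 R => 0 : R[i]) by have [] := @plancherel0 R.
apply: le_trans (le_opnorm K z2 _); first exact: Lnorm_ge0.
by rewrite L2normE energy0 poweR0r// invr_neq0.
Qed.

Variables (alpha m s : R) (V : R3 R -> R) (sgn : bool).
Variables (K : (R3 R -> R[i]) -> R3 R -> R[i]) (B E : R).
Hypotheses (alpha0 : 0 < alpha) (m0 : 0 < m) (s0 : 0 <= s) (E0 : E <= 0).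
Hypotheses (mV : measurable_fun setT V) (HK : is_boundary_resolvent (H0 alpha m) s sgn K).
Hypotheses (B0 : 0 <= B) (k0 : 0 < fine (opnorm K)) (Bk : B ^+ 2 * fine (opnorm K) < 1).
Hypothesis VB : {ae mu, forall x, japanese x `^ s * `|V x| `^ 2^-1 <= B}.

Let a := symbol alpha m.
Let k := fine (opnorm K).

Let opnormE : opnorm K = k%:E.
Proof.
have [[_ _ Koo] _] := HK.
by rewrite /k fineK// ge0_fin_numE// opnorm_ge0.
Qed.

Definition potential_mul f x : R[i] := (`|V x|)%:C * f x.

Lemma cmeasurable_potential_mul f : cmeasurable f -> cmeasurable (potential_mul f).
Proof.
by move=> mf; apply: cmeasurableM => //; apply: cmeasurable_real; exact: measurableT_comp.
Qed.

Let cross_potential f x : cross (f x) (potential_mul f x) = `|V x| * cnorm2 (f x).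
Proof.
by rewrite /potential_mul; case: (f x) => p q; rewrite /cross /cnorm2/=; ring.
Qed.

(** |V|^2 is split evenly: one factor |V| joins the weight in the quantity bounded by [B], the other
    joins |f|^2 to form the integrand of <f, |V| f>. *)
Let cnorm2_weight_potential f x : cnorm2 (weight s (potential_mul f) x) =
  (japanese x `^ s * `|V x| `^ 2^-1) ^+ 2 * (`|V x| * cnorm2 (f x)).
Proof.
rewrite /weight /potential_mul !cnorm2M /cnorm2/= !expr0n/= !addr0 exprMn.
rewrite powR12_sqrt// sqr_sqrtr//.
by move: (_ ^+ 2 + _) => N; ring.
Qed.

(** As <x>^s >= 1, the weighted bound also bounds V itself. *)
Let abs_potential_le : {ae mu, forall x, `|V x| <= B ^+ 2}.
Proof.
apply: filterS VB => x Vx.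
have h : `|V x| `^ 2^-1 <= B.
  apply: le_trans Vx; rewrite ler_peMl ?powR_ge0// -[leLHS](powRr0 (japanese x)).
  by apply: ler_powR => //; exact: japanese_ge1.
rewrite -[leLHS]sqr_sqrtr// -powR12_sqrt//.
by rewrite ler_sqr ?nnegrE ?powR_ge0.
Qed.

Lemma inL2_weight_potential f : inL2 f -> inL2 (weight s (potential_mul f)).
Proof.
move=> f2; have mf := f2.1.
have mu_ := cmeasurable_weight s (cmeasurable_potential_mul mf).
(* In |u|^2 one factor B^2 comes from the weighted square root and another from |V|, so |u| <= B^2
   |f| pointwise almost everywhere. *)
have f2' : inL2 (fun x => (B ^+ 2)%:C * f x) by exact: inL2Z.
apply/inL2P; split => //; have [_ +] := (inL2P _).1 f2'.
apply: le_lt_trans; apply: ae_ge0_le_integral => //.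
- by move=> x _; rewrite lee_fin cnorm2_ge0.
- exact: measurable_ecnorm2.
- by move=> x _; rewrite lee_fin cnorm2_ge0.
- exact: measurable_ecnorm2 f2'.1.
apply: filterS2 VB abs_potential_le => x Vx Vx2 _.
rewrite lee_fin cnorm2_weight_potential cnorm2M [X in _ <= X * _]/cnorm2/= expr0n addr0.
rewrite mulrA ler_wpM2r ?cnorm2_ge0// expr2.
apply: ler_pM; rewrite ?sqr_ge0 ?normr_ge0//.
by rewrite ler_sqr ?nnegrE// mulr_ge0 ?powR_ge0.
Qed.

Let unit_energy_le f : inL2 f -> inL2 (potential_mul f) ->
  energy (weight s (potential_mul f)) = 1%E -> 1 <= B ^+ 2 * rinner f (potential_mul f).
Proof.
move=> f2 g2 u1; have u2 := inL2_weight_potential f2.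
have ic := integrable_cross f2 g2.
have -> : 1 = fine (energy (weight s (potential_mul f))) :> R by rewrite u1.
rewrite /rinner -RintegralZl//; apply: le_Rintegral_ae.
- exact: integrable_cnorm2.
- exact: (integrableZl measurableT (B ^+ 2) ic).
apply: filterS VB => x Vx; rewrite cnorm2_weight_potential cross_potential.
rewrite ler_wpM2r ?mulr_ge0 ?cnorm2_ge0//.
by rewrite ler_sqr ?nnegrE// mulr_ge0 ?powR_ge0.
Qed.

(** The spectral shift enters squared, so the limits from above and from below share one
    estimate. *)
Let defect_sign (b : bool) (t : R) fh :
  defect a E ((-1) ^+ b * t) fh = defect a E t fh.
Proof. by apply/funext => xi; rewrite /defect exprMn sqrr_sign mul1r. Qed.

Let rinner_le_opnorm f fh : fourierL2 f fh ->
  fourierL2 (potential_mul f) (fun xi => (a xi - E)%:C * fh xi) ->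
  energy (weight s (potential_mul f)) = 1%E ->
  rinner f (potential_mul f) <= k.
Proof.
move=> Ff Fg u1; set g := potential_mul f in Fg u1 *; set u := weight s g in u1 *.
have [f2 fh2 _] := Ff; have [g2 gh2 _] := Fg.
have u2 : inL2 u by exact: inL2_weight_potential.
have nu1 : (L2norm u <= 1)%E by rewrite L2normE u1 poweR1r.
have ma : measurable_fun setT a by exact: measurable_symbol.
have a0 xi : 0 <= a xi by exact: symbol_ge0.
have [bK Klim] := HK; have [KL2 _ _] := bK.
(* Half of [e2] pays for the distance between the weighted resolvent and [K], half for the defect.
   The bound [k / 8] on [d] ensures 4 d < k, as [weighted_resolvent_solvable] asks. *)
apply/ler_addgt0Pr => e2 e20; pose e := e2 / 2; have e0 : 0 < e by exact: divr_gt0.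
pose d := Num.min e (k / 8); have d0 : 0 < d by rewrite lt_min e0 divr_gt0.
have := Klim => /fine_cvgP[Kfin /cvgrPdist_le/(_ d d0) Kd].
(* The limit as eps decreases to 0 is sampled along 1/(n+1), the sequence of [cvg_defect]. *)
have Kn : \forall n \near \oo, (opnorm (fun f x => weighted_resolvent (H0 alpha m) s
    (0 +i* ((-1) ^+ sgn * n.+1%:R^-1)) f x - K f x)%R <= d%:E)%E.
  have h0 : (n.+1%:R^-1 : R) @[n --> \oo] --> 0 by exact: cvg_harmonic.
  have [N _ hN] := h0 _ (filterI Kfin Kd); exists N => // n Nn.
  have [/= fin] := hN n Nn (harmonic_gt0 n); rewrite sub0r normrN => le; rewrite -(fineK fin) lee_fin.
  exact: le_trans (ler_norm _) le.
have Dn := cvg_defect a0 ma E0 fh2 gh2 (ae_symbol_gt0 alpha0 m0).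
have /cvgrPdist_le/(_ e e0) Dn' := Dn.
have [n _ /(_ n (leqnn n))[/= Kdn De]] := filterI Kn Dn'.
set t : R := (-1) ^+ sgn * n.+1%:R^-1 in Kdn.
have t0 : t != 0 by rewrite mulf_neq0 ?signr_eq0 ?invr_eq0.
(* [g] is the weight [- s] applied to the unit vector [u], so closeness to [K] puts it in the
   range. *)
have sol : solvable a (0 +i* t) g.
  rewrite -(weightK s g); apply: (weighted_resolvent_solvable bK Kdn) => //.
  rewrite opnormE lte_fin; apply: (@le_lt_trans _ _ (4 * (k / 8))).
    by rewrite ler_wpM2l// ge_min lexx orbT.
  by have := k0; rewrite -/k; lra.
have [h [Tr gE]] := resolventP sol; set r := resolvent _ _ _ in Tr gE.
have [rh [Fr Fg']] := fourier_equation Tr gE g2.1.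
have := rinner_resolvent_ge a0 ma E0 t0 Ff Fg Fr Fg'.
have r2 : inL2 r by have [] := Fr.
have wrE : weighted_resolvent (H0 alpha m) s (0 +i* t) u = weight (- s) r.
  by rewrite /weighted_resolvent /u weightK.
have -> : rinner r g = rinner (weight (- s) r) u.
  by apply: eq_Rintegral => x _; rewrite cross_weight.
have -> : weight (- s) r = (fun x => K u x + (weight (- s) r x - K u x)).
  by apply/funext => x; rewrite addrC subrK.
have wr2 : inL2 (weight (- s) r) by exact: inL2_weight.
have Ku2 : inL2 (K u) by exact: KL2.
have d2 : inL2 (fun x => weight (- s) r x - K u x) by exact: inL2B.
rewrite rinnerD//.
have b1 : rinner (K u) u <= k.
  apply: rinner_le => //; last by rewrite u1.
  by apply: energy_le_sqr; [exact: ltW|rewrite -opnormE; exact: le_opnorm].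
have b2 : rinner (fun x => weight (- s) r x - K u x) u <= e.
  apply: rinner_le => //; last by rewrite u1.
  apply: energy_le_sqr; first exact: ltW.
  rewrite -wrE; apply: (@le_trans _ _ d%:E); last by rewrite lee_fin ge_min lexx.
  apply: le_trans Kdn.
  exact: (le_opnorm (fun f x => weighted_resolvent (H0 alpha m) s (0 +i* t) f x - K f x)).
have b3 : \int[mu]_xi defect a E t fh xi <= e.
  rewrite defect_sign; apply: le_trans De; rewrite sub0r normrN; exact: ler_norm.
move=> /le_trans; apply.
have -> : k + e2 = (k + e) + e by rewrite /e; lra.
by apply: lerD => //; apply: lerD.
Qed.

(** Otherwise 1 <= B^2 <f, |V| f> <= B^2 k < 1. *)
Lemma no_unit_eigenfunction f fh : fourierL2 f fh ->
  fourierL2 (potential_mul f) (fun xi => (a xi - E)%:C * fh xi) ->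
  energy (weight s (potential_mul f)) <> 1%E.
Proof.
move=> Ff Fg u1; have [f2 _ _] := Ff; have [g2 _ _] := Fg.
have h1 := unit_energy_le f2 g2 u1; have h2 := rinner_le_opnorm Ff Fg u1.
have : 1 <= B ^+ 2 * k by rewrite (le_trans h1)// ler_wpM2l// sqr_ge0.
by rewrite leNgt Bk.
Qed.

Lemma no_eigenvalue : ~ is_eigenvalue (add_potential (H0 alpha m) (fun x => - `|V x|)) E%:C.
Proof.
move=> [f [fn0 [h [[fh [Ff Fh]] Eh]]]]; have [f2 fh2 _] := Ff.
have mg := cmeasurable_potential_mul f2.1.
have ma : measurable_fun setT a by exact: measurable_symbol.
have a0 xi : 0 <= a xi by exact: symbol_ge0.
(* The eigenvalue equation for H_0 - |V| reads |V| f = (H_0 - E) f. *)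
have Fg : fourierL2 (potential_mul f) (fun xi => (a xi - E)%:C * fh xi).
  have gE : aeq (potential_mul f) (fun x => h x - E%:C * f x).
    apply: filterS Eh => x ->; rewrite /potential_mul rmorphN/= mulNr.
    by rewrite opprD opprK addrA subrr add0r.
  have [rh [Frh Fg]] := fourier_equation (a := a) (ex_intro _ fh (conj Ff Fh)) gE mg.
  have rhfh := fourierL2_unique Frh Ff (aeq_refl f).
  apply: (fourierL2_aeq Fg (aeq_refl _)) => //.
    by apply: filterS rhfh => xi ->; rewrite (rmorphB _ (a xi)).
  apply: cmeasurableM; last exact: fh2.1.
  by apply: cmeasurable_real; exact: measurable_funB.
have [g2 gh2 _] := Fg.
set u := weight s (potential_mul f); have u2 : inL2 u by exact: inL2_weight_potential.
(* If u = 0 then |V| f = 0 and (a - E) [fh] = 0; since a > 0 >= E almost everywhere, [fh] and hence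
   [f] vanish, against the choice of [f]. *)
have [u0|un0] := eqVneq (energy u) 0%E.
  apply: fn0; apply: energy_eq0; first exact: f2.1.
  have g0 : aeq (potential_mul f) (fun=> 0).
    apply: filterS (energy_eq0 u2.1 u0) => x ux.
    by rewrite -(weightK s (potential_mul f)) -/u /weight ux mulr0.
  have gh0 : energy (fun xi => (a xi - E)%:C * fh xi) = 0%E.
    by rewrite -(fourierL2_isometry Fg) (energy_aeq mg (cmeasurable_cst 0) g0) energy0.
  rewrite (fourierL2_isometry Ff) (energy_aeq fh2.1 (cmeasurable_cst 0)) ?energy0//.
  apply: filterS2 (energy_eq0 gh2.1 gh0) (ae_symbol_gt0 alpha0 m0) => xi /eqP.
  rewrite mulf_eq0 => /orP[/eqP aE|/eqP//] axi; exfalso.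
  have {}aE : a xi - E = 0 by apply: complexI; exact: aE.
  by move/eqP: aE axi; rewrite subr_eq0 => /eqP; rewrite /a => ->; rewrite ltNge E0.
(* The equation is linear, so [f] may be rescaled to make |u| = 1. *)
pose t : R := (Num.sqrt (fine (energy u)))^-1.
apply: (@no_unit_eigenfunction (fun x => t%:C * f x) (fun xi => t%:C * fh xi)).
- exact: fourierL2Z.
- have := fourierL2Z t%:C Fg; congr fourierL2; apply/funext => x.
    by rewrite /potential_mul mulrCA.
  by rewrite mulrCA.
have -> : weight s (potential_mul (fun x => t%:C * f x)) = (fun x => t%:C * u x).
  by apply/funext => x; rewrite /u /weight /potential_mul; ring.
have fu : 0 < fine (energy u).
  by rewrite fine_gt0// lt0e un0 energy_ge0/=; case/inL2P: u2.
rewrite energyM; last exact: u2.1.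
rewrite -(fineK (inL2_fin_num u2)) -EFinM; congr EFin.
rewrite /cnorm2/= expr0n addr0 /t exprVn sqr_sqrtr ?(ltW fu)//.
by rewrite mulVf// gt_eqF.
Qed.

End birman_schwinger.

Theorem theorem4p9 (R : realType) (alpha m : R) (V : R3 R -> R) (sgn : bool)
  (halpha : 1 < alpha < 2) (hm : 0 < m)
  (mV : measurable_fun [set: R3 R] V)
  (V_le0 : {ae mu3, forall x : R3 R, V x <= 0})
  (hV : exists s : R, 1 < s /\
     exists K : (R3 R -> R[i]) -> (R3 R -> R[i]),
       is_boundary_resolvent (H0 alpha m) s sgn K /\
       ('N[mu3]_(+oo)[EFin \o (fun x => japanese x `^ s * `|V x| `^ 2^-1)%R]
        < (fine (opnorm K) `^ (- 2^-1))%:E)%E) :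
  (forall E : R, E <= 0 -> ~ is_eigenvalue (add_potential (H0 alpha m) V) E%:C) /\
  ~ is_eigenvalue (add_potential (H0 alpha m) V) 0.
Proof.
suff main (E : R) : E <= 0 -> ~ is_eigenvalue (add_potential (H0 alpha m) V) E%:C.
  by split => //; exact: (main 0).
move=> E0; have [s [s1 [K [HK VK]]]] := hV.
have alpha0 : 0 < alpha by case/andP: halpha => /(lt_trans _)->.
set b := (fun x => _)%R in VK; set N := Lnorm _ _ _ in VK.
have N0 : (0 <= N)%E by exact: Lnorm_ge0.
have k_ge0 : 0 <= fine (opnorm K) by rewrite fine_ge0// opnorm_ge0.
(* [0 `^ r = 0] for [r != 0], so [VK] would fail. *)
have k0 : 0 < fine (opnorm K).
  rewrite lt_neqAle k_ge0 andbT eq_sym; apply/eqP => k0.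
  by move: VK; rewrite k0 powR0 ?oppr_eq0 ?invr_eq0// ltNge N0.
have Nfin : N \is a fin_num by rewrite ge0_fin_numE// (lt_trans VK)// ltry.
pose B := fine N; have B0 : 0 <= B by rewrite fine_ge0.
have Bk : B ^+ 2 * fine (opnorm K) < 1.
  have : B < fine (opnorm K) `^ (- 2^-1) by rewrite -lte_fin fineK.
  rewrite powRN powR12_sqrt// => BK.
  have sk0 : 0 < Num.sqrt (fine (opnorm K)) by rewrite sqrtr_gt0.
  rewrite -[X in _ * X]sqr_sqrtr// -exprMn expr_lt1// ?mulr_ge0 ?sqrtr_ge0//.
  by rewrite -ltr_pdivlMr// mul1r.
have VB : {ae mu3, forall x : R3 R, japanese x `^ s * `|V x| `^ 2^-1 <= B}.
  have b0 x : 0 <= b x by rewrite mulr_ge0 ?powR_ge0.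
  (* The norm with exponent +oo unfolds to the essential supremum only on a space of positive
     measure; on a null space the claim is vacuous. *)
  have [mT|] := ltP 0%E (mu3 [set: R3 R]); last first.
    move=> mT; exists setT; split => //.
    by apply/eqP; rewrite eq_le mT measure_ge0.
  have NE : N = ess_sup mu3 (abse \o (EFin \o b)).
    by rewrite /N unlock mT.
  have := ess_sup_ge mu3 (abse \o (EFin \o b)); rewrite -NE.
  apply: filterS => x; rewrite /= -(fineK Nfin) lee_fin ger0_norm//.
have s0 : 0 <= s by exact: ltW (lt_trans ltr01 s1).
(* [no_eigenvalue] concerns the potential - |V|, which equals V almost everywhere because V <= 0
   there. *)
apply: contra_not (no_eigenvalue alpha0 hm s0 E0 mV HK B0 k0 Bk VB).
move=> [f [fn0 [h [Hf Eh]]]]; exists f; split => //; exists h; split => //.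
by apply: filterS2 Eh V_le0 => x -> Vx; rewrite ler0_norm// opprK.
Qed.
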